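(* There exist a constant $c_{\mathcal Q}>0$, an integer $n_{\mathcal Q}\geq 1$ (both depending only on $\mathcal Q$) and a continuous function $w_0:(0,+\infty)^2\to\mathbb R$, satisfying $$\frac{2}{\pi} \arctan\left(\frac{ (e^{k_0}-1)^{n_{\mathcal Q} }} {\sqrt{(e^{k^\star}-1)^{2n_{\mathcal Q}} - (e^{k_0}-1)^{2n_{\mathcal Q} } }}\right) \leq w_0(k^\star, k_0)\leq \frac{2}{\pi} \arctan\left(\inf\left\{\frac{k_0}{\sqrt{(k^\star)^2- k_0^2}},\ \frac{ e^{k_0 n_{\mathcal Q}}}{\sqrt{e^{2k^\star n_{\mathcal Q}}- e^{2k_0 n_{\mathcal Q}}} }\right\}\right)$$ for all $k^\star>0$ and $k_0\in(0,k^\star]$, such that the following holds. Let $q,\tilde q\in\mathcal Q$, and let $(d,\tilde d)$ be either $(d_+,\tilde d_+)$ or $(d_-,\tilde d_-)$, the boundary measurements associated with $q$ and $\tilde q$ respectively. Assume $\|d-\tilde d\|_{L^\infty(0,+\infty)}<1$, and let $k^\star\in\mathbb R_+$ be the smallest value satisfying $|d(k^\star)-\tilde d(k^\star)|=\|d-\tilde d\|_{L^\infty(0,+\infty)}$, with $k^\star>0$. Then $$\| q- \tilde q \|_{L^\infty(\mathbb R)}\leq c_{\mathcal Q}\, \|d -\tilde d \|_{L^\infty(0,k_0)}^{\frac{m}{m+1}w_0(k^\star, k_0)}\qquad\text{for all } k_0>0.$$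
   Context: Fix an integer $m\ge 4$, $M>0$, $n_0\in(0,1)$, and $q_0\in C_0^{m+1}([0,1])$ with $1+q_0\ge n_0$ on $\mathbb R$. Here $C_0^{m+1}([0,1])$ denotes the real-valued functions of class $C^{m+1}$ on $\mathbb R$ that vanish outside $[0,1]$. Set $$\mathcal Q=\{q\in C_0^{m+1}([0,1]):\ \|q-q_0\|_{C^{m+1}([0,1])}\le M,\ n_0\le 1+q\}.$$ Constants with subscript $\mathcal Q$ depend only on $\mathcal Q$ (i.e. on $n_0,m,M,q_0$). For $q\in\mathcal Q$ and real $k\neq 0$, let $\phi_\pm(x,k)=e^{\pm ikx}+\psi_\pm(x,k)$ be the unique solutions of $\phi_\pm''+k^2(1+q)\phi_\pm=0$ on $\mathbb R$ (primes are $x$-derivatives) such that $\psi_\pm'-ik\psi_\pm=0$ for $x\ge1$ and $\psi_\pm'+ik\psi_\pm=0$ for $x\le 0$. These solutions exist and never vanish. The impedance functions are $p_\pm(x,k)=\pm\frac{\phi_\pm'(x,k)}{ik\,\phi_\pm(x,k)}$, and the boundary measurements are $d_+(k)=p_+(0,k)$ and $d_-(k)=p_-(1,k)$, extended by continuity to $k=0$. Quantities with a tilde correspond to $\tilde q$. Convention: when $k_0=k^\star$ the quotients with zero denominator are $+\infty$ and $\arctan(+\infty)=\pi/2$. *)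

(* Defs.v *)
From HB Require Import structures.
From mathcomp Require Import all_boot all_order all_algebra.
From mathcomp Require Import complex.
From mathcomp Require Import all_classical all_reals all_analysis.

Set Implicit Arguments.
Unset Strict Implicit.
Unset Printing Implicit Defensive.

Import Order.TTheory GRing.Theory Num.Theory.
Import numFieldNormedType.Exports.

Local Open Scope classical_set_scope.
Local Open Scope ring_scope.

Section Potentials.
Variable R : realType.
Implicit Types (q f : R -> R) (A : set R).

Definition class_C (n : nat) f : Prop :=
  (forall j : nat, (j < n)%N -> forall x, derivable (derive1n j f) x 1) /\
  continuous (derive1n n f).

Definition C0_01 (n : nat) f : Prop :=
  class_C n f /\ forall x, x \notin `[0, 1] -> f x = 0.

Definition Cnorm_01 (n : nat) f : \bar R :=
  (\sum_(j < n.+1)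
     ereal_sup [set `|derive1n j f x|%:E | x in [set` `[0%R, 1%R]]])%E.

Definition admissible (m : nat) (M n0 : R) (q0 q : R -> R) : Prop :=
  [/\ C0_01 m.+1 q,
      (Cnorm_01 m.+1 (fun x => q x - q0 x)%R <= M%:E)%E
    & forall x, n0 <= 1 + q x].

(* The zero extension outside A does not change the essential supremum of
   the absolute value over A. *)
Definition Linfty A f : \bar R :=
  Lnorm (@lebesgue_measure R) +oo%E ((EFin \o f) \_ A).

End Potentials.

Section Scattering.
Variable R : realType.
Local Open Scope complex_scope.
Implicit Types (f phi d : R -> R[i]) (q : R -> R).

(* Derivatives of complex-valued functions of a real variable are taken
   componentwise. *)
Definition complex_derivable f (x : R) : Prop :=
  derivable (fun y => complex.Re (f y)) x 1 /\ derivable (fun y => complex.Im (f y)) x 1.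

Definition complex_derive1 f (x : R) : R[i] :=
  derive1 (fun y => complex.Re (f y)) x +i* derive1 (fun y => complex.Im (f y)) x.

Definition expi (t : R) : R[i] := cos t +i* sin t.

Inductive side := side_plus | side_minus.

Definition sgn (s : side) : R := if s is side_plus then 1 else -1.

(* d_+ is measured at x = 0 and d_- at x = 1. *)
Definition endpoint (s : side) : R := if s is side_plus then 0 else 1.

Definition scattering_solution (s : side) q (k : R) phi : Prop :=
  let psi := fun x => phi x - expi (sgn s * k * x) in
  [/\ forall x, complex_derivable phi x /\ complex_derivable (complex_derive1 phi) x,
      forall x, complex_derive1 (complex_derive1 phi) x + (k ^+ 2 * (1 + q x))%:C * phi x = 0,
      forall x, 1 <= x -> complex_derive1 psi x - (0 +i* k) * psi x = 0
    & forall x, x <= 0 -> complex_derive1 psi x + (0 +i* k) * psi x = 0].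

Definition impedance (s : side) (k : R) phi (x : R) : R[i] :=
  (sgn s)%:C * (complex_derive1 phi x / ((0 +i* k) * phi x)).

(* The scattering solution is unique and never vanishes, so this predicate
   determines d; the last two clauses extend d by continuity to k = 0. *)
Definition boundary_measurement (s : side) q d : Prop :=
  [/\ forall k : R, k != 0 -> exists2 phi, scattering_solution s q k phi
        & d k = impedance s k phi (endpoint s),
      complex.Re (d k) @[k --> 0^'] --> complex.Re (d 0)
    & complex.Im (d k) @[k --> 0^'] --> complex.Im (d 0)].

Definition dist_meas d d' (k : R) : R := Normc.normc (d k - d' k).

End Scattering.

Section Exponent.
Variable R : realType.

Definition equot (a b : R) : \bar R :=
  if b == 0 then +oo%E else (a / b)%:E.

Definition eatan (x : \bar R) : R :=
  match x with
  | r%:E => atan r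
  | +oo%E => pi / 2
  | -oo%E => - (pi / 2)
  end.

Definition w0_lower (n : nat) (kstar k0 : R) : R :=
  2 / pi * eatan (equot ((expR k0 - 1) ^+ n)
    (Num.sqrt ((expR kstar - 1) ^+ (2 * n) - (expR k0 - 1) ^+ (2 * n)))).

Definition w0_upper (n : nat) (kstar k0 : R) : R :=
  2 / pi * eatan (ereal_inf
    [set equot k0 (Num.sqrt (kstar ^+ 2 - k0 ^+ 2));
         equot (expR (k0 * n%:R))
           (Num.sqrt (expR (2 * kstar * n%:R) - expR (2 * k0 * n%:R)))]).

End Exponent.

(* Main.v *)
Require Import Defs.
From HB Require Import structures.
From mathcomp Require Import all_boot all_order all_algebra.
From mathcomp Require Import complex.
From mathcomp Require Import all_classical all_reals all_analysis.
From mathcomp Require Import qpoly ess_sup_inf.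
From mathcomp Require Import ring lra zify.

(** Let r = (1 + q)^(1/4), let s = r' / r and let tau be the travel time, the
    primitive of r^2. For a wave u of frequency k and its flux v = u' / (i k),
    the amplitudes al and be in u = (al + be) e^(i k tau) / r and
    v = r (al - be) e^(i k tau) solve al' = s be and be' = s al - 2 i k r^2 be.
    Since q vanishes outside [0, 1], the wave that leaves through x = 1 can be
    normalised to al 1 = 1 and be 1 = 0, and the impedance at x = 0 is
    (al 0 - be 0) / (al 0 + be 0); the measurement at x = 1 is reduced to this
    one by a reflection.

    The main tool is [transport]. For finitely many frequencies k_j and weights
    c_j, the sums of c_j e^(i k_j t) (al_j x - 1) and of c_j e^(i k_j t) be_j x
    are bounded by a multiple of M t as soon as the sum of the c_j e^(i k_j t)
    is bounded by M1 + M, where M1 is minus the derivative of M. These sums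
    solve a hyperbolic system whose coupling is integrated along the
    characteristics, so that no kernel representation is needed. The estimate
    passes to products of amplitudes of two media, and is used twice.

    Stability for all frequencies ([local_estimate], [contrast_stability]). The
    Wronskian of the waves in two media vanishes at x = 1, is at x = 0 the
    difference of the impedances up to nonvanishing factors, and has a derivative
    linear in the contrast r / r' - r' / r. Summed over frequencies against a
    Fejer kernel centred at the travel time of a point x0, it isolates the
    contrast at x0: the correction given by [transport] is a small tail on one
    side of x0 and a Volterra term on the other, which an exponential weight
    absorbs. If the measurements differ by at most eps, the contrast is at most a
    multiple of (eps + 1 / N) (1 + ln N); for N of the order of 1 / eps, the
    logarithm is absorbed into the power m / (m + 1) ([contrast_hoelder]).

    Extrapolation in the frequency ([defect_extrapolation],
    [propagation_power]). With a constant M, [transport] says that a linear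
    combination of the values of the difference of the measurements, cleared of
    denominators, is bounded by the same combination of exponentials over the
    range of travel times. Lagrange extrapolation from Chebyshev nodes below k0 to
    kstar has a total weight at most e^N with e = z + sqrt (z^2 - 1), where z - 1
    is the distance to kstar on the scale of min (k0, 1) / 4, and a remainder
    with a factorial. If the difference of the measurements is at most eta below
    k0, balancing both bounds it by a power eta^(theta / e) at kstar, where the
    difference is largest by assumption.

    The exponent w0 is the prescribed lower bound itself, with n = 400. It is
    at most theta / e ([hoelder_exponent_rate]) because its distance to 1 has the
    same square root behaviour near the diagonal with a larger factor, and because far
    from the diagonal it decays like a high power of theta / e. The two estimates
    then combine ([potential_hoelder]). *)

Import Order.TTheory GRing.Theory Num.Theory.
Import numFieldNormedType.Exports.

Local Open Scope classical_set_scope.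
Local Open Scope ring_scope.

Set Implicit Arguments.
Unset Strict Implicit.
Unset Printing Implicit Defensive.
Local Open Scope complex_scope.

Local Notation Re := complex.Re.
Local Notation Im := complex.Im.
Local Notation normc := Normc.normc.
Local Notation "'ii'" := (Complex 0 1).

(** * Derivatives of real and complex functions of a real variable *)
Section RealCalculus.
Variable R : realType.
Implicit Types (f g : R -> R) (x y a b d e : R).

Definition rder f x d := is_derive x (1 : R) f d.

Lemma rder_eq f x d e : rder f x d -> d = e -> rder f x e.
Proof. by move=> h <-. Qed.
Lemma rder_cst x a : rder (fun _ => a) x 0.
Proof. exact: is_derive_cst. Qed.
Lemma rder_id x : rder (fun y => y) x 1.
Proof. exact: is_derive_id. Qed.
Lemma rderD f g x d e : rder f x d -> rder g x e -> rder (fun y => f y + g y) x (d + e).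
Proof. exact: is_deriveD. Qed.
Lemma rderN f x d : rder f x d -> rder (fun y => - f y) x (- d).
Proof. exact: is_deriveN. Qed.
Lemma rderB f g x d e : rder f x d -> rder g x e -> rder (fun y => f y - g y) x (d - e).
Proof. exact: is_deriveB. Qed.
Lemma rderM f g x d e :
  rder f x d -> rder g x e -> rder (fun y => f y * g y) x (d * g x + f x * e).
Proof.
move=> hf hg; apply: (rder_eq (is_deriveM hf hg)).
by rewrite addrC /GRing.scale /= [g x * d]mulrC.
Qed.
Lemma rder_comp f g x d e :
  rder f (g x) d -> rder g x e -> rder (fun y => f (g y)) x (d * e).
Proof. by move=> hf hg; apply: (rder_eq (is_derive1_comp hf hg)). Qed.
Lemma rderV f x d : f x != 0 -> rder f x d -> rder (fun y => (f y)^-1) x (- d / f x ^+ 2).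
Proof.
move=> f0 h; apply: (rder_eq (is_deriveV f0 h)).
by rewrite /GRing.scale /= mulrC mulrN mulNr.
Qed.
Lemma rderX f n x d : rder f x d -> rder (fun y => f y ^+ n.+1) x (n.+1%:R * f x ^+ n * d).
Proof.
move=> h; elim: n => [|n ih]; first by rewrite expr0 !mul1r.
under eq_fun do rewrite exprS.
by apply: (rder_eq (rderM h ih)); rewrite exprS -(natr1 n.+1); ring.
Qed.

Lemma rder_continuous f x d : rder f x d -> {for x, continuous f}.
Proof. by case=> h _; apply/differentiable_continuous; rewrite -derivable1_diffP. Qed.

(** Every integral estimate below is replaced by this comparison: exhibit a
    primitive of the bound and differentiate. *)
Lemma rder_nondecreasing f f' a b :
  (forall y, a <= y <= b -> rder f y (f' y)) ->
  (forall y, a <= y <= b -> 0 <= f' y) -> a <= b -> f a <= f b.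
Proof.
move=> df f0 ab.
apply: (@ger0_derive1_ndecr R f a b) => //.
- move=> y; rewrite in_itv /= => /andP[/ltW ay /ltW yb].
  by have [] := df y; rewrite ?ay ?yb.
- move=> y; rewrite in_itv /= => /andP[/ltW ay /ltW yb].
  have h : a <= y <= b by rewrite ay yb.
  by have [_ e] := df y h; rewrite derive1E e f0.
- apply: continuous_in_subspaceT => y; rewrite inE /= in_itv /= => h.
  exact: rder_continuous (df y h).
Qed.

End RealCalculus.

Section ComplexCalculus.
Variable R : realType.
Implicit Types (f g : R -> R[i]) (x y a b : R) (z w d e : R[i]).

Definition cder f x d :=
  rder (fun y => Re (f y)) x (Re d) /\ rder (fun y => Im (f y)) x (Im d).

Lemma ReD z w : Re (z + w) = Re z + Re w. Proof. by case: z; case: w. Qed.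
Lemma ImD z w : Im (z + w) = Im z + Im w. Proof. by case: z; case: w. Qed.
Lemma ReM z w : Re (z * w) = Re z * Re w - Im z * Im w. Proof. by case: z; case: w. Qed.
Lemma ImM z w : Im (z * w) = Re z * Im w + Im z * Re w. Proof. by case: z; case: w. Qed.
Lemma ReN z : Re (- z) = - Re z. Proof. by case: z. Qed.
Lemma ImN z : Im (- z) = - Im z. Proof. by case: z. Qed.
Definition reimE := (ReD, ImD, ReM, ImM, ReN, ImN).

Lemma complexP z w : Re z = Re w -> Im z = Im w -> z = w.
Proof. by case: z => a b; case: w => c e /= -> ->. Qed.

Lemma normcD z w : normc (z + w) <= normc z + normc w.
Proof. exact: complex.le_normcD. Qed.
Lemma normcM z w : normc (z * w) = normc z * normc w.
Proof. exact: Normc.normcM. Qed.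
Lemma normcN z : normc (- z) = normc z.
Proof. exact: complex.normcN. Qed.
Lemma normcB z w : normc (z - w) <= normc z + normc w.
Proof. by rewrite -(normcN w) normcD. Qed.
Lemma normc_ge0 z : 0 <= normc z.
Proof. by case: z => a b; rewrite /Normc.normc sqrtr_ge0. Qed.
Lemma normc_sqr z : normc z ^+ 2 = Re z ^+ 2 + Im z ^+ 2.
Proof. by case: z => a b; rewrite /Normc.normc sqr_sqrtr // addr_ge0 ?sqr_ge0. Qed.
Lemma Re_le_normc z : `|Re z| <= normc z.
Proof.
by rewrite -ler_sqr ?nnegrE ?normc_ge0 // normc_sqr real_normK ?num_real // lerDl sqr_ge0.
Qed.
Lemma normc_real a : normc a%:C = `|a|.
Proof. by rewrite /Normc.normc /= expr0n /= addr0 sqrtr_sqr. Qed.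
Lemma normc_expi a : normc (expi a) = 1.
Proof. by rewrite /Normc.normc /= cos2Dsin2 sqrtr1. Qed.
Lemma normc_ii : normc ii = 1 :> R.
Proof. by rewrite /Normc.normc expr0n expr1n /= add0r sqrtr1. Qed.
Lemma expi0 : expi 0 = 1 :> R[i].
Proof. by rewrite /expi cos0 sin0. Qed.
Lemma expiD a b : expi (a + b) = expi a * expi b.
Proof. by apply: complexP; rewrite !reimE /= ?cosD ?sinD // addrC [_ * sin b]mulrC mulrC. Qed.
Lemma normc_sum (I : Type) (r : seq I) (P : pred I) (F : I -> R[i]) :
  normc (\sum_(i <- r | P i) F i) <= \sum_(i <- r | P i) normc (F i).
Proof.
elim/big_rec2: _ => [|i y z _ h]; first by rewrite Normc.normc0.
by apply: le_trans (normcD _ _) _; rewrite lerD2l.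
Qed.

Lemma cder_eq f x d e : cder f x d -> d = e -> cder f x e.
Proof. by move=> h <-. Qed.
Lemma cder_cst x z : cder (fun _ => z) x 0.
Proof. split; exact: rder_cst. Qed.
Lemma cderD f g x d e : cder f x d -> cder g x e -> cder (fun y => f y + g y) x (d + e).
Proof.
move=> [f1 f2] [g1 g2]; split.
- by under eq_fun do rewrite ReD; rewrite ReD; apply: rderD.
- by under eq_fun do rewrite ImD; rewrite ImD; apply: rderD.
Qed.
Lemma cderN f x d : cder f x d -> cder (fun y => - f y) x (- d).
Proof.
move=> [f1 f2]; split.
- by under eq_fun do rewrite ReN; rewrite ReN; apply: rderN.
- by under eq_fun do rewrite ImN; rewrite ImN; apply: rderN.
Qed.
Lemma cderB f g x d e : cder f x d -> cder g x e -> cder (fun y => f y - g y) x (d - e).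
Proof. by move=> hf hg; apply: cderD => //; exact: cderN. Qed.
Lemma cderM f g x d e :
  cder f x d -> cder g x e -> cder (fun y => f y * g y) x (d * g x + f x * e).
Proof.
move=> [f1 f2] [g1 g2]; split.
- under eq_fun do rewrite ReM.
  by apply: rder_eq; [apply: rderB; apply: rderM; eassumption | rewrite !reimE; ring].
- under eq_fun do rewrite ImM.
  by apply: rder_eq; [apply: rderD; apply: rderM; eassumption | rewrite !reimE; ring].
Qed.
Lemma cder_real (h : R -> R) x a : rder h x a -> cder (fun y => (h y)%:C) x a%:C.
Proof. by move=> H; split => //=; exact: rder_cst. Qed.
Lemma cder_expi (h : R -> R) x a :
  rder h x a -> cder (fun y => expi (h y)) x (ii * a%:C * expi (h x)).
Proof.
move=> H; split => /=.
- by apply: rder_eq; [apply: rder_comp H; exact: is_derive_cos | ring].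
- by apply: rder_eq; [apply: rder_comp H; exact: is_derive_sin | ring].
Qed.
Lemma cder_sum (I : Type) (r : seq I) (F : I -> R -> R[i]) (D : I -> R[i]) x :
  (forall i, cder (F i) x (D i)) ->
  cder (fun y => \sum_(i <- r) F i y) x (\sum_(i <- r) D i).
Proof.
move=> h; elim: r => [|i r ih].
  by under eq_fun do rewrite big_nil; rewrite big_nil; exact: cder_cst.
by under eq_fun do rewrite big_cons; rewrite big_cons; apply: cderD.
Qed.
Lemma cder_comp (f : R -> R[i]) (h : R -> R) x a d :
  cder f (h x) d -> rder h x a -> cder (fun y => f (h y)) x (d * a%:C).
Proof.
move=> [h1 h2] H; split; rewrite !reimE /= mulr0 ?subr0 ?add0r.
- exact: (@rder_comp _ (fun y => Re (f y))).
- exact: (@rder_comp _ (fun y => Im (f y))).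
Qed.
Lemma cder_conj f x d : cder f x d -> cder (fun y => conjc (f y)) x (conjc d).
Proof.
move=> [h1 h2]; split.
  by rewrite (_ : (fun y => _) = fun y => Re (f y)); [case: d h1 {h2}
    | apply/funext => y; case: (f y)].
rewrite (_ : (fun y => _) = fun y => - Im (f y)); last by apply/funext => y; case: (f y).
by case: d h2 {h1} => /= a b; exact: rderN.
Qed.

(** Rotating the increment of f onto the real axis reduces the complex
    comparison to the real one, without any loss of constant. *)
Lemma cder_mean_value f f' (g g' : R -> R) a b :
  (forall y, a <= y <= b -> cder f y (f' y)) ->
  (forall y, a <= y <= b -> rder g y (g' y)) ->
  (forall y, a <= y <= b -> normc (f' y) <= g' y) ->
  a <= b -> normc (f b - f a) <= g b - g a.
Proof.
move=> df dg le ab; set D := f b - f a.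
have [D0|D0] := eqVneq (normc D) 0.
  rewrite D0 subr_ge0; apply: rder_nondecreasing dg _ ab => y h.
  exact: le_trans (normc_ge0 _) (le y h).
pose w := conjc D * (normc D)^-1%:C.
have wD : Re (w * D) = normc D.
  have key z r : Re (conjc z * r%:C * z) = (Re z ^+ 2 + Im z ^+ 2) * r.
    by case: z => p q; rewrite !reimE /=; ring.
  by rewrite /w key -normc_sqr expr2 mulfK.
have nw : normc w = 1.
  rewrite /w normcM normc_real normfV ger0_norm ?normc_ge0 //.
  rewrite (_ : normc (conjc D) = normc D) ?divff //.
  by case: (D) => p q /=; rewrite sqrrN.
suff : g a - Re (w * f a) <= g b - Re (w * f b).
  by rewrite -wD /D mulrBr ReD ReN; lra.
apply: (@rder_nondecreasing R (fun y => g y - Re (w * f y))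
         (fun y => g' y - Re (w * f' y))) => // y h.
- apply: rderB; first exact: dg.
  have [] := cderM (cder_cst y w) (df y h).
  by rewrite mul0r add0r.
- rewrite subr_ge0; apply: le_trans (le y h).
  by apply: le_trans (ler_norm _) _; apply: le_trans (Re_le_normc _) _; rewrite normcM nw mul1r.
Qed.

End ComplexCalculus.

(** * Forward and backward amplitudes *)
Section Modes.
Variable R : realType.
Implicit Types (x y t k : R) (al be : R -> R[i]).

(** A family that is bounded by some unspecified constant, and for which every
    bound B can be traded for C + B / 2, is bounded by the fixed point 2 * C of
    that trade. This plays the role of an iteration or of a Gronwall argument
    whenever the bounded quantity depends on several variables. *)
Lemma self_improving (T : Type) (P : T -> Prop) (F : T -> R) (B0 C : R) :
  0 <= C -> (forall p, P p -> F p <= B0) ->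
  (forall B, 0 <= B -> (forall p, P p -> F p <= B) ->
     forall p, P p -> F p <= C + B / 2) ->
  forall p, P p -> F p <= 2 * C.
Proof.
move=> C0 bd imp p Pp; pose S := [set F p | p in [set p | P p]].
have hS : has_sup S.
  by split; [exists (F p); exists p | exists B0 => _ [q Pq <-]; exact: bd].
have le_sup q : P q -> F q <= sup S by move=> Pq; apply: ub_le_sup; [case: hS | exists q].
pose B := Num.max (sup S) 0.
have B0' : 0 <= B by rewrite le_max lexx orbT.
have leB q : P q -> F q <= B by move=> Pq; rewrite le_max le_sup.
have : sup S <= C + B / 2.
  by apply: ge_sup; [case: hS | move=> _ [q Pq <-]; exact: imp].
move: (leB p Pp); rewrite /B; case: (leP (sup S) 0) => [_ h1 h2 | _]; lra.
Qed.

(** The fourth root r of the refraction coefficient, its logarithmic derivative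
    s and the travel time tau, with the uniform bounds on which alone the
    constants of all estimates depend. *)
Record medium (nu rho sg : R) (r s tau : R -> R) : Prop := Medium {
  medium_nu : 0 < nu;
  medium_r : forall x, 0 <= x <= 1 -> rder r x (s x * r x);
  medium_tau : forall x, 0 <= x <= 1 -> rder tau x (r x ^+ 2);
  medium_ge : forall x, 0 <= x <= 1 -> nu <= r x;
  medium_le : forall x, 0 <= x <= 1 -> r x <= rho;
  medium_s : forall x, 0 <= x <= 1 -> `|s x| <= sg;
  medium_tau0 : tau 0 = 0;
  medium_r0 : r 0 = 1;
  medium_r1 : r 1 = 1 }.

(** The equation u'' + k^2 r^4 u = 0 after the substitution
    u = (al + be) e^(i k tau) / r and u' / (i k) = r (al - be) e^(i k tau).
    The amplitudes are coupled only through s; the phase is removed from the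
    forward one, so that the backward one turns at the rate 2 k r^2. *)
Definition mode_eq (r s : R -> R) k al be := forall x, 0 <= x <= 1 ->
  cder al x ((s x)%:C * be x) /\
  cder be x ((s x)%:C * al x - (2 * k * r x ^+ 2)%:C * ii * be x).

(** The wave leaving through x = 1: beyond that point r = 1 and nothing is
    reflected. *)
Record mode (r s : R -> R) k al be : Prop := Mode {
  mode_ode : mode_eq r s k al be;
  mode_al1 : al 1 = 1;
  mode_be1 : be 1 = 0 }.

Section OneMedium.
Variables (nu rho sg : R) (r s tau : R -> R).
Hypothesis med : medium nu rho sg r s tau.

Lemma medium_sg_ge0 : 0 <= sg.
Proof.
by apply: le_trans (normr_ge0 (s 0)) _; apply: (medium_s med); rewrite lexx ler01.
Qed.

Lemma medium_rho_ge1 : 1 <= rho.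
Proof. by rewrite -(medium_r0 med); apply: (medium_le med); rewrite lexx ler01. Qed.

Lemma medium_r_gt0 x : 0 <= x <= 1 -> 0 < r x.
Proof. by move=> h; apply: lt_le_trans (medium_nu med) _; exact: (medium_ge med). Qed.

Lemma medium_r2_ge x : 0 <= x <= 1 -> nu ^+ 2 <= r x ^+ 2.
Proof.
move=> h; rewrite ler_sqr ?nnegrE ?(medium_ge med) //; apply: ltW.
  exact: (medium_nu med).
exact: medium_r_gt0.
Qed.

Lemma medium_r2_le x : 0 <= x <= 1 -> r x ^+ 2 <= rho ^+ 2.
Proof.
move=> h; rewrite ler_sqr ?nnegrE ?(medium_le med) //.
  exact/ltW/medium_r_gt0.
exact: le_trans ler01 medium_rho_ge1.
Qed.

Lemma tau_lipschitz x y : 0 <= x -> x <= y -> y <= 1 ->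
  nu ^+ 2 * (y - x) <= tau y - tau x <= rho ^+ 2 * (y - x).
Proof.
move=> x0 xy y1.
have H z : x <= z <= y -> 0 <= z <= 1.
  by case/andP=> h1 h2; rewrite (le_trans x0 h1) (le_trans h2 y1).
apply/andP; split.
- suff : tau x - nu ^+ 2 * x <= tau y - nu ^+ 2 * y by lra.
  apply: (@rder_nondecreasing R (fun z => tau z - nu ^+ 2 * z)
      (fun z => r z ^+ 2 - (0 * z + nu ^+ 2 * 1))) => // z /H hz.
    apply: rderB; first exact: (medium_tau med).
    by apply: rderM; [exact: rder_cst | exact: rder_id].
  by have := medium_r2_ge hz; lra.
- suff : rho ^+ 2 * x - tau x <= rho ^+ 2 * y - tau y by lra.
  apply: (@rder_nondecreasing R (fun z => rho ^+ 2 * z - tau z)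
      (fun z => (0 * z + rho ^+ 2 * 1) - r z ^+ 2)) => // z /H hz.
    apply: rderB; last exact: (medium_tau med).
    by apply: rderM; [exact: rder_cst | exact: rder_id].
  by have := medium_r2_le hz; lra.
Qed.

Lemma tau_nondecreasing x y : 0 <= x -> x <= y -> y <= 1 -> tau x <= tau y.
Proof.
move=> x0 xy y1; have /andP[h _] := tau_lipschitz x0 xy y1.
have : 0 <= nu ^+ 2 * (y - x) by rewrite mulr_ge0 ?sqr_ge0 ?subr_ge0.
lra.
Qed.

Lemma tau1_le : tau 1 <= rho ^+ 2.
Proof.
have /andP[_] := @tau_lipschitz 0 1 (lexx _) ler01 (lexx _).
by rewrite (medium_tau0 med); lra.
Qed.

(** The oscillating term is skew and does not change the energy, so its growth
    rate is governed by s and is uniform in the frequency. *)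
Lemma mode_energy k al be x : mode_eq r s k al be -> 0 <= x <= 1 ->
  normc (al x) ^+ 2 + normc (be x) ^+ 2 <=
  expR (2 * sg * (1 - x)) * (normc (al 1) ^+ 2 + normc (be 1) ^+ 2).
Proof.
move=> ode /andP[x0 x1].
pose e y := normc (al y) ^+ 2 + normc (be y) ^+ 2.
pose de y := 4 * s y * (Re (al y) * Re (be y) + Im (al y) * Im (be y)).
have der y : x <= y <= 1 -> rder e y (de y).
  case/andP=> h1 h2; have h : 0 <= y <= 1 by rewrite h2 (le_trans x0 h1).
  have [[a1 a2] [b1 b2]] := ode y h.
  rewrite /e; under eq_fun do rewrite !normc_sqr.
  apply: rder_eq.
    apply: rderD; apply: rderD; apply: rderX; [exact: a1|exact: a2|exact: b1|exact: b2].
  by rewrite /de !reimE /=; ring.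
have : expR (2 * sg * x) * e x <= expR (2 * sg * 1) * e 1.
  apply: (@rder_nondecreasing R (fun y => expR (2 * sg * y) * e y)
    (fun y => (expR (2 * sg * y) * (0 * y + 2 * sg * 1)) * e y
              + expR (2 * sg * y) * de y)) => // y hy.
    apply: rderM; last exact: der.
    apply: (@rder_comp R expR); first exact: is_derive_expR.
    by apply: rderM; [exact: rder_cst | exact: rder_id].
  rewrite mul0r add0r mulr1 -mulrA -mulrDr mulr_ge0 ?expR_ge0 //.
  have sy : `|s y| <= sg.
    by apply: (medium_s med); case/andP: hy => h1 ->; rewrite (le_trans x0 h1).
  move: sy; rewrite ler_norml => /andP[s1 s2].
  rewrite /e !normc_sqr /de.
  set a1 := Re (al y); set a2 := Im (al y); set b1 := Re (be y); set b2 := Im (be y).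
  have [p0 m0] : 0 <= (a1 + b1) ^+ 2 + (a2 + b2) ^+ 2
     /\ 0 <= (a1 - b1) ^+ 2 + (a2 - b2) ^+ 2 by split; rewrite addr_ge0 ?sqr_ge0.
  nra.
rewrite -/(e x) -/(e 1) => h.
have -> : 2 * sg * (1 - x) = 2 * sg * 1 - 2 * sg * x by ring.
by rewrite expRD expRN mulrAC ler_pdivlMr ?expR_gt0 // mulrC.
Qed.

(** The conserved flux keeps al 0 + be 0 away from zero, which is why the
    impedance is well defined with bounds uniform in the frequency. *)
Lemma mode_flux k al be x : mode r s k al be -> 0 <= x <= 1 ->
  normc (al x) ^+ 2 - normc (be x) ^+ 2 = 1.
Proof.
move=> [ode al1 be1] /andP[x0 x1].
pose e y := normc (al y) ^+ 2 - normc (be y) ^+ 2.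
have der y : x <= y <= 1 -> rder e y 0.
  case/andP=> h1 h2; have h : 0 <= y <= 1 by rewrite h2 (le_trans x0 h1).
  have [[a1 a2] [b1 b2]] := ode y h.
  rewrite /e; under eq_fun do rewrite !normc_sqr.
  apply: rder_eq.
    apply: rderB; apply: rderD; apply: rderX; [exact: a1|exact: a2|exact: b1|exact: b2].
  by rewrite !reimE /=; ring.
have e1 : e 1 = 1 by rewrite /e al1 be1 Normc.normc0 Normc.normc1; ring.
rewrite -[RHS]e1 -/(e x); apply/eqP; rewrite eq_le; apply/andP; split.
  exact: (@rder_nondecreasing R e (fun=> 0)).
rewrite -lerN2; apply: (@rder_nondecreasing R (fun y => - e y) (fun=> - 0)) => // y h.
  exact/rderN/der.
Qed.

Lemma mode_bound k al be x : mode r s k al be -> 0 <= x <= 1 ->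
  normc (al x) <= expR sg /\ normc (be x) <= expR sg.
Proof.
move=> m hx; have := mode_energy (mode_ode m) hx.
rewrite (mode_al1 m) (mode_be1 m) Normc.normc0 Normc.normc1 expr1n expr0n /= addr0 mulr1 => h.
have hE : expR (2 * sg * (1 - x)) <= expR sg ^+ 2.
  rewrite expr2 -expRD ler_expR; have := medium_sg_ge0; case/andP: hx; nra.
by split; rewrite -ler_sqr ?nnegrE ?normc_ge0 ?expR_ge0 //; apply: le_trans hE;
  apply: le_trans h; rewrite ?lerDl ?lerDr sqr_ge0.
Qed.

End OneMedium.

End Modes.

(** * Superpositions of modes *)
Section Transport.
Variable R : realType.
Implicit Types (x y t : R).

(** Multiplying by e^(i k_j t) and summing turns a family of modes into a
    solution of a transport equation in (x, t), of which this sum is the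
    boundary value at x = 1. *)
Definition trig (J : finType) (c : J -> R[i]) (k : J -> R) t : R[i] :=
  \sum_j c j * expi (k j * t).

(** The exponential weight of the energy estimate below; it is chosen large
    enough that the coupling through s contributes at most half of a bound. *)
Definition transport_rate (sg : R) : R := 2 * sg + 1.
Definition transport_cst (nu sg : R) : R :=
  2 * (sg / (2 * nu ^+ 2) + sg) * expR (transport_rate sg).

Lemma rder_linear (a : R) x : rder (fun y => a * y) x a.
Proof. by apply: rder_eq (rderM (rder_cst x a) (rder_id x)) _; ring. Qed.

Lemma rder_exp_decay (l : R) x :
  rder (fun y => expR (l * (1 - y))) x (- (l * expR (l * (1 - x)))).
Proof.
apply: rder_eq.
  apply: (@rder_comp R expR); first exact: is_derive_expR.
  apply: (@rder_comp R (fun z => l * z)); first exact: rder_linear.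
  by apply: rderB; [exact: rder_cst | exact: rder_id].
ring.
Qed.

Lemma le_mul_expR (a l : R) : 0 <= a -> 0 <= l -> a <= a * expR l.
Proof.
move=> a0 l0; rewrite -[leLHS]mulr1 ler_wpM2l //.
by apply: le_trans (expR_ge1Dx l); rewrite lerDl.
Qed.

Section Estimate.
Variables (nu rho sg : R) (r s tau : R -> R).
Hypothesis med : medium nu rho sg r s tau.
Variables (J : finType) (c : J -> R[i]) (k : J -> R) (al be : J -> R -> R[i]).
Hypothesis modes : forall j, mode r s (k j) (al j) (be j).
Variables (M M1 : R -> R) (Tm : R).
Hypothesis dM : forall t, 0 <= t <= Tm -> rder M t (- M1 t).
Hypothesis M1_ge0 : forall t, 0 <= t <= Tm -> 0 <= M1 t.
Hypothesis M_gt0 : forall t, 0 < M t.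
Hypothesis chi_le : forall t, 0 <= t <= Tm -> normc (trig c k t) <= M1 t + M t.

(** The superposed amplitudes, and the domain of dependence in which they are
    determined by the boundary value at the times at most Tm. *)
Let fa x t : R[i] := \sum_j c j * expi (k j * t) * (al j x - 1).
Let fb x t : R[i] := \sum_j c j * expi (k j * t) * be j x.
Let dom x t := [/\ 0 <= x <= 1, 0 <= t & t + 2 * (tau 1 - tau x) <= Tm].
(* The rate is kept abstract so that the arithmetic below treats it as an atom. *)
Variable lam : R.
Hypothesis lamE : lam = transport_rate sg.

Let sg0 : 0 <= sg. Proof. exact: medium_sg_ge0 med. Qed.
Let lam_gt0 : 0 < lam. Proof. by rewrite ?lamE /transport_rate; have := sg0; lra. Qed.
Let nu2 : 0 < nu ^+ 2. Proof. by rewrite exprn_gt0 // (medium_nu med). Qed.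
Let rate_le : sg / lam <= 1 / 2.
Proof. by rewrite ler_pdivrMr // lamE /transport_rate; have := sg0; lra. Qed.

Let c_ge0 : 0 <= sg / (2 * nu ^+ 2).
Proof. by rewrite divr_ge0 // mulr_ge0 // ltW. Qed.
Let M_ge0 t : 0 <= M t. Proof. exact: ltW. Qed.

Let M_noninc t u : 0 <= t -> t <= u -> u <= Tm -> M u <= M t.
Proof.
move=> t0 tu uT; rewrite -lerN2.
apply: (@rder_nondecreasing R (fun y => - M y) (fun y => - - M1 y)) => // y /andP[h1 h2].
  by apply/rderN/dM; rewrite (le_trans t0 h1) (le_trans h2 uT).
by rewrite opprK M1_ge0 // (le_trans t0 h1) (le_trans h2 uT).
Qed.

Let bounded_by (B : R) := forall x t, dom x t ->
  normc (fa x t) <= B * expR (lam * (1 - x)) * M t /\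
  normc (fb x t) <= B * expR (lam * (1 - x)) * M t.

Let dom_later x y t : dom x t -> x <= y <= 1 -> dom y t.
Proof.
move=> [/andP[x0 x1] t0 tT] /andP[xy y1]; split => //.
  by rewrite y1 (le_trans x0 xy).
have := tau_nondecreasing med x0 xy y1; lra.
Qed.

(** At a fixed time the forward amplitude only changes through the coupling. *)
Let step_a (B : R) x t : 0 <= B -> bounded_by B -> dom x t ->
  normc (fa x t) <= B / 2 * expR (lam * (1 - x)) * M t.
Proof.
move=> B0 hB D; have [/andP[x0 x1] t0 tT] := D.
have := @cder_mean_value R (fun y => fa y t)
  (fun y => \sum_j c j * expi (k j * t) * ((s y)%:C * be j y))
  (fun y => - (sg * B / lam * M t) * expR (lam * (1 - y)))
  (fun y => sg * (B * expR (lam * (1 - y)) * M t)) x 1.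
have -> : fa 1 t = 0.
  by rewrite /fa big1 // => j _; rewrite (mode_al1 (modes j)) subrr mulr0.
rewrite sub0r normcN subrr mulr0 expR0 => H.
apply: le_trans (H _ _ _ x1) _.
- move=> y /andP[xy y1]; apply: cder_sum => j; apply: cder_eq.
    apply: cderM; first exact: cder_cst.
    apply: cderB; last exact: cder_cst.
    have y01 : 0 <= y <= 1 by rewrite y1 (le_trans x0 xy).
    by have [h _] := mode_ode (modes j) y01; exact: h.
  by rewrite mul0r add0r subr0.
- move=> y _; apply: rder_eq.
    by apply: rderM; [exact: rder_cst | exact: rder_exp_decay].
  by move: (expR _) => e; field; rewrite gt_eqF //.
- move=> y xy; have D' := dom_later D xy; have [_ hb] := hB _ _ D'.
  have [y01 _ _] := D'.
  rewrite (_ : \sum_j _ = (s y)%:C * fb y t); last first.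
    by rewrite /fb mulr_sumr; apply: eq_bigr => j _; ring.
  rewrite normcM normc_real; apply: ler_pM => //; first exact: normc_ge0.
  exact: (medium_s med).
- have h1 : 0 <= B * M t * expR (lam * (1 - x)).
    by rewrite !mulr_ge0 ?expR_ge0 // ltW.
  have h2 : 0 <= sg * B / lam * M t by rewrite !mulr_ge0 ?invr_ge0 // ltW.
  have := rate_le; nra.
Qed.

(** Along the characteristic u y = t + 2 (tau y - tau x) the rotation of the
    backward amplitude disappears, and the source is s times the sum of trig and
    of the superposed forward correction. The part of trig bounded by M1 is
    integrated exactly, since M1 is minus the derivative of M. *)
Let step_b (B : R) x t : 0 <= B -> bounded_by B -> dom x t ->
  normc (fb x t) <= ((sg / (2 * nu ^+ 2) + sg) + B / 2) * expR (lam * (1 - x)) * M t.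
Proof.
move=> B0 hB D; have [/andP[x0 x1] t0 tT] := D.
have [u uE] : exists u : R -> R, forall y, u y = t + 2 * (tau y - tau x).
  by exists (fun y => t + 2 * (tau y - tau x)).
have du y : 0 <= y <= 1 -> rder u y (2 * r y ^+ 2).
  move=> y01; rewrite (_ : u = fun y => t + 2 * (tau y - tau x)); last exact/funext.
  apply: rder_eq.
    apply: rderD; first exact: rder_cst.
    apply: (@rder_comp R (fun z => 2 * z)); first exact: rder_linear.
    by apply: rderB; [exact: (medium_tau med) | exact: rder_cst].
  ring.
have hu y : x <= y <= 1 -> [/\ t <= u y, u y <= Tm & dom y (u y)].
  case/andP=> xy y1.
  have h1 := tau_nondecreasing med x0 xy y1.
  have h2 := tau_nondecreasing med (le_trans x0 xy) y1 (lexx 1).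
  rewrite uE; split; [lra | lra | split; [by rewrite y1 (le_trans x0 xy) | lra | lra]].
have := @cder_mean_value R
  (fun y => \sum_j c j * expi (k j * u y) * be j y)
  (fun y => (s y)%:C * (trig c k (u y) + fa y (u y)))
  (fun y => - (sg / (2 * nu ^+ 2)) * M (u y) + sg * M t * y
            + - (sg * B / lam * M t) * expR (lam * (1 - y)))
  (fun y => sg / (2 * nu ^+ 2) * M1 (u y) * (2 * r y ^+ 2) + sg * M t
            + sg * (B * expR (lam * (1 - y)) * M t)) x 1.
have -> : \sum_j c j * expi (k j * u 1) * be j 1 = 0.
  by rewrite big1 // => j _; rewrite (mode_be1 (modes j)) mulr0.
have -> : u x = t by rewrite uE; ring.
rewrite sub0r normcN -/(fb x t) => H.
apply: le_trans (H _ _ _ x1) _.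
- move=> y /andP[xy y1].
  have y01 : 0 <= y <= 1 by rewrite y1 (le_trans x0 xy).
  rewrite (_ : _ * _ = \sum_j c j * expi (k j * u y) * ((s y)%:C * al j y)); last first.
    by rewrite /trig /fa -big_split mulr_sumr; apply: eq_bigr => j _ /=; ring.
  apply: cder_sum => j; have [_ h] := mode_ode (modes j) y01.
  apply: cder_eq.
    apply: cderM; last exact: h.
    apply: cderM; first exact: cder_cst.
    apply: cder_expi; apply: (@rder_comp R (fun z => k j * z)); first exact: rder_linear.
    exact: du.
  rewrite (_ : k j * (2 * r y ^+ 2) = 2 * k j * r y ^+ 2); last by ring.
  ring.
- move=> y xy; have [h1 h2 _] := hu y xy.
  apply: rder_eq.
    apply: rderD; last first.
      by apply: rderM; [exact: rder_cst | exact: rder_exp_decay].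
    apply: rderD; last exact: rder_linear.
    apply: rderM; first exact: rder_cst.
    apply: (@rder_comp R M); first by apply: dM; rewrite h2 (le_trans t0 h1).
    by apply: du; case/andP: xy => h3 ->; rewrite (le_trans x0 h3).
  by move: (expR _) => e; field; rewrite !gt_eqF //= (medium_nu med).
- move=> y xy; have [h1 h2 D'] := hu y xy; have [ha _] := hB _ _ D'.
  have [y01 u0 _] := D'; have u0T : 0 <= u y <= Tm by rewrite u0 h2.
  rewrite normcM normc_real -addrA.
  apply: (@le_trans _ _ (sg * (M1 (u y) + (M t + B * expR (lam * (1 - y)) * M t)))).
    apply: ler_pM => //; first exact: normc_ge0.
      exact: (medium_s med).
    apply: le_trans (normcD _ _) _; rewrite addrA; apply: lerD.
      by apply: le_trans (chi_le u0T) _; rewrite lerD2l M_noninc.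
    apply: le_trans ha _; apply: ler_wpM2l; last exact: M_noninc.
    by rewrite mulr_ge0 ?expR_ge0.
  have k1 : sg * M1 (u y) <= sg / (2 * nu ^+ 2) * M1 (u y) * (2 * r y ^+ 2).
    rewrite (_ : _ * (2 * _) = sg * M1 (u y) * (r y ^+ 2 / nu ^+ 2)); last first.
      by field; rewrite !gt_eqF //= (medium_nu med).
    by rewrite ler_peMr ?ler_pdivlMr ?mul1r ?(medium_r2_ge med) // mulr_ge0 ?M1_ge0.
  lra.
- have h1 : 0 <= B * M t * expR (lam * (1 - x)).
    by rewrite !mulr_ge0 ?expR_ge0 // ltW.
  have h2 : 0 <= sg * B / lam * M t by rewrite !mulr_ge0 ?invr_ge0 // ltW.
  have h3 : sg * M t * (1 - x) <= sg * M t * expR (lam * (1 - x)).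
    apply: ler_wpM2l; first by rewrite mulr_ge0 // ltW.
    by have := expR_ge1Dx (lam * (1 - x)); have := sg0; have := lam_gt0; rewrite lamE /transport_rate; nra.
  have h4 : sg / (2 * nu ^+ 2) * M t <= sg / (2 * nu ^+ 2) * M t * expR (lam * (1 - x)).
    apply: le_mul_expR; last by rewrite mulr_ge0 ?subr_ge0 // ltW.
    by rewrite mulr_ge0.
  have h5 : 0 <= sg / (2 * nu ^+ 2) * M (u 1).
    by rewrite mulr_ge0.
  have := rate_le; rewrite subrr mulr0 expR0; nra.
Qed.

(** As functions of the frequency, al x - 1 and be x are Fourier transforms of
    kernels supported in the times at most 2 (tau 1 - tau x); hence their
    superpositions at time t are controlled by the later values of trig, whose
    integral is of the size of M t. The kernels are never constructed: the two
    steps above show that a bound with an arbitrary constant improves itself. *)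
Lemma transport x t : 0 <= x <= 1 -> 0 <= t -> t + 2 * (tau 1 - tau x) <= Tm ->
  normc (\sum_j c j * expi (k j * t) * (al j x - 1)) <= transport_cst nu sg * M t /\
  normc (\sum_j c j * expi (k j * t) * be j x) <= transport_cst nu sg * M t.
Proof.
move=> hx ht hT.
pose w (p : R * R) := expR (lam * (1 - p.1)) * M p.2.
have w0 p : 0 < w p by rewrite mulr_gt0 ?expR_gt0.
pose F p := Num.max (normc (fa p.1 p.2)) (normc (fb p.1 p.2)) / w p.
pose C0 := sg / (2 * nu ^+ 2) + sg.
have C0_ge0 : 0 <= C0 by rewrite addr_ge0.
have dom_t y u : dom y u -> 0 <= u <= Tm.
  case=> /andP[y0 y1] u0 uT; rewrite u0 /=.
  by have := tau_nondecreasing med y0 y1 (lexx 1); lra.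
have FB B p : (F p <= B) = (normc (fa p.1 p.2) <= B * w p) && (normc (fb p.1 p.2) <= B * w p).
  by rewrite /F ler_pdivrMr // ge_max.
pose S := \sum_j normc (c j) * (expR sg + 1).
have S0 : 0 <= S by apply: sumr_ge0 => j _; rewrite mulr_ge0 ?normc_ge0 // addr_ge0 ?expR_ge0.
have main : forall p, dom p.1 p.2 -> F p <= 2 * C0.
  apply: (@self_improving R _ (fun p => dom p.1 p.2) F (S / M Tm) C0) => //.
  - move=> [y u] /= D; have [y01 u0 _] := D; have /andP[_ uT] := dom_t _ _ D.
    have hw : S <= S / M Tm * w (y, u). 
      rewrite -mulrA ler_peMr // mulrC ler_pdivlMr ?mul1r // /w /=.
      apply: le_trans (M_noninc u0 uT (lexx _)) _; rewrite mulrC.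
      apply: le_mul_expR; first exact: ltW.
      by rewrite mulr_ge0 ?subr_ge0 //; [exact: ltW | case/andP: y01].
    rewrite FB; apply/andP; split; apply: le_trans hw; apply: le_trans (normc_sum _ _ _) _;
      apply: ler_sum => j _; rewrite normcM normcM normc_expi mulr1; apply: ler_wpM2l;
      rewrite ?normc_ge0 //; have [h1 h2] := mode_bound med (modes j) y01.
      by apply: le_trans (normcB _ _) _; rewrite Normc.normc1 lerD2r.
    by apply: le_trans h2 _; rewrite lerDl.
  - move=> B B0 hB [y u] /= D.
    have hB' : bounded_by B.
      by move=> y' u' /(hB (y', u')); rewrite FB /w /= !mulrA => /andP.
    have ha := step_a B0 hB' D; have hb := step_b B0 hB' D.
    rewrite FB /w /= !mulrA hb andbT; apply: le_trans ha _.
    apply: ler_wpM2r; first exact: ltW.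
    by apply: ler_wpM2r; rewrite ?expR_ge0 // lerDr.
have D : dom (x, t).1 (x, t).2 by [].
have := main (x, t) D; rewrite FB /w /= => /andP[h1 h2].
have hE : 2 * C0 * (expR (lam * (1 - x)) * M t) <= transport_cst nu sg * M t.
  rewrite mulrA; apply: ler_wpM2r; first exact: ltW.
  rewrite /transport_cst -/C0; apply: ler_wpM2l; first by rewrite mulr_ge0.
  rewrite ler_expR -lamE -[leRHS]mulr1 ler_wpM2l //; first exact: ltW.
  by case/andP: hx; lra.
by split; [apply: le_trans h1 hE | apply: le_trans h2 hE].
Qed.

End Estimate.
End Transport.

(** * Elementary inequalities *)
Section TrigBounds.
Variable R : realType.
Implicit Types (x y t v : R).

Lemma sin_le x : 0 <= x -> sin x <= x.
Proof.
move=> x0; have := @rder_nondecreasing R (fun y => y - sin y) (fun y => 1 - cos y) 0 x.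
rewrite sin0 subr0 subr_ge0; apply => // y _.
by apply: rderB; [exact: rder_id | exact: is_derive_sin].
Qed.

Lemma cos_ge_quad x : 1 - x ^+ 2 / 2 <= cos x.
Proof.
wlog x0 : x / 0 <= x.
  move=> H; case: (leP 0 x) => [/H//|/ltW x0].
  by have := H (- x); rewrite cosN sqrrN oppr_ge0; apply.
have := @rder_nondecreasing R (fun y => cos y + y ^+ 2 * 2^-1)
   (fun y => - sin y + y) 0 x.
rewrite cos0 expr0n /= mul0r addr0 => H.
rewrite lerBlDr; apply: H => //.
- move=> y _; apply: rder_eq.
    apply: rderD; first exact: is_derive_cos.
    by apply: rderM; [apply: rderX; exact: rder_id | exact: rder_cst].
  by rewrite expr1; field.
- by move=> y /andP[y0 _]; have := sin_le y0; lra.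
Qed.

Lemma cos_ge_half x : `|x| <= 1 -> 1 / 2 <= cos x.
Proof.
move=> h; have := cos_ge_quad x.
have : x ^+ 2 <= 1 by rewrite -real_normK ?num_real // expr_le1.
lra.
Qed.

Lemma abs_sin_ge x : `|x| <= 1 -> `|x| / 2 <= `|sin x|.
Proof.
wlog x0 : x / 0 <= x.
  move=> H; case: (leP 0 x) => [/H//|/ltW x0].
  by rewrite -normrN -[`|sin x|]normrN -sinN; apply: H; rewrite oppr_ge0.
rewrite (ger0_norm x0) => x1; apply: le_trans (ler_norm _).
have := @rder_nondecreasing R (fun y => sin y - y * 2^-1)
   (fun y => cos y - (1 * 2^-1 + y * 0)) 0 x.
rewrite sin0 mul0r subrr subr_ge0; apply => //.
- move=> y _; apply: rderB; first exact: is_derive_sin.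
  by apply: rderM; [exact: rder_id | exact: rder_cst].
- move=> y /andP[y0 y1]; have := @cos_ge_half y.
  by rewrite ger0_norm // => /(_ (le_trans y1 x1)); lra.
Qed.

Lemma coatan_gt0 x : 0 < pi / 2 - atan x.
Proof. by rewrite subr_gt0 atan_ltpi2. Qed.

Lemma atanV x : 0 < x -> atan x^-1 = pi / 2 - atan x.
Proof.
move=> x0; set y := pi / 2 - atan x.
have y0 : 0 < y by exact: coatan_gt0.
have a0 : 0 < atan x by rewrite -atan0 lt_atan.
have yp : y < pi / 2 by rewrite /y; lra.
have e : atan x = pi / 2 - y by rewrite /y; ring.
clearbody y.
have sE : sin (pi / 2 - y) = cos y by rewrite sinB sin_pihalf cos_pihalf mul0r mul1r subr0.
have cE : cos (pi / 2 - y) = sin y by rewrite cosB sin_pihalf cos_pihalf mul0r mul1r add0r.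
have xE : x = cos y / sin y by rewrite -sE -cE -e -[LHS]atanK.
rewrite xE invf_div -[sin y / cos y]/(tan y) tanK // in_itv /= yp andbT.
by have := pi_gt0 R; lra.
Qed.

Lemma atan_le x : 0 <= x -> atan x <= x.
Proof.
move=> x0; have := @rder_nondecreasing R (fun y => y - atan y)
  (fun y => 1 - (1 + y ^+ 2)^-1) 0 x.
rewrite atan0 subrr subr_ge0; apply => // y _.
- by apply: rderB; [exact: rder_id | exact: is_derive1_atan].
- by rewrite subr_ge0 invf_le1 ?ltr_pwDl ?sqr_ge0 // lerDl sqr_ge0.
Qed.

Lemma atan_ge_half x : 0 <= x <= 1 -> x / 2 <= atan x.
Proof.
case/andP=> x0 x1; have := @rder_nondecreasing R (fun y => atan y - y * 2^-1)
  (fun y => (1 + y ^+ 2)^-1 - (1 * 2^-1 + y * 0)) 0 x.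
rewrite atan0 mul0r subrr subr_ge0; apply => // y /andP[y0 yx].
- apply: rderB; first exact: is_derive1_atan.
  by apply: rderM; [exact: rder_id | exact: rder_cst].
- rewrite mulr0 addr0 mul1r subr_ge0 lef_pV2 ?posrE ?ltr_pwDl ?sqr_ge0 //.
  have : y ^+ 2 <= 1 by rewrite expr_le1 // (le_trans yx).
  lra.
Qed.

Lemma coatan_le_inv x : 0 < x -> pi / 2 - atan x <= x^-1.
Proof. by move=> x0; rewrite -atanV // atan_le // invr_ge0 ltW. Qed.

(** The majorants M1 and M for the Fejer kernel are a Lorentzian profile and
    this primitive; M decays like the inverse of its argument. *)
Lemma rder_coatan (a : R) x :
  rder (fun y => pi / 2 - atan (a * y)) x (- (a / (1 + (a * x) ^+ 2))).
Proof.
apply: rder_eq.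
  apply: rderB; first exact: rder_cst.
  apply: (@rder_comp R atan); first exact: is_derive1_atan.
  exact: rder_linear.
by rewrite sub0r mulrC.
Qed.

Lemma rder_log_quad (a : R) x :
  rder (fun y => ln (1 + (a * y) ^+ 2)) x (2 * a ^+ 2 * x / (1 + (a * x) ^+ 2)).
Proof.
have h : 0 < 1 + (a * x) ^+ 2 by rewrite ltr_pwDl ?sqr_ge0.
apply: rder_eq.
  apply: (@rder_comp R (@ln R)); first exact: is_derive1_ln.
  apply: rderD; first exact: rder_cst.
  by apply: rderX; exact: rder_linear.
by field; rewrite gt_eqF.
Qed.

Lemma harmonic_le_ln N : \sum_(m < N.+1) (m.+1%:R : R)^-1 <= 1 + ln N.+1%:R.
Proof.
elim: N => [|N ih]; first by rewrite big_ord_recr big_ord0 /= add0r invr1 ln1 addr0.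
rewrite big_ord_recr /=.
have h2 : (0 : R) < N.+1%:R by [].
have h3 : (0 : R) < N.+2%:R by [].
have e : N.+1%:R / N.+2%:R = 1 + - (N.+2%:R)^-1 :> R.
  by rewrite -[N.+1%:R](addrK 1) natr1 mulrDl divff ?gt_eqF // mulN1r.
have := @le_ln1Dx R (- (N.+2%:R)^-1).
rewrite -e ln_div ?posrE // => /(_ _) H.
have : - (N.+2%:R)^-1 > -1 :> R by rewrite ltrN2 invf_lt1 // ltr1n.
move=> /H {}H; apply: le_trans (lerD ih (lexx _)) _.
rewrite -addrA lerD2l; move: H; move: (_^-1) (ln _) (ln _) => a b c; lra.
Qed.

End TrigBounds.

(** * A Fejer kernel with nonzero frequencies *)
Section Fejer.
Variable R : realType.
Variables (N : nat) (kap t0 : R).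
Hypotheses (N_gt0 : (0 < N)%N) (kap_gt0 : 0 < kap).
Implicit Types (t v : R).

(** The frequencies kap (j - l), shifted by half a step: the shift avoids the
    frequency 0, by which the antiderivative of the kernel would divide, and only
    multiplies the kernel by a slowly varying phase. *)
Definition fejer_freq (p : 'I_N * 'I_N) : R := kap * ((p.1)%:R - (p.2)%:R + 2^-1).
Definition fejer_weight (p : 'I_N * 'I_N) : R[i] :=
  (N%:R^-1)%:C * expi (- (fejer_freq p * t0)).

Let dirichlet v : R[i] := \sum_(j < N) expi (kap * v * j%:R).

Let N0 : (0 : R) < N%:R. Proof. by rewrite ltr0n. Qed.

Let conj_expi (a : R) : conjc (expi a) = expi (- a).
Proof. by rewrite /expi cosN sinN. Qed.

Let normc_sq_conj (z : R[i]) : z * conjc z = (normc z ^+ 2)%:C.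
Proof. by rewrite normc_sqr; case: z => a b; apply: complexP; rewrite !reimE /=; ring. Qed.

(** The kernel is the squared Dirichlet kernel over N, up to the phase of the
    half step. *)
Let trigE t : trig fejer_weight fejer_freq t =
  (normc (dirichlet (t - t0)) ^+ 2 / N%:R)%:C * expi (kap * (t - t0) / 2).
Proof.
set v := t - t0.
have -> : (normc (dirichlet v) ^+ 2 / N%:R)%:C =
    (N%:R^-1)%:C * (dirichlet v * conjc (dirichlet v)).
  by rewrite normc_sq_conj mulrC rmorphM.
have -> : conjc (dirichlet v) = \sum_(l < N) expi (- (kap * v * l%:R)).
  by rewrite /dirichlet rmorph_sum; apply: eq_bigr => l _; exact: conj_expi.
rewrite /dirichlet big_distrlr /= pair_big /= mulr_sumr mulr_suml.
apply: eq_bigr => -[j l] _ /=.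
rewrite /fejer_weight -!mulrA -!expiD; congr (_ * expi _).
by rewrite /fejer_freq /v /=; field.
Qed.

Let dirichlet_le v : normc (dirichlet v) <= N%:R.
Proof.
apply: le_trans (normc_sum _ _ _) _.
under eq_bigr do rewrite normc_expi.
by rewrite sumr_const card_ord.
Qed.

(** A geometric sum; the frequency kap is so small that the denominator does
    not vanish again in the range of times considered. *)
Let dirichlet_decay v : `|kap * v| <= 1 -> normc (dirichlet v) * `|kap * v| <= 4.
Proof.
set th := kap * v => th1.
have geo : (expi th - 1) * dirichlet v = expi (th * N%:R) - 1.
  have -> : dirichlet v = \sum_(j < N) expi th ^+ j.
    apply: eq_bigr => j _; rewrite -/th; elim: (nat_of_ord j) => [|n ih].
      by rewrite mulr0 expi0 expr0.
    by rewrite -natr1 mulrDr mulr1 expiD ih exprSr.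
  rewrite -subrX1; congr (_ - _); elim: (N) => [|n ih]; first by rewrite mulr0 expi0.
  by rewrite -natr1 mulrDr mulr1 expiD -ih exprSr.
have low : `|th| / 2 <= normc (expi th - 1).
  apply: le_trans (abs_sin_ge th1) _.
  have := normc_sqr (expi th - 1); rewrite !reimE /= oppr0 addr0 => h.
  rewrite -ler_sqr ?nnegrE ?normc_ge0 // h real_normK ?num_real // lerDr sqr_ge0 //.
have : normc (expi th - 1) * normc (dirichlet v) <= 2.
  rewrite -normcM geo; apply: le_trans (normcB _ _) _.
  by rewrite normc_expi Normc.normc1.
have := normc_ge0 (dirichlet v); nra.
Qed.

Definition fejer_cst : R := 1 + 16 / kap ^+ 2.

Lemma fejer_bound t : `|kap * (t - t0)| <= 1 ->
  normc (trig fejer_weight fejer_freq t) <=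
  fejer_cst * (N%:R / (1 + (N%:R * (t - t0)) ^+ 2)).
Proof.
move=> h; rewrite trigE normcM normc_expi mulr1 normc_real ger0_norm; last first.
  by rewrite divr_ge0 ?sqr_ge0 // ltW.
set v := t - t0 in h *; set S := normc _.
have S0 : 0 <= S by exact: normc_ge0.
have h1 : S <= N%:R by exact: dirichlet_le.
have h2 : S * `|kap * v| <= 4 by exact: dirichlet_decay.
have h3 : S ^+ 2 <= N%:R ^+ 2 by rewrite ler_sqr ?nnegrE // ltW.
have h4 : S ^+ 2 * (kap * v) ^+ 2 <= 16.
  rewrite -[(kap * v) ^+ 2]real_normK ?num_real // -exprMn.
  by rewrite (_ : 16 = 4 ^+ 2) ?ler_sqr ?nnegrE ?mulr_ge0 //; ring.
rewrite mulrA ler_pdivlMr ?ltr_pwDl ?sqr_ge0 // mulrAC ler_pdivrMr //.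
have h5 : S ^+ 2 * v ^+ 2 <= 16 / kap ^+ 2.
  by rewrite ler_pdivlMr ?exprn_gt0 // -mulrA -exprMn [v * _]mulrC.
rewrite /fejer_cst exprMn.
have : 0 <= N%:R ^+ 2 :> R by rewrite sqr_ge0.
nra.
Qed.

(** The phase of the half step stays within the range where the cosine is at
    least one half. *)
Lemma fejer_Re_ge0 t : `|kap * (t - t0)| <= 1 ->
  0 <= Re (trig fejer_weight fejer_freq t).
Proof.
move=> h; rewrite trigE ReM /= mul0r subr0 mulr_ge0 ?divr_ge0 ?sqr_ge0 ?ltW //.
apply: (lt_le_trans _ (@cos_ge_half R _ _)); first by lra.
rewrite normrM (@ger0_norm _ 2^-1) ?invr_ge0 //; have := normr_ge0 (kap * (t - t0)); lra.
Qed.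

(** All terms of the Dirichlet sum are nearly in phase at distance 1 / N from
    the centre, which provides the mass of the kernel there. *)
Lemma fejer_Re_ge t : kap <= 1 -> N%:R * `|t - t0| <= 1 ->
  N%:R / 8 <= Re (trig fejer_weight fejer_freq t).
Proof.
move=> k1 h; rewrite trigE ReM /= mul0r subr0.
set v := t - t0 in h *.
have kv (x : R) : 0 <= x <= N%:R -> `|kap * v * x| <= 1.
  case/andP=> x0 xN; rewrite !normrM (ger0_norm x0) (ger0_norm (ltW kap_gt0)).
  have v0 := normr_ge0 v.
  have h1 : `|v| * x <= 1 by apply: le_trans h; rewrite mulrC ler_wpM2r.
  have h2 : 0 <= `|v| * x by rewrite mulr_ge0.
  nra.
have c1 : 1 / 2 <= cos (kap * v / 2).
  apply/cos_ge_half/kv; rewrite invr_ge0 ler0n /=.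
  by apply: (@le_trans _ _ 1); [lra | rewrite ler1n].
have c2 : N%:R / 2 <= normc (dirichlet v).
  apply: le_trans (Re_le_normc _); apply: le_trans (ler_norm _).
  rewrite /dirichlet (_ : Re _ = \sum_(j < N) cos (kap * v * j%:R)); last first.
    by apply: (big_morph _ (@ReD R)).
  apply: (@le_trans _ _ (\sum_(j < N) (1 / 2))).
    by rewrite sumr_const card_ord -[leRHS]mulr_natr mul1r mulrC.
  apply: ler_sum => j _; apply/cos_ge_half/kv.
  by rewrite ler0n ler_nat ltnW.
have c3 : N%:R / 4 <= normc (dirichlet v) ^+ 2 / N%:R.
  rewrite ler_pdivlMr //.
  have : (N%:R / 2) ^+ 2 <= normc (dirichlet v) ^+ 2.
    by rewrite ler_sqr ?nnegrE ?normc_ge0 // divr_ge0 // ltW.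
  by apply: le_trans; rewrite le_eqVlt (_ : _ == _) //; apply/eqP; field.
have := N0; nra.
Qed.

Lemma fejer_freq_neq0 p : fejer_freq p != 0.
Proof.
rewrite mulf_neq0 ?(gt_eqF kap_gt0) //; apply/eqP => h.
have : (2 * p.1 + 1)%:R = (2 * p.2)%:R :> R by rewrite natrD !natrM; lra.
by move/eqP; rewrite eqr_nat => /eqP/(congr1 odd); rewrite oddD !oddM.
Qed.

Let inv_freq_le (p : 'I_N * 'I_N) :
  `|fejer_freq p|^-1 <= 4 / kap * ((p.1 - p.2 + (p.2 - p.1)).+1%:R)^-1.
Proof.
case: p => j l /=; have k0 := kap_gt0.
set d := (j - l + (l - j)).+1%:R : R.
have d0 : 0 < d by rewrite ltr0n.
suff h : kap * d / 4 <= `|fejer_freq (j, l)|.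
  rewrite (_ : 4 / kap * d^-1 = (kap * d / 4)^-1); last by field; rewrite !gt_eqF.
  by rewrite lef_pV2 ?posrE ?normr_gt0 ?fejer_freq_neq0 // divr_gt0 // mulr_gt0.
rewrite /fejer_freq normrM (gtr0_norm kap_gt0) -mulrA ler_pM2l //=.
rewrite /d -natr1 natrD; case: (leqP l j) => [lj|jl].
  rewrite [(l - j)%N](eqP (_ : _ == 0)%N) ?subn_eq0 // natrB // addr0.
  have : (l%:R : R) <= j%:R by rewrite ler_nat.
  by move=> h; apply: le_trans (ler_norm _); lra.
rewrite [(j - l)%N](eqP (_ : _ == 0)%N) ?subn_eq0 ?natrB ?add0r; last by rewrite ltnW.
  have : (j.+1%:R : R) <= l%:R by rewrite ler_nat.
  by rewrite -natr1 => h; rewrite -normrN; apply: le_trans (ler_norm _); lra.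
by rewrite ltnW.
Qed.

Let sum_decreasing (g : nat -> R) (j : 'I_N) :
  (forall m, 0 <= g m) -> (forall m, g m.+1 <= g m) ->
  \sum_(l < N) g (j - l + (l - j))%N <= 2 * \sum_(m < N) g m.
Proof.
move=> g0 gd; rewrite -(big_mkord xpredT (fun l => g (j - l + (l - j))%N)).
rewrite -(big_mkord xpredT g) (@big_cat_nat _ _ _ j) //=; last exact: ltnW.
have le n : (n <= N)%N -> \sum_(0 <= m < n) g m <= \sum_(0 <= m < N) g m.
  move=> nN; rewrite (@big_cat_nat _ _ _ n 0 N) //= lerDl.
  exact: sumr_ge0.
rewrite mulr_natl mulr2n; apply: lerD.
- apply: le_trans (le j (ltnW (ltn_ord j))).
  rewrite big_nat_rev /= add0n big_nat [leRHS]big_nat.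
  apply: ler_sum => m /andP[_ mj].
  rewrite (_ : (_ + _)%N = m.+1) //; lia.
- apply: le_trans (le (N - j)%N (leq_subr _ _)).
  rewrite -{1}[j : nat]add0n big_addn.
  by apply: ler_sum => m _; rewrite (_ : (_ + _)%N = m) //; lia.
Qed.

(** The antiderivative of the kernel in time has the coefficients of the kernel
    divided by its frequencies; their total size is logarithmic. *)
Lemma fejer_l1 : \sum_p normc (fejer_weight p) * `|fejer_freq p|^-1 <=
  8 / kap * (1 + ln N%:R).
Proof.
have k0 := kap_gt0.
have w p : normc (fejer_weight p) = N%:R^-1.
  by rewrite normcM normc_expi normc_real mulr1 ger0_norm // invr_ge0 ltW.
apply: (@le_trans _ _ (\sum_(j < N) \sum_(l < N)
    N%:R^-1 * (4 / kap * ((j - l + (l - j)).+1%:R)^-1))).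
  rewrite pair_bigA; apply: ler_sum => p _; rewrite w.
  by apply: ler_wpM2l; [rewrite invr_ge0 ltW | exact: inv_freq_le].
apply: (@le_trans _ _ (\sum_(j < N) N%:R^-1 * (4 / kap * (2 * (1 + ln N%:R))))).
  apply: ler_sum => j _; rewrite -mulr_sumr -mulr_sumr.
  apply: ler_wpM2l; first by rewrite invr_ge0 ltW.
  apply: ler_wpM2l; first by rewrite divr_ge0 // ltW.
  apply: le_trans (@sum_decreasing (fun m => m.+1%:R^-1) j _ _) _.
  - by move=> m; rewrite invr_ge0.
  - by move=> m; rewrite lef_pV2 ?posrE // ler_nat.
  - by apply: ler_wpM2l => //; case: (N) N_gt0 => // n _; exact: harmonic_le_ln.
rewrite sumr_const card_ord -mulr_natl le_eqVlt (_ : _ == _) //; apply/eqP.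
by move: (ln _) => L; field; rewrite !gt_eqF.
Qed.

End Fejer.

(** * Products of two amplitudes *)
Section LinearTransport.
Variable R : realType.
Implicit Types (x t : R) (p q : R[i]).
Variables (nu rho sg : R) (r s tau : R -> R).
Hypothesis med : medium nu rho sg r s tau.

(** Bounds combinations of both amplitudes with coefficients of modulus at most
    1; being at least 1, it can be replaced by its square. *)
Definition pair_cst : R := 2 * transport_cst nu sg + 1.

Lemma transport_cst_ge0 : 0 <= transport_cst nu sg.
Proof.
have h : 0 <= sg by exact: medium_sg_ge0 med.
rewrite /transport_cst mulr_ge0 ?expR_ge0 // mulr_ge0 // addr_ge0 // divr_ge0 //.
by rewrite mulr_ge0 // sqr_ge0.
Qed.

Lemma pair_cst_ge1 : 1 <= pair_cst.
Proof. by rewrite /pair_cst; have := transport_cst_ge0; lra. Qed.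

Section Weights.
Variables (J : finType) (k : J -> R) (al be : J -> R -> R[i]).
Hypothesis modes : forall j, mode r s (k j) (al j) (be j).
Variables (M M1 : R -> R) (Tm : R) (c : J -> R[i]).
Hypothesis dM : forall t, 0 <= t <= Tm -> rder M t (- M1 t).
Hypothesis M1_ge0 : forall t, 0 <= t <= Tm -> 0 <= M1 t.
Hypothesis M_gt0 : forall t, 0 < M t.
Hypothesis chi_le : forall t, 0 <= t <= Tm -> normc (trig c k t) <= M1 t + M t.

Lemma transport_lin p q x t : normc p <= 1 -> normc q <= 1 ->
  0 <= x <= 1 -> 0 <= t -> t + 2 * (tau 1 - tau x) <= Tm ->
  normc (\sum_j c j * expi (k j * t) * (p * (al j x - 1) + q * be j x))
    <= pair_cst * M t.
Proof.
move=> p1 q1 hx t0 tT.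
have [ha hb] := transport med modes dM M1_ge0 M_gt0 chi_le (erefl _) hx t0 tT.
rewrite (_ : \sum_j _ = p * (\sum_j c j * expi (k j * t) * (al j x - 1))
   + q * (\sum_j c j * expi (k j * t) * be j x)); last first.
  by rewrite !mulr_sumr -big_split; apply: eq_bigr => j _ /=; ring.
apply: le_trans (normcD _ _) _; rewrite !normcM.
have H z (w : R[i]) B : normc z <= 1 -> normc w <= B -> normc z * normc w <= B.
  move=> h1 h2; apply: le_trans h2; rewrite -[leRHS]mul1r ler_wpM2r //; exact: normc_ge0.
have := H p _ _ p1 ha; have := H q _ _ q1 hb; rewrite /pair_cst.
have := M_gt0 t; lra.
Qed.

End Weights.
End LinearTransport.

Section PairTransport.
Variable R : realType.
Implicit Types (x t : R) (p q : R[i]).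
Variables (nu rho sg : R) (r s tau r' s' tau' : R -> R).
Hypotheses (med : medium nu rho sg r s tau) (med' : medium nu rho sg r' s' tau').
Variables (J : finType) (k : J -> R) (al be al' be' : J -> R -> R[i]).
Hypothesis modes : forall j, mode r s (k j) (al j) (be j).
Hypothesis modes' : forall j, mode r' s' (k j) (al' j) (be' j).
Variables (M M1 : R -> R) (Tm : R) (c : J -> R[i]).
Hypothesis dM : forall t, 0 <= t <= Tm -> rder M t (- M1 t).
Hypothesis M1_ge0 : forall t, 0 <= t <= Tm -> 0 <= M1 t.
Hypothesis M_gt0 : forall t, 0 < M t.
Hypothesis chi_le : forall t, 0 <= t <= Tm -> normc (trig c k t) <= M1 t + M t.

Local Notation C := (pair_cst nu sg).

(** The transport estimate for the second medium bounds the superpositions in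
    which the factors of that medium at x are absorbed into the weights; the
    estimate for the first one then applies to these new weights, over a range
    of times shortened by the travel time in the second medium. *)
Lemma transport_pair p q p' q' x t :
  normc p <= 1 -> normc q <= 1 -> normc p' <= 1 -> normc q' <= 1 ->
  0 <= x <= 1 -> 0 <= t ->
  t + 2 * (tau 1 - tau x) + 2 * (tau' 1 - tau' x) <= Tm ->
  normc (\sum_j c j * expi (k j * t) *
     ((p * (al j x - 1) + q * be j x) * (p' * (al' j x - 1) + q' * be' j x)))
    <= C ^+ 2 * M t.
Proof.
move=> p1 q1 p1' q1' hx t0 tT.
have C1 : 1 <= C by exact: pair_cst_ge1 med.
have C0 : 0 < C by apply: lt_le_trans C1.
pose c' j := c j * (p' * (al' j x - 1) + q' * be' j x).
pose Tm' := Tm - 2 * (tau' 1 - tau' x).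
have tx : 0 <= tau' 1 - tau' x.
  by case/andP: hx => x0 x1; rewrite subr_ge0 (tau_nondecreasing med').
have TT u : 0 <= u <= Tm' -> 0 <= u <= Tm.
  by rewrite /Tm' => /andP[-> h] /=; lra.
rewrite (_ : \sum_j _ =
   \sum_j c' j * expi (k j * t) * (p * (al j x - 1) + q * be j x)); last first.
  by apply: eq_bigr => j _; rewrite /c'; ring.
rewrite expr2 -mulrA.
have := @transport_lin R nu rho sg r s tau med J k al be modes
   (fun u => C * M u) (fun u => C * M1 u) Tm' c' _ _ _ _ p q x t p1 q1 hx t0 _.
apply.
- move=> u /TT hu; apply: rder_eq.
    by apply: rderM; [exact: rder_cst | exact: dM].
  by rewrite mul0r add0r mulrN.
- by move=> u /TT hu; rewrite mulr_ge0 ?M1_ge0 // ltW.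
- by move=> u; rewrite mulr_gt0.
- move=> u hu; have /andP[u0 _] := hu.
  apply: (@le_trans _ _ (C * M u)); last first.
    by rewrite lerDr mulr_ge0 ?M1_ge0 ?TT // ltW.
  rewrite /trig (_ : \sum_j _ = \sum_j c j * expi (k j * u) *
     (p' * (al' j x - 1) + q' * be' j x)); last first.
    by apply: eq_bigr => j _; rewrite /c'; ring.
  apply: (transport_lin med' modes' dM M1_ge0 M_gt0 chi_le) => //.
  by case/andP: hu; rewrite /Tm' => _; lra.
- by rewrite /Tm'; lra.
Qed.

(** To leading order the product of the two waves is a pure phase, which is what
    makes it possible to read the contrast off at a prescribed travel time. *)
Lemma transport_sum_product x t : 0 <= x <= 1 -> 0 <= t ->
  t + 2 * (tau 1 - tau x) + 2 * (tau' 1 - tau' x) <= Tm ->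
  normc (\sum_j c j * expi (k j * t) * ((al j x + be j x) * (al' j x + be' j x))
         - trig c k t) <= 3 * C ^+ 2 * M t.
Proof.
move=> hx t0 tT.
have n1 : normc (1 : R[i]) <= 1 by rewrite Normc.normc1.
have h1 : tau x <= tau 1 by case/andP: hx => x0 x1; rewrite (tau_nondecreasing med).
have h2 : tau' x <= tau' 1 by case/andP: hx => x0 x1; rewrite (tau_nondecreasing med').
have C1 : 1 <= C by exact: pair_cst_ge1 med.
rewrite (_ : _ - trig c k t =
    \sum_j c j * expi (k j * t) * (1 * (al j x - 1) + 1 * be j x)
  + \sum_j c j * expi (k j * t) * (1 * (al' j x - 1) + 1 * be' j x)
  + \sum_j c j * expi (k j * t) *
     ((1 * (al j x - 1) + 1 * be j x) * (1 * (al' j x - 1) + 1 * be' j x))); last first.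
  by rewrite /trig -sumrB -!big_split; apply: eq_bigr => j _ /=; ring.
have a1 : normc (\sum_j c j * expi (k j * t) * (1 * (al j x - 1) + 1 * be j x)) <= C * M t.
  by apply: (transport_lin med modes dM M1_ge0 M_gt0 chi_le) => //; lra.
have a2 : normc (\sum_j c j * expi (k j * t) * (1 * (al' j x - 1) + 1 * be' j x)) <= C * M t.
  by apply: (transport_lin med' modes' dM M1_ge0 M_gt0 chi_le) => //; lra.
have a3 := @transport_pair 1 1 1 1 x t n1 n1 n1 n1 hx t0 tT.
apply: le_trans (normcD _ _) _; apply: le_trans (lerD (normcD _ _) a3) _.
apply: le_trans (lerD (lerD a1 a2) (lexx _)) _.
have : C * M t <= C ^+ 2 * M t.
  by apply: ler_wpM2r; [exact: ltW | rewrite expr2 ler_peMl // (le_trans ler01 C1)].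
lra.
Qed.

End PairTransport.

(** * Stability for measurements at all frequencies *)

(** The quantity that is stably determined: up to the positive factor
    r r' (r^2 + r'^2) it is the difference of the two potentials. *)
Definition contrast (R : realType) (r r' : R -> R) (x : R) : R := r x / r' x - r' x / r x.

Section TwoMedia.
Variable R : realType.
Implicit Types (x y t k : R).
Variables (nu rho sg : R) (r s tau r' s' tau' : R -> R).
Hypotheses (med : medium nu rho sg r s tau) (med' : medium nu rho sg r' s' tau').

(** The difference of the two impedances, multiplied by their denominators. *)
Definition mode_defect (al be al' be' : R -> R[i]) x : R[i] :=
  (al x - be x) * (al' x + be' x) - (al x + be x) * (al' x - be' x).

Local Notation gam := (contrast r r').
Let T x := tau x + tau' x.

Let nu0 : 0 < nu := medium_nu med.
Let rho1 : 1 <= rho := medium_rho_ge1 med.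
Let sg0 : 0 <= sg := medium_sg_ge0 med.
Let r0 x (h : 0 <= x <= 1) : 0 < r x := medium_r_gt0 med h.
Let r0' x (h : 0 <= x <= 1) : 0 < r' x := medium_r_gt0 med' h.

Let dratio x : 0 <= x <= 1 -> rder (fun y => r y / r' y) x ((s x - s' x) * (r x / r' x)).
Proof.
move=> h; have p := r0 h; have p' := r0' h.
apply: rder_eq.
  apply: rderM; first exact: (medium_r med).
  by apply: rderV; [rewrite gt_eqF | exact: (medium_r med')].
by rewrite /=; field; rewrite !gt_eqF.
Qed.

Let dratio' x : 0 <= x <= 1 -> rder (fun y => r' y / r y) x ((s' x - s x) * (r' x / r x)).
Proof.
move=> h; have p := r0 h; have p' := r0' h.
apply: rder_eq.
  apply: rderM; first exact: (medium_r med').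
  by apply: rderV; [rewrite gt_eqF | exact: (medium_r med)].
by rewrite /=; field; rewrite !gt_eqF.
Qed.

Let dT x : 0 <= x <= 1 -> rder T x (r x ^+ 2 + r' x ^+ 2).
Proof. by move=> h; apply: rderD; [exact: (medium_tau med)|exact: (medium_tau med')]. Qed.

Let T_ge x y : 0 <= x -> x <= y -> y <= 1 ->
  2 * nu ^+ 2 * (y - x) <= T y - T x <= 2 * rho ^+ 2 * (y - x).
Proof.
move=> h1 h2 h3.
have /andP[a1 a2] := tau_lipschitz med h1 h2 h3.
have /andP[b1 b2] := tau_lipschitz med' h1 h2 h3.
by rewrite /T; apply/andP; split; lra.
Qed.

Let T0 : T 0 = 0. Proof. by rewrite /T (medium_tau0 med) (medium_tau0 med') addr0. Qed.

Section Wronskian.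
Variables (k : R) (al be al' be' : R -> R[i]).
Hypotheses (mo : mode r s k al be) (mo' : mode r' s' k al' be').

(** For the waves u and u' in the two media and their fluxes v and v' this is
    v u' - u v', written in the amplitudes. *)
Definition wronskian x : R[i] :=
  expi (k * T x) * ((r x / r' x)%:C * ((al x - be x) * (al' x + be' x))
                  - (r' x / r x)%:C * ((al x + be x) * (al' x - be' x))).

Lemma wronskian1 : wronskian 1 = 0.
Proof.
rewrite /wronskian (medium_r1 med) (medium_r1 med') (mode_al1 mo) (mode_al1 mo').
by rewrite (mode_be1 mo) (mode_be1 mo') divr1; ring.
Qed.

Lemma wronskian0 : wronskian 0 = mode_defect al be al' be' 0.
Proof.
rewrite /wronskian (medium_r0 med) (medium_r0 med') T0 mulr0 expi0 divr1 /mode_defect.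
ring.
Qed.

(** Both waves solve the same equation up to the difference of the
    coefficients, so that the derivative is linear in the contrast. *)
Lemma cder_wronskian x : 0 <= x <= 1 ->
  cder wronskian x (ii * (k * (gam x * (r x ^+ 2 + r' x ^+ 2)))%:C *
    (expi (k * T x) * ((al x + be x) * (al' x + be' x)))).
Proof.
move=> h; have p := r0 h; have p' := r0' h.
have [da db] := mode_ode mo h; have [da' db'] := mode_ode mo' h.
apply: cder_eq.
  apply: cderM.
    apply: cder_expi; apply: (@rder_comp R (fun z => k * z)); first exact: rder_linear.
    exact: dT.
  apply: cderB.
    apply: cderM; first exact/cder_real/dratio.
    by apply: cderM; [apply: cderB | apply: cderD]; eassumption.
  apply: cderM; first exact/cder_real/dratio'.
  by apply: cderM; [apply: cderD | apply: cderB]; eassumption.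
have e : (r x / r' x) * r' x ^+ 2 = (r' x / r x) * r x ^+ 2 by field; rewrite !gt_eqF.
rewrite /contrast; move: (expi _) (al x) (be x) (al' x) (be' x) => E a b a' b'.
move: (r x / r' x) (r' x / r x) e => u v e.
rewrite !(rmorphM, rmorphD, rmorphN, rmorph1) /=.
have : u%:C * (r' x)%:C ^+ 2 = v%:C * (r x)%:C ^+ 2.
  by rewrite -!rmorphXn -!rmorphM e.
move: (u%:C) (v%:C) ((r x)%:C) ((r' x)%:C) ((s x)%:C) ((s' x)%:C) (k%:C) => U V X X' S S' K eU.
suff h0 : U * X' ^+ 2 - V * X ^+ 2 = 0.
  apply/eqP; rewrite -subr_eq0; apply/eqP.
  rewrite -[RHS](mulr0 (ii * K * E * ((a - b) * (a' - b') - (a + b) * (a' + b')))) -h0.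
  ring.
by rewrite eU subrr.
Qed.

End Wronskian.

Let ratio_le a b : 0 <= a -> a <= rho -> nu <= b -> a / b <= rho / nu.
Proof.
move=> a0 ar nb; have b0 : 0 < b by exact: lt_le_trans nb.
apply: ler_pM => //; first by rewrite invr_ge0 ltW.
by rewrite lef_pV2.
Qed.

Let contrast_le x : 0 <= x <= 1 -> `|gam x| <= rho / nu.
Proof.
move=> h; have p := ltW (r0 h); have p' := ltW (r0' h).
have q1 : r x / r' x <= rho / nu.
  by apply: ratio_le; [| exact: (medium_le med) | exact: (medium_ge med')].
have q2 : r' x / r x <= rho / nu.
  by apply: ratio_le; [| exact: (medium_le med') | exact: (medium_ge med)].
have q3 : 0 <= r x / r' x by rewrite divr_ge0.
have q4 : 0 <= r' x / r x by rewrite divr_ge0.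
by rewrite /contrast ler_norml; apply/andP; split; lra.
Qed.

Definition contrast_slope : R := 4 * sg * (rho / nu).

Let contrast_lipschitz x y : 0 <= x -> x <= y -> y <= 1 ->
  `|gam y - gam x| <= contrast_slope * (y - x).
Proof.
move=> x0 xy y1.
have H z : x <= z <= y -> 0 <= z <= 1.
  by case/andP=> h1 h2; rewrite (le_trans x0 h1) (le_trans h2 y1).
have := @cder_mean_value R (fun z => (gam z)%:C)
  (fun z => ((s z - s' z) * (r z / r' z) - (s' z - s z) * (r' z / r z))%:C)
  (fun z => contrast_slope * z) (fun=> contrast_slope) x y.
rewrite -rmorphB normc_real mulrBr; apply => // z /H hz.
- by apply/cder_real/rderB; [exact: dratio | exact: dratio'].
- exact: rder_linear.
- rewrite normc_real.
  have -> : (s z - s' z) * (r z / r' z) - (s' z - s z) * (r' z / r z)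
     = (s z - s' z) * (r z / r' z + r' z / r z) by ring.
  have p := ltW (r0 hz); have p' := ltW (r0' hz).
  rewrite normrM (_ : contrast_slope = (sg + sg) * (rho / nu + rho / nu)); last first.
    by rewrite /contrast_slope; ring.
  apply: ler_pM => //.
    apply: le_trans (ler_normB _ _) _.
    by apply: lerD; [exact: (medium_s med) | exact: (medium_s med')].
  apply: le_trans (ler_normD _ _) _; rewrite !ger0_norm ?divr_ge0 //.
  apply: lerD; apply: ratio_le => //; by
    [exact: (medium_le med)|exact: (medium_ge med')|exact: (medium_le med')|exact: (medium_ge med)].
Qed.

Let nu_le1 : nu <= 1.
Proof. by rewrite -(medium_r0 med); apply: (medium_ge med); rewrite lexx ler01. Qed.

Section LocalEstimate.
Variables (eps : R) (N : nat).
Hypotheses (N_gt0 : (0 < N)%N) (eps_ge0 : 0 <= eps).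
Hypothesis data : forall k, k != 0 -> exists al be al' be',
  [/\ mode r s k al be, mode r' s' k al' be' & normc (mode_defect al be al' be' 0) <= eps].

(** The step of the probing frequencies is the inverse of a bound for the sum of
    the round trip times in both media. *)
Definition probe_freq : R := (4 * rho ^+ 2)^-1.
Definition probe_mass : R := fejer_cst probe_freq.
(** In the local estimate, near_cst stems from the variation of the contrast
    near x0, far_cst from the transport correction to the right of x0, and
    volterra_cst from that correction to the left of x0. *)
Definition near_cst : R := contrast_slope * probe_mass / (2 * nu ^+ 2).
Definition far_cst : R := rho / nu * (3 * pair_cst nu sg ^+ 2) * probe_mass.
Definition tail_cst : R :=
  (near_cst + far_cst) * (1 + ln (1 + (4 * rho ^+ 2) ^+ 2)) + far_cst.
Definition volterra_cst : R := 2 * rho ^+ 2 * (3 * pair_cst nu sg ^+ 2) * probe_mass * pi.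
Definition volterra_rate : R := 16 * volterra_cst / nu ^+ 2 + 1.

Let N0 : (0 : R) < N%:R. Proof. by rewrite ltr0n. Qed.
Let N1 : (1 : R) <= N%:R. Proof. by rewrite ler1n. Qed.
Let rho2 : 1 <= rho ^+ 2. Proof. exact: exprn_ege1. Qed.
Let kap0 : 0 < probe_freq. Proof. by rewrite invr_gt0; have := rho2; lra. Qed.
Let kap1 : probe_freq <= 1. Proof. by rewrite invf_le1; have := rho2; lra. Qed.
Let mass0 : 0 < probe_mass.
Proof. by rewrite /probe_mass /fejer_cst ltr_pwDl // divr_ge0 // sqr_ge0. Qed.
Let nu2 : 0 < nu ^+ 2. Proof. exact: exprn_gt0. Qed.
Let rho0 : 0 < rho. Proof. exact: lt_le_trans rho1. Qed.
Let pair0 : 0 < 3 * pair_cst nu sg ^+ 2.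
Proof. by rewrite mulr_gt0 // exprn_gt0 // (lt_le_trans ltr01 (pair_cst_ge1 med)). Qed.
Let slope0 : 0 <= contrast_slope.
Proof. by apply: mulr_ge0; [exact: mulr_ge0 | exact/ltW/divr_gt0]. Qed.
Let near0 : 0 <= near_cst.
Proof. by apply: divr_ge0; apply: mulr_ge0 => //; exact: ltW. Qed.
Let far0 : 0 <= far_cst.
Proof. by apply: ltW; apply: mulr_gt0 => //; apply: mulr_gt0 => //; exact: divr_gt0. Qed.
Let volt0 : 0 < volterra_cst.
Proof.
rewrite /volterra_cst mulr_gt0 ?pi_gt0 // mulr_gt0 // mulr_gt0 // mulr_gt0 //.
exact: exprn_gt0.
Qed.
Let rate0 : 0 < volterra_rate.
Proof. by rewrite /volterra_rate ltr_pwDr // ltW // divr_gt0 // mulr_gt0. Qed.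

Section AtPoint.
Variables (x0 B : R).
Hypotheses (x0_01 : 0 <= x0 <= 1) (B0 : 0 <= B).
Hypothesis gamB : forall x, 0 <= x <= 1 -> `|gam x| <= B * expR (volterra_rate * x).

Let t0 := T x0.
Let w := @fejer_weight R N probe_freq t0.
Let f := @fejer_freq R N probe_freq.
Let v x := T x - t0.
Let Tm : R := 4 * rho ^+ 2.

Let T_range x : 0 <= x <= 1 -> 0 <= T x <= Tm.
Proof.
case/andP=> h0 h1.
have := T_ge (lexx 0) h0 h1; rewrite T0 subr0 => /andP[a1 a2].
have b1 : 0 <= 2 * nu ^+ 2 * (x - 0) by rewrite subr0 !mulr_ge0 // ltW.
have b2 : 2 * rho ^+ 2 * (x - 0) <= Tm by rewrite /Tm subr0; have := rho2; nra.
by apply/andP; split; lra.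
Qed.

Let kap_small t : 0 <= t <= Tm -> `|probe_freq * (t - t0)| <= 1.
Proof.
move=> /andP[h1 h2]; have /andP[h3 h4] := T_range x0_01.
rewrite normrM gtr0_norm // /probe_freq mulrC ler_pdivrMr ?mul1r; last by have := rho2; lra.
by rewrite ler_norml /t0; apply/andP; split; move: h2 h4; rewrite /Tm; lra.
Qed.

(** Majorant and integrated majorant of the kernel centred at the travel time
    of the point x0. *)
Let M1 t := probe_mass * (N%:R / (1 + (N%:R * (t - t0)) ^+ 2)).
Let M t := probe_mass * (pi / 2 - atan (N%:R * (t - t0))).

Let den_gt0 t : 0 < 1 + (N%:R * (t - t0)) ^+ 2.
Proof. by rewrite ltr_pwDl ?sqr_ge0. Qed.

Let dM t : rder M t (- M1 t).
Proof.
apply: rder_eq.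
  apply: rderM; first exact: rder_cst.
  apply: (@rder_comp R (fun y => pi / 2 - atan (N%:R * y)) (fun y => y - t0)).
    exact: rder_coatan.
  by apply: rderB; [exact: rder_id | exact: rder_cst].
by rewrite /M1 subr0 mulr1 mul0r add0r mulrN.
Qed.
Let M1_ge0 t : 0 <= M1 t.
Proof. by rewrite /M1 mulr_ge0 ?divr_ge0 // ltW. Qed.
Let M_gt0 t : 0 < M t.
Proof. by rewrite /M mulr_gt0 // coatan_gt0. Qed.
Let chi_le t : 0 <= t <= Tm -> normc (trig w f t) <= M1 t.
Proof. by move=> ht; apply: fejer_bound => //; exact: kap_small. Qed.

Let v_sign x y : 0 <= x -> x <= y -> y <= 1 -> v x <= v y.
Proof.
move=> h1 h2 h3; have /andP[h _] := T_ge h1 h2 h3.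
have : 0 <= 2 * nu ^+ 2 * (y - x) by rewrite !mulr_ge0 ?subr_ge0 // ltW.
rewrite /v; lra.
Qed.

(** The contrast is Lipschitz, hence close to its value at x0 where the kernel
    is large. *)
Let dist_le x : 0 <= x <= 1 ->
  `|gam x - gam x0| <= contrast_slope / (2 * nu ^+ 2) * `|v x|.
Proof.
case/andP=> h0 h1; have /andP[g0 g1] := x0_01.
have key a b : 0 <= a -> a <= b -> b <= 1 ->
    contrast_slope * (b - a) <= contrast_slope / (2 * nu ^+ 2) * (T b - T a).
  move=> a0 ab b1; have /andP[h _] := T_ge a0 ab b1.
  rewrite -[leRHS]mulrA ler_wpM2l // mulrC ler_pdivlMr ?mulr_gt0 //.
  by rewrite mulrC.
have [xx|/ltW xx] := leP x x0.
  rewrite distrC -[`|v x|]normrN -[- v x]/(- (T x - t0)) [- (T x - t0)]opprB.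
  apply: le_trans (contrast_lipschitz h0 xx g1) _.
  apply: le_trans (key _ _ h0 xx g1) _; apply: ler_wpM2l; last exact: ler_norm.
  by rewrite divr_ge0 // mulr_ge0 // ltW.
apply: le_trans (contrast_lipschitz g0 xx h1) _.
apply: le_trans (key _ _ g0 xx h1) _; apply: ler_wpM2l; last exact: ler_norm.
by rewrite divr_ge0 // mulr_ge0 // ltW.
Qed.

Let dT' x := r x ^+ 2 + r' x ^+ 2.
Let dv x : 0 <= x <= 1 -> rder v x (dT' x).
Proof.
by move=> h; apply: rder_eq; [apply: rderB; [exact: dT | exact: rder_cst] | rewrite subr0].
Qed.
Let dT'_ge0 x : 0 <= dT' x. Proof. by rewrite addr_ge0 ?sqr_ge0. Qed.
Let dT'_le x : 0 <= x <= 1 -> dT' x <= 2 * rho ^+ 2.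
Proof.
by move=> h; have := medium_r2_le med h; have := medium_r2_le med' h; rewrite /dT'; lra.
Qed.

(** The primitives, in the variable x, of the two profiles that occur in the
    error: a tail of the Lorentzian weighted by the distance to x0, and the
    integrated majorant to the right of x0. *)
Let Lg x := ln (1 + (N%:R * v x) ^+ 2) / (2 * N%:R).
Let dLg x : 0 <= x <= 1 -> rder Lg x (N%:R * v x / (1 + (N%:R * v x) ^+ 2) * dT' x).
Proof.
move=> h; apply: rder_eq.
  apply: rderM; last exact: rder_cst.
  by apply: (@rder_comp R (fun y => ln (1 + (N%:R * y) ^+ 2)) v); [exact: rder_log_quad|exact: dv].
by rewrite /=; move: (den_gt0 (T x)) => d0; field; rewrite !gt_eqF.
Qed.

Let Ct x := v x * (pi / 2 - atan (N%:R * v x)).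
Let dCt x : 0 <= x <= 1 -> rder Ct x
  ((pi / 2 - atan (N%:R * v x)) * dT' x - N%:R * v x / (1 + (N%:R * v x) ^+ 2) * dT' x).
Proof.
move=> h; apply: rder_eq.
  apply: rderM; first exact: dv.
  apply: (@rder_comp R (fun y => pi / 2 - atan (N%:R * y)) v); last exact: dv.
  exact: rder_coatan.
by rewrite /=; ring.
Qed.

Let Lg_le x : 0 <= x <= 1 -> Lg x <= (1 + ln (1 + Tm ^+ 2)) * (1 + ln N%:R) / N%:R.
Proof.
move=> h; have /andP[a1 a2] := T_range h; have /andP[b1 b2] := T_range x0_01.
have vT : v x ^+ 2 <= Tm ^+ 2.
  rewrite -[v x ^+ 2]real_normK ?num_real // ler_sqr ?nnegrE ?normr_ge0 //; last by lra.
  by rewrite ler_norml /v /t0; apply/andP; split; lra.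
have lN : 0 <= ln N%:R :> R by rewrite ln_ge0.
have lT : 0 <= ln (1 + Tm ^+ 2) by rewrite ln_ge0 // lerDl sqr_ge0.
have h1 : ln (1 + (N%:R * v x) ^+ 2) <= 2 * ln N%:R + ln (1 + Tm ^+ 2).
  have pT : 0 < 1 + Tm ^+ 2 by rewrite ltr_pwDl ?sqr_ge0.
  rewrite [2 * ln _]mulr_natl -lnXn // -lnM ?posrE ?exprn_gt0 // ler_ln ?posrE ?mulr_gt0 ?exprn_gt0 //.
    rewrite exprMn; have : 1 <= N%:R ^+ 2 :> R by exact: exprn_ege1.
    have : 0 <= N%:R ^+ 2 :> R by exact: sqr_ge0.
    nra.
  by rewrite /v; exact: den_gt0.
rewrite /Lg invfM mulrA ler_wpM2r ?invr_ge0 ?ler0n //.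
by rewrite ler_pdivrMr //; nra.
Qed.

Let Ct_le x : 0 <= x <= 1 -> x0 <= x -> Ct x <= N%:R^-1.
Proof.
case/andP=> h0 h1 h2; have /andP[g0 g1] := x0_01.
have : 0 <= v x by have := v_sign g0 h2 h1; rewrite {1}/v /t0 subrr.
rewrite le_eqVlt => /predU1P[e|v0]; first by rewrite /Ct -e mul0r invr_ge0 ler0n.
rewrite /Ct; apply: (@le_trans _ _ (v x * (N%:R * v x)^-1)).
  by apply: ler_wpM2l; [exact: ltW | apply: coatan_le_inv; rewrite mulr_gt0].
by rewrite invfM mulrCA divff ?gt_eqF // mulr1.
Qed.

Let choose_modes : exists F : 'I_N * 'I_N -> (R -> R[i]) * (R -> R[i]) * ((R -> R[i]) * (R -> R[i])),
  forall p, [/\ mode r s (f p) (F p).1.1 (F p).1.2, mode r' s' (f p) (F p).2.1 (F p).2.2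
     & normc (mode_defect (F p).1.1 (F p).1.2 (F p).2.1 (F p).2.2 0) <= eps].
Proof.
have H p : exists F : (R -> R[i]) * (R -> R[i]) * ((R -> R[i]) * (R -> R[i])),
  [/\ mode r s (f p) F.1.1 F.1.2, mode r' s' (f p) F.2.1 F.2.2
     & normc (mode_defect F.1.1 F.1.2 F.2.1 F.2.2 0) <= eps].
  have [a [b [a' [b' h]]]] := data (fejer_freq_neq0 kap0 p).
  by exists ((a, b), (a', b')).
by have [F HF] := choice H; exists F.
Qed.

(** The Wronskians are summed against the antiderivative of the kernel centred
    at the travel time of x0. The boundary terms are the data; the increment is
    the integral of the contrast against the kernel, whose mass gives the value
    at x0. To the left of x0 the integrated majorant does not decay, which
    leaves a Volterra term: the contrast on the left of x0, measured in an
    exponential weight. *)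
Lemma local_estimate : `|gam x0| * (nu ^+ 2 / 8) <=
  (8 / probe_freq * eps + 2 * tail_cst / N%:R) * (1 + ln N%:R)
  + volterra_cst * B / volterra_rate * expR (volterra_rate * x0).
Proof.
have /andP[x00 x01] := x0_01.
have [F HF] := choose_modes.
pose al p := (F p).1.1; pose be p := (F p).1.2.
pose al' p := (F p).2.1; pose be' p := (F p).2.2.
have modes p : mode r s (f p) (al p) (be p) by have [] := HF p.
have modes' p : mode r' s' (f p) (al' p) (be' p) by have [] := HF p.
have f0 p : f p != 0 by exact: fejer_freq_neq0.
pose a p : R[i] := w p * (- ii * ((f p)^-1)%:C).
pose W x := \sum_p a p * wronskian (f p) (al p) (be p) (al' p) (be' p) x.
pose P x := \sum_p w p * expi (f p * T x) * ((al p x + be p x) * (al' p x + be' p x)).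
have iik p (z : R[i]) : w p * z = a p * (ii * (f p)%:C * z).
  have e : (f p)^-1%:C * (f p)%:C = 1 by rewrite -rmorphM mulVf.
  have i2 : ii * ii = -1 :> R[i] by apply: complexP; rewrite !reimE /=; ring.
  rewrite (_ : a p * _ = w p * z * (- (ii * ii)) * ((f p)^-1%:C * (f p)%:C)); last first.
    by rewrite /a; ring.
  by rewrite i2 e opprK !mulr1.
have dW x : 0 <= x <= 1 -> cder W x ((gam x * dT' x)%:C * P x).
  move=> h; apply: cder_eq.
    apply: cder_sum => p; apply: cderM; first exact: cder_cst.
    exact: (cder_wronskian (modes p) (modes' p) h).
  rewrite /P mulr_sumr; apply: eq_bigr => p _ /=.
  rewrite mul0r add0r -[w p * _ * _]mulrA iik -/(dT' x) !(rmorphM (real_complex R)).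
  ring.
have dH t : cder (trig a f) t (trig w f t).
  apply: cder_sum => p; apply: cder_eq.
    apply: cderM; first exact: cder_cst.
    by apply: cder_expi; exact: rder_linear.
  by rewrite mul0r add0r iik.
have PT x : 0 <= x <= 1 ->
    normc (P x - trig w f (T x)) <= 3 * pair_cst nu sg ^+ 2 * M (T x).
  move=> h; apply: (@transport_sum_product R nu rho sg r s tau r' s' tau' med med'
    _ f al be al' be' modes modes' M M1 Tm w) => //.
  - by move=> t ht; apply: le_trans (chi_le ht) _; rewrite lerDl ltW.
  - by have /andP[] := T_range h.
  - have /andP[h1 _] := T_range h.
    have t1 := tau1_le med; have t1' := tau1_le med'.
    by move: h1; rewrite /Tm /T; lra.
(* The contrast frozen at x0 integrates exactly and is subtracted. *)
pose J x := W x - (gam x0)%:C * trig a f (T x).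
pose J' x := (gam x * dT' x)%:C * P x - (gam x0)%:C * (trig w f (T x) * (dT' x)%:C).
have dJ x : 0 <= x <= 1 -> cder J x (J' x).
  move=> h; apply: cderB; first exact: dW.
  apply: cder_eq.
    apply: cderM; first exact: cder_cst.
    by apply: cder_comp; [exact: dH | exact: dT].
  by rewrite mul0r add0r.
have J'_le x : 0 <= x <= 1 -> normc (J' x) <=
    near_cst * (N%:R * `|v x| / (1 + (N%:R * v x) ^+ 2) * dT' x)
    + `|gam x| * dT' x * (3 * pair_cst nu sg ^+ 2 * M (T x)).
  move=> h; rewrite (_ : J' x = ((gam x - gam x0) * dT' x)%:C * trig w f (T x)
    + (gam x * dT' x)%:C * (P x - trig w f (T x))); last first.
    by rewrite /J' !(rmorphM, rmorphB) /=; ring.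
  apply: le_trans (normcD _ _) _; rewrite !normcM !normc_real !normrM.
  rewrite (ger0_norm (dT'_ge0 x)); apply: lerD; last first.
    by apply: ler_wpM2l; [rewrite mulr_ge0 | exact: PT].
  rewrite -[leLHS]mulrA; apply: le_trans (ler_wpM2r _ (dist_le h)) _.
    by rewrite mulr_ge0 ?normc_ge0.
  have := chi_le (T_range h) => hc.
  apply: le_trans (ler_wpM2l _ (ler_wpM2l (dT'_ge0 x) hc)) _.
    by rewrite mulr_ge0 // divr_ge0 // mulr_ge0 // ltW.
  rewrite le_eqVlt /near_cst /M1 -/(v x) (_ : _ == _) //; apply/eqP.
  have d0 := den_gt0 (T x); rewrite -/(v x) in d0.
  by field; rewrite !gt_eqF.
have Mx x : M (T x) = probe_mass * (pi / 2 - atan (N%:R * v x)) by [].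
have lN : 0 <= ln N%:R :> R by rewrite ln_ge0.
have near_tail y : 0 <= y <= 1 ->
    (near_cst + far_cst) * Lg y + far_cst / N%:R <= tail_cst / N%:R * (1 + ln N%:R).
  move=> hy; rewrite /tail_cst -/Tm.
  have := ler_wpM2l (addr_ge0 near0 far0) (Lg_le hy).
  have h2 : 0 <= far_cst / N%:R * ln N%:R by rewrite mulr_ge0 // divr_ge0 // ltW.
  move: h2; move: (ln N%:R) (ln (1 + Tm ^+ 2)) (N%:R^-1 : R) => l1 l2 iN h2; nra.
have Lx0 : Lg x0 = 0 by rewrite /Lg /v subrr mulr0 expr0n addr0 ln1 mul0r.
have right : normc (J 1 - J x0) <= tail_cst / N%:R * (1 + ln N%:R).
  have o1 : 0 <= (1 : R) <= 1 by rewrite lexx ler01.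
  have H x : x0 <= x <= 1 -> 0 <= x <= 1.
    by case/andP=> h1 ->; rewrite (le_trans x00 h1).
  apply: le_trans (@cder_mean_value R J J'
    (fun x => near_cst * Lg x + far_cst * (Ct x + Lg x))
    (fun x => near_cst * (N%:R * v x / (1 + (N%:R * v x) ^+ 2) * dT' x)
       + far_cst * ((pi / 2 - atan (N%:R * v x)) * dT' x)) x0 1 _ _ _ x01) _.
  - by move=> x /H; exact: dJ.
  - move=> x /H h; apply: rder_eq.
      apply: rderD; (apply: rderM; first exact: rder_cst); first exact: dLg.
      by apply: rderD; [exact: dCt | exact: dLg].
    by rewrite !mul0r !add0r subrK.
  - move=> x hx; have h := H x hx; case/andP: hx => hx1 hx2.
    have v0 : 0 <= v x by have := v_sign x00 hx1 hx2; rewrite {1}/v subrr.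
    apply: le_trans (J'_le x h) _; rewrite (ger0_norm v0) lerD2l.
    have c0 : 0 <= (pi / 2 - atan (N%:R * v x)) * dT' x.
      by rewrite mulr_ge0 // ltW // coatan_gt0.
    rewrite Mx (_ : `|gam x| * dT' x * _ = `|gam x| * (3 * pair_cst nu sg ^+ 2 * probe_mass
       * ((pi / 2 - atan (N%:R * v x)) * dT' x))); last by ring.
    rewrite (_ : far_cst * _ = rho / nu * (3 * pair_cst nu sg ^+ 2 * probe_mass
       * ((pi / 2 - atan (N%:R * v x)) * dT' x))); last by rewrite /far_cst; ring.
    apply: ler_wpM2r; last exact: contrast_le.
    by rewrite mulr_ge0 // mulr_ge0 // ltW.
  - rewrite Lx0 /(Ct x0) (_ : v x0 = 0); last by rewrite /v subrr.
    rewrite mul0r !addr0 !mulr0 addr0 subr0.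
    apply: le_trans (near_tail 1 o1).
    rewrite mulrDl [far_cst * (_ + _)]mulrDr [far_cst * Ct 1 + _]addrC addrA lerD2l.
    by apply: ler_wpM2l => //; exact: Ct_le.
have left : normc (J x0 - J 0) <= tail_cst / N%:R * (1 + ln N%:R)
     + volterra_cst * B / volterra_rate * expR (volterra_rate * x0).
  have H x : 0 <= x <= x0 -> 0 <= x <= 1.
    by case/andP=> -> h1; rewrite (le_trans h1 x01).
  apply: le_trans (@cder_mean_value R J J'
    (fun x => - near_cst * Lg x + volterra_cst * B / volterra_rate * expR (volterra_rate * x))
    (fun x => - near_cst * (N%:R * v x / (1 + (N%:R * v x) ^+ 2) * dT' x)
       + volterra_cst * (B * expR (volterra_rate * x))) 0 x0 _ _ _ x00) _.
  - by move=> x /H; exact: dJ.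
  - move=> x /H h; apply: rder_eq.
      apply: rderD; (apply: rderM; first exact: rder_cst); first exact: dLg.
      by apply: (@rder_comp R expR); [exact: is_derive_expR | exact: rder_linear].
    by move: (expR _) => e; rewrite !mul0r !add0r; congr (_ + _); field; rewrite gt_eqF.
  - move=> x hx; have h := H x hx; case/andP: hx => hx1 hx2.
    have v0 : v x <= 0 by have := v_sign hx1 hx2 x01; rewrite {2}/v subrr.
    apply: le_trans (J'_le x h) _; rewrite (ler0_norm v0); apply: lerD.
      by rewrite le_eqVlt (_ : _ == _) //; apply/eqP; ring.
    rewrite (_ : volterra_cst * _ = B * expR (volterra_rate * x) * (2 * rho ^+ 2)
       * (3 * pair_cst nu sg ^+ 2 * (probe_mass * pi))); last first.
      by rewrite /volterra_cst; move: (expR _) => e; ring.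
    apply: ler_pM.
    + exact: mulr_ge0.
    + by apply: mulr_ge0; exact: ltW.
    + by apply: ler_pM => //; [exact: gamB | exact: dT'_le].
    + rewrite ler_wpM2l ?(ltW pair0) // Mx ler_wpM2l ?(ltW mass0) //.
      by have := atan_gtNpi2 (N%:R * v x); lra.
  - rewrite Lx0 mulr0 add0r mulr0 expR0 mulr1.
    have z1 : 0 <= (0 : R) <= 1 by rewrite lexx ler01.
    have h1 := near_tail 0 z1.
    have h2 : 0 <= volterra_cst * B / volterra_rate.
      by apply: divr_ge0; [apply: mulr_ge0 => // |]; exact: ltW.
    have h3 : 0 <= Lg 0.
      apply: divr_ge0; last by apply: mulr_ge0.
      by rewrite ln_ge0 // lerDl sqr_ge0.
    have h4 : 0 <= far_cst * Lg 0 by rewrite mulr_ge0.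
    have h5 : 0 <= far_cst / N%:R by exact: divr_ge0.
    move: h1; rewrite mulrDl; lra.
have W1 : W 1 = 0.
  by rewrite /W big1 // => p _; rewrite wronskian1 ?mulr0.
have W0 : normc (W 0) <= 8 / probe_freq * eps * (1 + ln N%:R).
  apply: le_trans (normc_sum _ _ _) _.
  apply: (@le_trans _ _ (\sum_p normc (w p) * `|f p|^-1 * eps)).
    apply: ler_sum => p _; rewrite normcM wronskian0.
    have -> : normc (a p) = normc (w p) * `|f p|^-1.
      rewrite /a [normc (w p * _)]normcM [normc (- ii * _)]normcM normcN normc_ii mul1r.
      by rewrite [normc _%:C]normc_real normfV.
    by apply: ler_wpM2l; [rewrite mulr_ge0 ?normc_ge0 ?invr_ge0 | have [] := HF p].
  rewrite -mulr_suml -mulrAC; apply: ler_wpM2r => //.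
  exact: fejer_l1.
have mass : nu ^+ 2 / 8 <= normc (trig a f (T 1) - trig a f (T 0)).
  apply: le_trans (Re_le_normc _); apply: le_trans (ler_norm _).
  rewrite ReD ReN.
  pose h t := Re (trig a f t).
  have dh t : rder h t (Re (trig w f t)) by have [] := dH t.
  have o1 : 0 <= (1 : R) <= 1 by rewrite lexx ler01.
  have /andP[T1a T1b] := T_range o1; have := T_range x0_01; rewrite -/t0 => /andP[t0a t0b].
  have mono b c : 0 <= b -> b <= c -> c <= T 1 -> h b <= h c.
    move=> b0 bc cT; apply: (rder_nondecreasing (fun t _ => dh t)) => // t /andP[h1 h2].
    apply: fejer_Re_ge0 => //; apply: kap_small.
    by rewrite (le_trans b0 h1) (le_trans h2) // (le_trans cT).
  (* A window of this width next to t0 already carries the mass; it fits on at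
     least one side of t0 because the total travel time is at least 2 nu^2. *)
  pose d := nu ^+ 2 / N%:R.
  have d0 : 0 < d by rewrite divr_gt0.
  have dN : N%:R * d = nu ^+ 2 by rewrite /d mulrC divfK ?gt_eqF.
  have nu2_le1 : nu ^+ 2 <= 1 by rewrite exprn_ile1 // ltW.
  have step b : `|b - t0| <= d -> `|b + d - t0| <= d -> nu ^+ 2 / 8 <= h (b + d) - h b.
    move=> h1 h2.
    suff : h b - N%:R / 8 * b <= h (b + d) - N%:R / 8 * (b + d).
      by have := dN; lra.
    apply: (@rder_nondecreasing R (fun t => h t - N%:R / 8 * t)
       (fun t => Re (trig w f t) - N%:R / 8)); last by rewrite lerDl ltW.
      by move=> t _; apply: rderB; [exact: dh | exact: rder_linear].
    move=> t /andP[h3 h4]; rewrite subr_ge0; apply: fejer_Re_ge => //.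
    apply: (@le_trans _ _ (N%:R * d)); last by rewrite dN.
    apply: ler_wpM2l; first exact: ltW.
    by move: h1 h2; rewrite !ler_norml => /andP[? ?] /andP[? ?]; apply/andP; split; lra.
  have d_le : d <= nu ^+ 2 by rewrite /d ler_pdivrMr // ler_peMr // ltW.
  have T2 : 2 * nu ^+ 2 <= T 1.
    by have /andP[] := T_ge (lexx 0) ler01 (lexx 1); rewrite T0 !subr0 mulr1.
  have t0T : t0 <= T 1 by have := v_sign x00 x01 (lexx 1); rewrite /v -/t0; lra.
  rewrite T0 -/(h (T 1)) -/(h 0).
  have [hd|hd] := leP (t0 + d) (T 1).
    have := step t0; rewrite subrr normr0 addrAC subrr add0r gtr0_norm //.
    move=> /(_ (ltW d0) (lexx _)).
    have := mono 0 t0 (lexx _) t0a t0T; have := mono (t0 + d) (T 1) _ hd (lexx _).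
    by move=> /(_ ltac:(lra)); lra.
  have := step (t0 - d); rewrite subrK subrr normr0 addrAC subrr add0r normrN gtr0_norm //.
  move=> /(_ (lexx _) (ltW d0)).
  have := mono 0 (t0 - d) (lexx _) _ _; have := mono t0 (T 1) t0a t0T (lexx _).
  by move=> h1 /(_ ltac:(lra) ltac:(lra)); lra.
have J10 : J 1 - J 0 = - W 0 - (gam x0)%:C * (trig a f (T 1) - trig a f (T 0)).
  by rewrite /J W1; ring.
have JJ : normc (J 1 - J 0) <= 2 * tail_cst / N%:R * (1 + ln N%:R)
     + volterra_cst * B / volterra_rate * expR (volterra_rate * x0).
  rewrite (_ : J 1 - J 0 = (J 1 - J x0) + (J x0 - J 0)); last by ring.
  by apply: le_trans (normcD _ _) _; apply: le_trans (lerD right left) _; lra.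
have : `|gam x0| * normc (trig a f (T 1) - trig a f (T 0)) <=
    normc (J 1 - J 0) + normc (W 0).
  rewrite -normc_real -normcM.
  rewrite (_ : _ * _ = - (J 1 - J 0) - W 0); last by rewrite J10; ring.
  by apply: le_trans (normcB _ _) _; rewrite normcN.
have : `|gam x0| * (nu ^+ 2 / 8) <=
    `|gam x0| * normc (trig a f (T 1) - trig a f (T 0)) by exact: ler_wpM2l.
rewrite mulrDl; lra.
Qed.

End AtPoint.

Definition stability_cst : R :=
  2 * (8 / nu ^+ 2 * (8 / probe_freq + 2 * tail_cst)) * expR volterra_rate.

(** The rate of the exponential weight is chosen so that the Volterra term of
    the local estimate takes at most half of the bound, and self-improvement
    removes it. *)
Lemma contrast_stability x : 0 <= x <= 1 ->
  `|gam x| <= stability_cst * ((eps + N%:R^-1) * (1 + ln N%:R)).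
Proof.
move=> hx.
have lN : 0 <= ln N%:R :> R by rewrite ln_ge0.
have tail0 : 0 <= tail_cst.
  rewrite /tail_cst addr_ge0 // mulr_ge0 ?addr_ge0 // ln_ge0 // lerDl; exact: sqr_ge0.
pose X := (8 / probe_freq + 2 * tail_cst) * ((eps + N%:R^-1) * (1 + ln N%:R)).
have k0 : 0 <= 8 / probe_freq by rewrite ltW // divr_gt0.
have iN0 : 0 <= N%:R^-1 :> R by rewrite invr_ge0 ltW.
have X0 : 0 <= X.
  apply: mulr_ge0; first by apply: addr_ge0 => //; exact: mulr_ge0.
  by apply: mulr_ge0; exact: addr_ge0.
have n8 : 0 < 8 / nu ^+ 2 by rewrite divr_gt0.
have main := @self_improving R R (fun y => 0 <= y <= 1)
  (fun y => `|gam y| / expR (volterra_rate * y)) (rho / nu) (8 / nu ^+ 2 * X).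
have : `|gam x| / expR (volterra_rate * x) <= 2 * (8 / nu ^+ 2 * X).
  apply: main => //.
  - by rewrite mulr_ge0 // ltW.
  - move=> y hy; rewrite ler_pdivrMr ?expR_gt0 //; apply: le_trans (contrast_le hy) _.
    apply: le_mul_expR; first by rewrite ltW // divr_gt0.
    by rewrite mulr_ge0 ?(ltW rate0) //; case/andP: hy.
  - move=> B B0 hB y hy.
    have hB' z : 0 <= z <= 1 -> `|gam z| <= B * expR (volterra_rate * z).
      by move=> hz; have := hB z hz; rewrite ler_pdivrMr ?expR_gt0.
    have := local_estimate hy B0 hB'; rewrite ler_pdivrMr ?expR_gt0 //.
    have e1 : 1 <= expR (volterra_rate * y).
      rewrite -[leRHS]mul1r; apply: le_mul_expR => //.
      by rewrite mulr_ge0 ?(ltW rate0) //; case/andP: hy.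
    move: (expR _) e1 => e e1 h.
    have hX : (8 / probe_freq * eps + 2 * tail_cst / N%:R) * (1 + ln N%:R) <= X.
      rewrite /X mulrA; apply: ler_wpM2r; first by rewrite addr_ge0.
      have h1 : 0 <= 8 / probe_freq * N%:R^-1 by rewrite mulr_ge0.
      have h2 : 0 <= 2 * tail_cst * eps by rewrite !mulr_ge0.
      by lra.
    have hr : volterra_cst / volterra_rate <= nu ^+ 2 / 16.
      rewrite ler_pdivrMr // /volterra_rate mulrDr mulr1.
      have -> : nu ^+ 2 / 16 * (16 * volterra_cst / nu ^+ 2) = volterra_cst.
        by field; rewrite gt_eqF.
      by rewrite lerDl divr_ge0 // ltW.
    have h3 : `|gam y| * (nu ^+ 2 / 8) <= X + nu ^+ 2 / 16 * (B * e).
      apply: le_trans h _; apply: lerD => //.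
      rewrite (_ : _ * e = volterra_cst / volterra_rate * (B * e)); last by ring.
      by apply: ler_wpM2r => //; rewrite mulr_ge0 // (le_trans ler01).
    have h4 : `|gam y| <= 8 / nu ^+ 2 * X + B / 2 * e.
      rewrite (_ : `|gam y| = 8 / nu ^+ 2 * (`|gam y| * (nu ^+ 2 / 8))); last first.
        by field; rewrite gt_eqF.
      apply: le_trans (ler_wpM2l (ltW n8) h3) _; rewrite mulrDr lerD2l.
      by rewrite le_eqVlt (_ : _ == _) //; apply/eqP; field; rewrite gt_eqF.
    apply: le_trans h4 _; rewrite [leRHS]mulrDl lerD2r.
    by rewrite ler_peMr // mulr_ge0 // ltW.
rewrite ler_pdivrMr ?expR_gt0 // => h; apply: le_trans h _.
rewrite (_ : stability_cst * _ = 2 * (8 / nu ^+ 2 * X) * expR volterra_rate); last first.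
  by rewrite /stability_cst /X; move: (expR _) (ln _) => e l; ring.
apply: ler_wpM2l.
  by apply: mulr_ge0 => //; apply: mulr_ge0 => //; exact: ltW.
by rewrite ler_expR ler_piMr ?(ltW rate0) //; case/andP: hx.
Qed.
End LocalEstimate.
End TwoMedia.

(** * Polynomial extrapolation from Chebyshev nodes *)
Section Extrapolation.
Variable R : realType.
Implicit Types (x z t : R).

Fixpoint chebyshev (n : nat) : {poly R} :=
  match n with
  | 0 => 1
  | m.+1 => match m with
            | 0 => 'X
            | p.+1 => 2%:P * 'X * chebyshev m - chebyshev p
            end
  end.

Lemma chebyshevSS n : chebyshev n.+2 = 2%:P * 'X * chebyshev n.+1 - chebyshev n.
Proof. by []. Qed.

Lemma size_chebyshev n : (size (chebyshev n) <= n.+1)%N.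
Proof.
suff : (size (chebyshev n) <= n.+1)%N && (size (chebyshev n.+1) <= n.+2)%N by case/andP.
elim: n => [|n /andP[h1 h2]]; first by rewrite size_poly1 size_polyX.
rewrite h2 chebyshevSS /=; apply: leq_trans (size_polyD _ _) _.
rewrite geq_max size_polyN (leq_trans h1) ?andbT //; last by lia.
apply: leq_trans (size_polyMleq _ _) _.
have : (size ((2%:P * 'X)%R : {poly R}) <= 2)%N.
  by rewrite mul_polyC; apply: leq_trans (size_scale_leq _ _) _; rewrite size_polyX.
move=> /leq_add/(_ h2) h; rewrite -[n.+3]/((2 + n.+2).-1) -!subn1.
exact: leq_sub2r.
Qed.

Lemma chebyshev_cos n x : (chebyshev n).[cos x] = cos (x * n%:R).
Proof.
suff : (chebyshev n).[cos x] = cos (x * n%:R) /\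
       (chebyshev n.+1).[cos x] = cos (x * n.+1%:R) by case.
elim: n => [|n [h1 h2]]; first by rewrite /= hornerC hornerX mulr0 cos0 mulr1.
split=> //; rewrite chebyshevSS hornerD hornerN !hornerM hornerC hornerX h1 h2.
have -> : x * n%:R = x * n.+1%:R - x by rewrite -natr1; ring.
have -> : x * n.+2%:R = x * n.+1%:R + x by rewrite -(natr1 n.+1); ring.
by rewrite cosB cosD; ring.
Qed.

Lemma chebyshev_exp n z e f : e * f = 1 -> e + f = 2 * z ->
  2 * (chebyshev n).[z] = e ^+ n + f ^+ n.
Proof.
move=> ef ez.
suff : 2 * (chebyshev n).[z] = e ^+ n + f ^+ n /\
       2 * (chebyshev n.+1).[z] = e ^+ n.+1 + f ^+ n.+1 by case.
elim: n => [|n [h1 h2]]; first by rewrite /= hornerC hornerX !expr0 !expr1 ez mulr1.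
split=> //; rewrite chebyshevSS hornerD hornerN !hornerM hornerC hornerX mulrBr h1.
have -> : 2 * (2 * z * (chebyshev n.+1).[z]) = 2 * z * (2 * (chebyshev n.+1).[z]) by ring.
rewrite h2 -ez !exprS.
rewrite (_ : _ - _ = e * (e * e ^+ n) + f * (f * f ^+ n)
   + (e * f - 1) * (e ^+ n + f ^+ n)); last by ring.
by rewrite ef subrr mul0r addr0.
Qed.

Section Nodes.
Variable N : nat.

(** The extremal points of the Chebyshev polynomial of degree N; the values
    beyond the index N serve to make the sequence injective. *)
Let node (j : nat) : R := if (j <= N)%N then cos (pi * j%:R / N%:R) else j.+1%:R.

Let angle_range (j : nat) : (j <= N)%N -> pi * j%:R / N%:R \in `[0, pi :> R].
Proof.
move=> jN; rewrite in_itv /= !mulr_ge0 ?invr_ge0 ?pi_ge0 //=.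
case: N jN => [|n] jn; first by rewrite invr0 mulr0 pi_ge0.
by rewrite ler_pdivrMr // ler_wpM2l ?pi_ge0 // ler_nat.
Qed.

Let node_lt (i j : nat) : (i < j)%N -> (j <= N)%N -> node j < node i.
Proof.
move=> ij jN; have iN : (i <= N)%N by apply: leq_trans jN; exact: ltnW.
rewrite /node jN iN ltr_cos ?angle_range //.
have N0 : (0 : R) < N%:R by rewrite ltr0n; lia.
by rewrite ltr_pM2r ?invr_gt0 // ltr_pM2l ?pi_gt0 // ltr_nat.
Qed.

Let node_le1 (j : nat) : (j <= N)%N -> -1 <= node j <= 1.
Proof. by move=> jN; rewrite /node jN cos_le1 cos_geN1. Qed.

Let node_inj : injective node.
Proof.
have H i j : (i < j)%N -> node i != node j.
  move=> ij; have [jN|jN] := leqP j N; first by rewrite gt_eqF // node_lt.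
  rewrite lt_eqF // [node j]/node leqNgt jN /=.
  have [iN|iN] := leqP i N.
    have /andP[_ h] := node_le1 iN; apply: le_lt_trans h _.
    by rewrite ltr1n; lia.
  by rewrite /node leqNgt iN /= ltr_nat.
move=> i j e; case: (ltngtP i j) => // h.
  by move: (H _ _ h); rewrite e eqxx.
by move: (H _ _ h); rewrite e eqxx.
Qed.

(** The Chebyshev polynomial alternates between 1 and -1 at these nodes in step
    with the signs of the Lagrange basis at z >= 1; hence the sum of the
    absolute values of the basis is the value of that polynomial at z, the half
    sum of the N-th powers of e = z + sqrt (z^2 - 1) and of its inverse f. *)
Lemma chebyshev_extrapolation z e f : 1 <= z -> e * f = 1 -> e + f = 2 * z -> 0 < f <= e ->
  exists (x l : 'I_N.+1 -> R), [/\ forall j, -1 <= x j <= 1,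
    forall p : {poly R}, (size p <= N.+1)%N -> p.[z] = \sum_j p.[x j] * l j
    & \sum_j `|l j| <= e ^+ N].
Proof.
move=> z1 ef ez /andP[f0 fe].
pose l (j : 'I_N.+1) := (tnth (N.+1.-lagrange node) j).[z].
have interp (p : {poly R}) : (size p <= N.+1)%N ->
    p.[z] = \sum_(j < N.+1) p.[node j] * l j.
  move=> sp; rewrite {1}(lagrange_gen (ltn0Sn N) node_inj sp) horner_sum.
  by apply: eq_bigr => j _; rewrite hornerM hornerC.
exists (fun j => node j), l; split => //.
  by move=> j; apply: node_le1; rewrite -ltnS.
have sgn (j : 'I_N.+1) : `|l j| = (chebyshev N).[node j] * l j.
  have jN : (j <= N)%N by rewrite -ltnS.
  have -> : (chebyshev N).[node j] = (-1) ^+ j.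
    rewrite /node jN chebyshev_cos.
    case: (N) j jN => [|n] j jN.
      by move: jN; rewrite leqn0 => /eqP ->; rewrite !mulr0 cos0.
    rewrite divfK ?pnatr_eq0 //; elim: (nat_of_ord j) => [|i ih].
      by rewrite mulr0 cos0.
    by rewrite -natr1 mulrDr mulr1 cosDpi ih exprS mulN1r.
  rewrite /l (lagrangeE (ltn0Sn N) node_inj) /=.
  rewrite hornerM hornerC !horner_prod.
  set P := \prod_(i < N.+1 | i != j) ('X - (node i)%:P).[z].
  have P0 : 0 <= P.
    apply: prodr_ge0 => i _; rewrite hornerXsubC subr_ge0.
    have iN : (i <= N)%N by rewrite -ltnS.
    by have /andP[_ h] := node_le1 iN; apply: le_trans h z1.
  have -> : \prod_(i < N.+1 | i != j) ('X - (node i)%:P).[node j] =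
     (-1) ^+ j * \prod_(i < N.+1 | i != j) `|node j - node i|.
    rewrite (_ : (-1) ^+ j = \prod_(i < N.+1 | i != j) (-1 : R) ^+ (i < j)%N); last first.
      rewrite -expr_sum; congr (_ ^+ _).
      rewrite -big_mkcondr /= (eq_bigl (fun i : 'I_N.+1 => (i < j)%N)); last first.
        by move=> i /=; rewrite andbC; case: ltngtP => //= h; apply/eqP => e'; rewrite e' ltnn in h.
      by rewrite (big_ord_narrow (ltnW (ltn_ord j))) /= sum1_card card_ord.
    rewrite -big_split; apply: eq_bigr => i ij /=; rewrite hornerXsubC.
    have iN : (i <= N)%N by rewrite -ltnS.
    case: (ltngtP i j) => h.
    - by rewrite expr1 mulN1r ltr0_norm ?opprK // subr_lt0 node_lt.
    - by rewrite expr0 mul1r gtr0_norm // subr_gt0 node_lt.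
    - by move/eqP: ij; case; apply: val_inj.
  rewrite invfM normrM normrM normfV normrX normrN1 expr1n invr1 mul1r (ger0_norm P0).
  rewrite ger0_norm ?invr_ge0 ?prodr_ge0 // !mulrA.
  by rewrite divff ?mul1r // signr_eq0.
rewrite (eq_bigr _ (fun j _ => sgn j)) -interp ?size_chebyshev //.
have h := chebyshev_exp N ef ez.
have : f ^+ N <= e ^+ N by apply: lerXn2r => //; rewrite nnegrE ltW // (lt_le_trans f0).
lra.
Qed.

End Nodes.
End Extrapolation.

(** * Extrapolation of exponentials *)
Section Propagation.
Variable R : realType.
Implicit Types (x z t : R).

Let taylor (n : nat) t : R[i] := \sum_(l < n) ii ^+ l * (t ^+ l / l`!%:R)%:C.

Let cder_taylor n t : cder (taylor n.+1) t (ii * taylor n t).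
Proof.
rewrite (_ : taylor n.+1 = fun t => 1 + \sum_(l < n) ii ^+ l.+1 * (t ^+ l.+1 / l.+1`!%:R)%:C); last first.
  by apply/funext => u; rewrite /taylor big_ord_recl expr0 fact0 divr1 mul1r.
apply: cder_eq.
  apply: cderD.
    by apply: cder_cst.
  apply: cder_sum => l; apply: cderM; first exact: cder_cst.
  apply: cder_real; apply: rderM; last exact: rder_cst.
  by apply: rderX; exact: rder_id.
rewrite add0r /taylor mulr_sumr; apply: eq_bigr => l _ /=.
rewrite mul0r add0r mulr0 addr0 mulr1 exprS -mulrA; congr (_ * (_ * _%:C)).
by rewrite factS natrM; field; rewrite nat1r !pnatr_eq0 -lt0n fact_gt0.
Qed.

Lemma expi_taylor n t : 0 <= t -> normc (expi t - taylor n t) <= t ^+ n / n`!%:R.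
Proof.
elim: n t => [|n ih] t t0.
  by rewrite /taylor big_ord0 subr0 normc_expi expr0 fact0 divr1.
have := @cder_mean_value R (fun u => expi u - taylor n.+1 u)
  (fun u => ii * (expi u - taylor n u)) (fun u => u ^+ n.+1 / n.+1`!%:R)
  (fun u => u ^+ n / n`!%:R) 0 t.
have -> : expi 0 - taylor n.+1 0 = 0.
  rewrite /taylor big_ord_recl /= expi0 expr0 fact0 divr1 mul1r big1 ?addr0 ?subrr //.
  by move=> l _; rewrite /= expr0n /= mul0r mulr0.
rewrite !subr0 expr0n /= mul0r subr0; apply => //.
- move=> u _; rewrite mulrBr; apply: cderB; last exact: cder_taylor.
  apply: cder_eq; first by apply: cder_expi; exact: rder_id.
  by rewrite mulr1.
- move=> u _; apply: rder_eq.
    by apply: rderM; [apply: rderX; exact: rder_id | exact: rder_cst].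
  by rewrite mulr0 addr0 mulr1 factS natrM; field; rewrite nat1r !pnatr_eq0 -lt0n fact_gt0.
- by move=> u /andP[u0 _]; rewrite normcM normc_ii mul1r; exact: ih.
Qed.

Lemma expi_lipschitz a b : normc (expi a - expi b) <= `|a - b| :> R.
Proof.
wlog ba : a b / b <= a.
  move=> H; case: (leP b a) => [/H//|/ltW/H]; rewrite distrC.
  by rewrite -[X in normc X <= _]opprB normcN.
have := @cder_mean_value R (@expi R) (fun u => ii * 1%:C * expi u) (fun u => u) (fun=> 1) b a.
rewrite ger0_norm ?subr_ge0 //; apply => // u _.
- by apply: cder_expi; exact: rder_id.
- exact: rder_id.
- by rewrite normcM normcM normc_ii normc_expi Normc.normc1 !mulr1.
Qed.

Section Extrapolate.
Variables (N : nat) (z e f c h : R).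
Hypotheses (z1 : 1 <= z) (ef : e * f = 1) (ez : e + f = 2 * z) (fe : 0 < f <= e).
Hypothesis h0 : 0 <= h.
Variables x l : 'I_N.+1 -> R.
Hypothesis x1 : forall j, -1 <= x j <= 1.
Hypothesis interp : forall p : {poly R}, (size p <= N.+1)%N -> p.[z] = \sum_j p.[x j] * l j.
Hypothesis l_le : \sum_j `|l j| <= e ^+ N.

Let e1 : 1 <= e. Proof. by case/andP: fe => f0 h1; have := ez; have := z1; lra. Qed.

(** Interpolation is exact on polynomials, so only the Taylor remainder of the
    exponential survives, and its factorial beats the growth of the basis. *)
Lemma expi_extrapolation t : 0 <= t ->
  normc (expi ((c + h * (1 + z)) * t) - \sum_j (l j)%:C * expi ((c + h * (1 + x j)) * t))
  <= 2 * e ^+ N * ((2 * h * z * t) ^+ N.+1 / N.+1`!%:R).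
Proof.
move=> t0.
pose th (y : R) := h * (1 + y) * t.
have th0 (y : R) : -1 <= y -> 0 <= th y.
  by move=> y1; rewrite /th !mulr_ge0 //; lra.
have th_le (y : R) : -1 <= y -> y <= z -> th y <= 2 * h * z * t.
  move=> y1 yz; rewrite /th; apply: ler_wpM2r => //.
  have : h * (1 + y) <= h * (2 * z) by apply: ler_wpM2l => //; have := z1; lra.
  lra.
have rem (y : R) : -1 <= y -> y <= z -> normc (expi (th y) - taylor N.+1 (th y))
    <= (2 * h * z * t) ^+ N.+1 / N.+1`!%:R.
  move=> y1 yz; apply: le_trans (expi_taylor _ (th0 _ y1)) _.
  apply: ler_wpM2r; first by rewrite invr_ge0 ler0n.
  apply: lerXn2r; rewrite ?nnegrE ?th0 ?th_le //.
  by apply: le_trans (th0 _ y1) (th_le _ y1 yz).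
set r := _ / _ in rem *.
have r0 : 0 <= r by apply: le_trans (normc_ge0 _) (rem z _ _) => //; have := z1; lra.
have exact_taylor : taylor N.+1 (th z) = \sum_j (l j)%:C * taylor N.+1 (th (x j)).
  under [RHS]eq_bigr do rewrite /taylor mulr_sumr.
  rewrite exchange_big /=; apply: eq_bigr => m _.
  under [RHS]eq_bigr do rewrite mulrCA.
  rewrite -mulr_sumr; congr (_ * _).
  under [RHS]eq_bigr do rewrite -rmorphM.
  rewrite -rmorph_sum; congr (_%:C).
  have := @interp (('X + 1%:P) ^+ m).
  have sz : (size (('X + 1%:P : {poly R}) ^+ m) <= N.+1)%N.
    apply: leq_trans (size_poly_exp_leq _ _) _; rewrite size_XaddC /= mul1n; exact: ltn_ord.
  move=> /(_ sz); rewrite horner_exp hornerD hornerX hornerC => E.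
  rewrite /th (_ : h * (1 + z) * t = (z + 1) * (h * t)); last by ring.
  rewrite exprMn E mulr_suml mulr_suml; apply: eq_bigr => j _.
  rewrite horner_exp hornerD hornerX hornerC.
  rewrite (_ : h * (1 + x j) * t = (x j + 1) * (h * t)) ?exprMn; last by ring.
  by ring.
rewrite (_ : expi _ - _ = expi (c * t) * ((expi (th z) - taylor N.+1 (th z))
   - \sum_j (l j)%:C * (expi (th (x j)) - taylor N.+1 (th (x j))))); last first.
  rewrite (_ : \sum_j _ * (_ - _) = \sum_j (l j)%:C * expi (th (x j))
     - \sum_j (l j)%:C * taylor N.+1 (th (x j))); last first.
    by rewrite -sumrB; apply: eq_bigr => j _; ring.
  rewrite exact_taylor [RHS](_ : _ = expi (c * t) * expi (th z)
     - expi (c * t) * \sum_j (l j)%:C * expi (th (x j))); last by ring.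
  rewrite mulr_sumr -expiD; congr (expi _ - _); first by rewrite /th; ring.
  apply: eq_bigr => j _; rewrite mulrCA -expiD; congr (_ * expi _).
  by rewrite /th; ring.
rewrite normcM normc_expi mul1r; apply: le_trans (normcB _ _) _.
have a1 : normc (expi (th z) - taylor N.+1 (th z)) <= r.
  by apply: rem => //; have := z1; lra.
have a2 : normc (\sum_j (l j)%:C * (expi (th (x j)) - taylor N.+1 (th (x j)))) <= e ^+ N * r.
  apply: le_trans (normc_sum _ _ _) _.
  apply: le_trans (ler_wpM2r r0 l_le); rewrite mulr_suml; apply: ler_sum => j _.
  rewrite normcM normc_real; apply: ler_wpM2l => //.
  by have /andP[b1 b2] := x1 j; apply: rem => //; apply: le_trans b2 z1.
have a3 : r <= e ^+ N * r by rewrite ler_peMl // exprn_ege1.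
lra.
Qed.

End Extrapolate.
End Propagation.

(** * Extrapolation of the measurements in the frequency *)
Section DefectPropagation.
Variable R : realType.
Implicit Types (x z t k : R).
Variables (nu rho sg : R) (r s tau r' s' tau' : R -> R).
Hypotheses (med : medium nu rho sg r s tau) (med' : medium nu rho sg r' s' tau').

Local Notation C := (pair_cst nu sg).
Local Notation Tm := (4 * rho ^+ 2).

Let C1 : 1 <= C. Proof. exact: pair_cst_ge1 med. Qed.

(** The transport estimates with a constant majorant: a linear combination of
    defects is as small as the same combination of exponentials on the range of
    travel times. In this sense the defect is an analytic function of the
    frequency of bounded exponential type. *)
Lemma defect_sum (J : finType) (c : J -> R[i]) (k : J -> R)
    (al be al' be' : J -> R -> R[i]) (B : R) :
  (forall j, mode r s (k j) (al j) (be j)) ->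
  (forall j, mode r' s' (k j) (al' j) (be' j)) ->
  0 < B -> (forall t, 0 <= t <= Tm -> normc (trig c k t) <= B) ->
  normc (\sum_j c j * mode_defect (al j) (be j) (al' j) (be' j) 0) <= 8 * C ^+ 2 * B.
Proof.
move=> modes modes' B0 chi_le.
have o : 0 <= (0 : R) <= 1 by rewrite lexx ler01.
have n1 : normc (1 : R[i]) <= 1 by rewrite Normc.normc1.
have n0 : normc (0 : R[i]) <= 1 by rewrite Normc.normc0.
have t1 := tau1_le med; have t1' := tau1_le med'.
have rho2 : 0 <= rho ^+ 2 by exact: sqr_ge0.
have T1 : 0 + 2 * (tau 1 - tau 0) <= Tm by rewrite (medium_tau0 med); lra.
have T1' : 0 + 2 * (tau' 1 - tau' 0) <= Tm by rewrite (medium_tau0 med'); lra.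
have T2 : 0 + 2 * (tau 1 - tau 0) + 2 * (tau' 1 - tau' 0) <= Tm.
  by rewrite (medium_tau0 med) (medium_tau0 med'); lra.
have dM (t : R) : 0 <= t <= Tm -> rder (fun=> B) t (- (fun=> 0) t).
  by move=> _; rewrite oppr0; exact: rder_cst.
have M1_ge0 (t : R) : 0 <= t <= Tm -> 0 <= (fun=> 0 : R) t by [].
have M_gt0 (t : R) : 0 < (fun=> B) t by [].
have chi t : 0 <= t <= Tm -> normc (trig c k t) <= (fun=> 0) t + (fun=> B) t.
  by rewrite add0r; exact: chi_le.
have a1 := transport_lin med' modes' dM M1_ge0 M_gt0 chi n0 n1 o (lexx 0) T1'.
have a2 := transport_lin med modes dM M1_ge0 M_gt0 chi n0 n1 o (lexx 0) T1.
have a3 := transport_pair med med' modes modes' dM M1_ge0 M_gt0 chi n1 n0 n0 n1 o (lexx 0) T2.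
have a4 := transport_pair med med' modes modes' dM M1_ge0 M_gt0 chi n0 n1 n1 n0 o (lexx 0) T2.
move: a1 a2 a3 a4.
set S1 := \sum_j _; set S2 := \sum_j _; set S3 := \sum_j _; set S4 := \sum_j _.
move=> a1 a2 a3 a4; clear M_gt0 dM M1_ge0 chi.
rewrite (_ : \sum_j _ = (S1 - S2 + (S3 - S4)) + (S1 - S2 + (S3 - S4))); last first.
  rewrite /S1 /S2 /S3 /S4 -!sumrB -!big_split; apply: eq_bigr => j _ /=.
  by rewrite /mode_defect mulr0 expi0; ring.
have a5 : normc (S1 - S2 + (S3 - S4)) <= C * B + C * B + (C ^+ 2 * B + C ^+ 2 * B).
  apply: le_trans (normcD _ _) _; apply: lerD; apply: le_trans (normcB _ _) _; exact: lerD.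
apply: le_trans (normcD _ _) _.
have : C * B <= C ^+ 2 * B.
  by apply: ler_wpM2r; [exact: ltW | rewrite expr2 ler_peMl // (le_trans ler01 C1)].
lra.
Qed.

(** The preceding bound for the combination that vanishes on exponentials up to
    the interpolation error: the point of evaluation with weight 1 and the nodes
    with minus their Lagrange weights. *)
Lemma defect_extrapolation (N : nat) z e f c h eta (al be al' be' : R -> R[i]) :
  1 <= z -> e * f = 1 -> e + f = 2 * z -> 0 < f <= e -> 0 < h -> 0 <= eta ->
  (forall k, c <= k <= c + 2 * h -> exists al be al' be',
     [/\ mode r s k al be, mode r' s' k al' be' & normc (mode_defect al be al' be' 0) <= eta]) ->
  mode r s (c + h * (1 + z)) al be -> mode r' s' (c + h * (1 + z)) al' be' ->
  normc (mode_defect al be al' be' 0) <= e ^+ N * eta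
    + 8 * C ^+ 2 * (2 * e ^+ N * ((2 * h * z * Tm) ^+ N.+1 / N.+1`!%:R)).
Proof.
move=> z1 ef ez fe h0 eta0 data mo mo'.
have [x [l [x1 interp l_le]]] := chebyshev_extrapolation N z1 ef ez fe.
have z0 : 0 < z by exact: lt_le_trans z1.
have e0 : 0 < e by case/andP: fe => f0; apply: lt_le_trans.
pose kn j := c + h * (1 + x j).
have H j : exists F : (R -> R[i]) * (R -> R[i]) * ((R -> R[i]) * (R -> R[i])),
  [/\ mode r s (kn j) F.1.1 F.1.2, mode r' s' (kn j) F.2.1 F.2.2
     & normc (mode_defect F.1.1 F.1.2 F.2.1 F.2.2 0) <= eta].
  have [|a [b [a' [b' h1]]]] := data (kn j); last by exists ((a, b), (a', b')).
  have /andP[b1 b2] := x1 j; rewrite /kn lerDl lerD2l mulr_ge0 ?(ltW h0) //=; last by lra.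
  by rewrite mulrC ler_wpM2r ?(ltW h0) //; lra.
have [F HF] := choice H.
(* Families over one point and N + 1 nodes. *)
pose q (A : Type) (a : A) (b : 'I_N.+1 -> A) (i : 'I_N.+2) :=
  if unlift ord0 i is Some j then b j else a.
have q0 (A : Type) (a : A) b : q A a b ord0 = a by rewrite /q unlift_none.
have qS (A : Type) (a : A) b j : q A a b (lift ord0 j) = b j by rewrite /q liftK.
pose B := 2 * e ^+ N * ((2 * h * z * Tm) ^+ N.+1 / N.+1`!%:R).
have rho2 : 0 < rho ^+ 2 by rewrite exprn_gt0 // (lt_le_trans ltr01 (medium_rho_ge1 med)).
have B0 : 0 < B.
  apply: mulr_gt0; first by apply: mulr_gt0 => //; exact: exprn_gt0.
  apply: divr_gt0; last by rewrite ltr0n fact_gt0.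
  by apply: exprn_gt0; do 3![apply: mulr_gt0 => //]; rewrite mulr_gt0.
have key := @defect_sum 'I_N.+2 (q _ 1 (fun j => - (l j)%:C))
  (q _ (c + h * (1 + z)) kn)
  (q _ al (fun j => (F j).1.1)) (q _ be (fun j => (F j).1.2))
  (q _ al' (fun j => (F j).2.1)) (q _ be' (fun j => (F j).2.2)) B _ _ B0 _.
have : normc (mode_defect al be al' be' 0
   - \sum_j (l j)%:C * mode_defect (F j).1.1 (F j).1.2 (F j).2.1 (F j).2.2 0) <= 8 * C ^+ 2 * B.
  rewrite (_ : _ - _ = \sum_(j < N.+2) q _ 1 (fun j => - (l j)%:C) j *
     mode_defect (q _ al (fun j => (F j).1.1) j) (q _ be (fun j => (F j).1.2) j)
      (q _ al' (fun j => (F j).2.1) j) (q _ be' (fun j => (F j).2.2) j) 0); last first.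
    rewrite [in RHS]big_ord_recl !q0 mul1r -sumrN; congr (_ + _).
    by apply: eq_bigr => j _; rewrite !qS mulNr.
  apply: key.
  - move=> j; case: (unliftP ord0 j) => [i ->|->]; rewrite ?q0 ?qS //.
    by have [] := HF i.
  - move=> j; case: (unliftP ord0 j) => [i ->|->]; rewrite ?q0 ?qS //.
    by have [] := HF i.
  - move=> t /andP[t0 tT].
    rewrite /trig big_ord_recl !q0 mul1r.
    under eq_bigr do rewrite !qS mulNr.
    rewrite sumrN.
    apply: le_trans (expi_extrapolation c z1 ez fe (ltW h0) x1 interp l_le t0) _.
    rewrite /B; apply: ler_wpM2l; first by rewrite mulr_ge0 // ltW // exprn_gt0.
    apply: ler_wpM2r; first by rewrite invr_ge0 ler0n.
    have hz : 0 <= 2 * h * z by rewrite ltW // !mulr_gt0.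
    apply: lerXn2r; rewrite ?nnegrE; [exact: mulr_ge0 | | exact: ler_wpM2l].
    by apply: mulr_ge0 => //; apply: mulr_ge0 => //; exact: ltW.
have : normc (\sum_j (l j)%:C * mode_defect (F j).1.1 (F j).1.2 (F j).2.1 (F j).2.2 0)
    <= e ^+ N * eta.
  apply: le_trans (normc_sum _ _ _) _; apply: le_trans (ler_wpM2r eta0 l_le).
  rewrite mulr_suml; apply: ler_sum => j _; rewrite normcM normc_real.
  by apply: ler_wpM2l => //; have [] := HF j.
set S := \sum_j _ => hS hD.
rewrite (_ : mode_defect al be al' be' 0 = (mode_defect al be al' be' 0 - S) + S); last by ring.
by apply: le_trans (normcD _ _) _; rewrite addrC lerD.
Qed.

End DefectPropagation.

(** * The impedance as a function of the frequency *)
Section Impedance.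
Variable R : realType.
Implicit Types (x z t k : R).

Definition amplitude_cst (sg : R) : R := 2 * expR sg.

Definition impedance_of (r s : R -> R) (d : R -> R[i]) k := exists al be,
  mode r s k al be /\ d k = (al 0 - be 0) / (al 0 + be 0).

Section One.
Variables (nu rho sg : R) (r s tau : R -> R).
Hypothesis med : medium nu rho sg r s tau.
Local Notation b := (amplitude_cst sg).
Local Notation Tm := (4 * rho ^+ 2).

Let o01 : 0 <= (0 : R) <= 1. Proof. by rewrite lexx ler01. Qed.

Lemma amplitude_cst_ge1 : 1 <= b.
Proof.
have h : 0 <= sg by exact: medium_sg_ge0 med.
rewrite /amplitude_cst; have := expR_ge1Dx sg; lra.
Qed.

Lemma mode_amplitude k al be : mode r s k al be ->
  [/\ b^-1 <= normc (al 0 + be 0), normc (al 0 + be 0) <= b & normc (al 0 - be 0) <= b].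
Proof.
move=> m; have [h1 h2] := mode_bound med m o01; have h3 := mode_flux m o01.
have h4 : normc (al 0) - normc (be 0) <= normc (al 0 + be 0).
  have := normcB (al 0 + be 0) (be 0); rewrite addrK; lra.
have a0 := normc_ge0 (al 0); have b0 := normc_ge0 (be 0).
have B0 : 0 < b by apply: lt_le_trans ltr01 amplitude_cst_ge1.
have s_le : normc (al 0) + normc (be 0) <= b by rewrite /amplitude_cst; lra.
split.
- rewrite -div1r ler_pdivrMr //; apply: le_trans (ler_wpM2r (ltW B0) h4).
  have ba : normc (be 0) <= normc (al 0).
    by rewrite -ler_sqr ?nnegrE //; move: h3; lra.
  rewrite -h3 subr_sqr; apply: ler_wpM2l => //; lra.
- exact: le_trans (normcD _ _) s_le.
- exact: le_trans (normcB _ _) s_le.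
Qed.

Lemma mode_denominator_neq0 k al be : mode r s k al be -> al 0 + be 0 != 0.
Proof.
case/mode_amplitude => h _ _; apply/eqP => e; move: h; rewrite e Normc.normc0.
by rewrite invr_le0 leNgt (lt_le_trans ltr01 amplitude_cst_ge1).
Qed.

(** The transport estimate for two frequencies with the weights 1 and -1. *)
Lemma mode_lipschitz k k' al be al' be' (q : R[i]) : k != k' -> normc q <= 1 ->
  mode r s k al be -> mode r s k' al' be' ->
  normc ((al 0 + q * be 0) - (al' 0 + q * be' 0)) <= pair_cst nu sg * (Tm * `|k - k'|).
Proof.
move=> kk q1 m m'.
pose B := Tm * `|k - k'|.
have rho1 := medium_rho_ge1 med.
have rho2 : 0 < rho ^+ 2 by rewrite exprn_gt0 // (lt_le_trans ltr01).
have B0 : 0 < B by apply: mulr_gt0; [exact: mulr_gt0 | rewrite normr_gt0 subr_eq0].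
have t1 := tau1_le med.
have T1 : 0 + 2 * (tau 1 - tau 0) <= Tm by rewrite (medium_tau0 med); lra.
have n1 : normc (1 : R[i]) <= 1 by rewrite Normc.normc1.
have := @transport_lin R nu rho sg r s tau med bool
  (fun i : bool => if i then k else k') (fun i => if i then al else al')
  (fun i => if i then be else be') _ (fun=> B) (fun=> 0) Tm
  (fun i => if i then 1 else - 1) _ _ _ _ 1 q 0 0 n1 q1 o01 (lexx 0) T1.
rewrite big_bool !mulr0 expi0 => H.
rewrite (_ : _ - _ = 1 * 1 * (1 * (al 0 - 1) + q * be 0)
   + -1 * 1 * (1 * (al' 0 - 1) + q * be' 0)); last by ring.
apply: H => //.
- by case.
- by move=> t _; rewrite oppr0; exact: rder_cst.
- move=> t /andP[t0 tT]; rewrite add0r /trig big_bool mul1r mulN1r.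
  apply: le_trans (expi_lipschitz _ _) _.
  by rewrite -mulrBl normrM mulrC (ger0_norm t0) /B ler_wpM2r.
Qed.

Lemma impedance_lipschitz d k k' : impedance_of r s d k -> impedance_of r s d k' ->
  normc (d k - d k') <= b ^+ 2 * (2 * b * (pair_cst nu sg * Tm)) * `|k - k'|.
Proof.
have [<- _ _|kk] := eqVneq k k'; first by rewrite !subrr Normc.normc0 normr0 mulr0.
move=> [al [be [m ->]]] [al' [be' [m' ->]]].
have u0 := mode_denominator_neq0 m; have u0' := mode_denominator_neq0 m'.
have [l1 l2 l3] := mode_amplitude m; have [l1' l2' l3'] := mode_amplitude m'.
have nn1 : normc (-1 : R[i]) <= 1 by rewrite normcN Normc.normc1.
have n1 : normc (1 : R[i]) <= 1 by rewrite Normc.normc1.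
have := mode_lipschitz kk n1 m m'; have := mode_lipschitz kk nn1 m m'.
rewrite !mulN1r !mul1r; set D := pair_cst nu sg * _.
move: u0 u0' l1 l2 l3 l1' l2' l3'.
set u := al 0 + be 0; set u' := al' 0 + be' 0; set v := al 0 - be 0; set v' := al' 0 - be' 0.
move=> u0 u0' l1 l2 l3 l1' l2' l3' hv hu.
have b0 : 0 < b by apply: lt_le_trans ltr01 amplitude_cst_ge1.
have inv_le (w : R[i]) : b^-1 <= normc w -> normc w^-1 <= b.
  move=> h; rewrite Normc.normcV -[leRHS]invrK lef_pV2 ?posrE ?invr_gt0 //.
  by apply: lt_le_trans h; rewrite invr_gt0.
rewrite (_ : v / u - v' / u' = u^-1 * u'^-1 * ((v - v') * u' - v' * (u - u'))); last first.
  by field; rewrite u0 u0'.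
rewrite normcM normcM (_ : _ * `|k - k'| = b ^+ 2 * (D * b + b * D)); last first.
  by rewrite /D; ring.
apply: ler_pM; rewrite ?mulr_ge0 ?normc_ge0 //.
  by rewrite expr2; apply: ler_pM; rewrite ?normc_ge0 ?inv_le.
apply: le_trans (normcB _ _) _; rewrite !normcM.
by apply: lerD; apply: ler_pM; rewrite ?normc_ge0.
Qed.

End One.

Section Two.
Variables (nu rho sg : R) (r s tau r' s' tau' : R -> R).
Hypotheses (med : medium nu rho sg r s tau) (med' : medium nu rho sg r' s' tau').
Local Notation b := (amplitude_cst sg).

Lemma defect_impedance k al be al' be' : mode r s k al be -> mode r' s' k al' be' ->
  let D := (al 0 - be 0) / (al 0 + be 0) - (al' 0 - be' 0) / (al' 0 + be' 0) in
  normc (mode_defect al be al' be' 0) <= b ^+ 2 * normc D /\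
  normc D <= b ^+ 2 * normc (mode_defect al be al' be' 0).
Proof.
move=> m m' D.
have u0 := mode_denominator_neq0 med m; have u0' := mode_denominator_neq0 med' m'.
have [l1 l2 l3] := mode_amplitude med m; have [l1' l2' l3'] := mode_amplitude med' m'.
have b0 : 0 < b by apply: lt_le_trans ltr01 (amplitude_cst_ge1 med).
have e : mode_defect al be al' be' 0 = (al 0 + be 0) * (al' 0 + be' 0) * D.
  by rewrite /mode_defect /D; field; rewrite u0 u0'.
rewrite e !normcM; move: l1 l2 l1' l2' (normc_ge0 D).
move: (normc (al 0 + be 0)) (normc (al' 0 + be' 0)) (normc D) => U U' d l1 l2 l1' l2' d0.
have bU : 1 <= b * U by rewrite -ler_pdivrMl // mulr1.
have bU' : 1 <= b * U' by rewrite -ler_pdivrMl // mulr1.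
have U0 : 0 <= U by apply: le_trans l1; rewrite invr_ge0 ltW.
have U0' : 0 <= U' by apply: le_trans l1'; rewrite invr_ge0 ltW.
split; first by rewrite expr2; apply: ler_wpM2r => //; exact: ler_pM.
rewrite (_ : _ * (_ * d) = (b * U) * (b * U') * d); last by ring.
by rewrite ler_peMl // mulr_ege1.
Qed.

End Two.
End Impedance.

(** * A power law for the extrapolated measurements *)
Section PropagationPower.
Variable R : realType.
Implicit Types (z k : R).
Variables (nu rho sg : R) (r s tau r' s' tau' : R -> R).
Hypotheses (med : medium nu rho sg r s tau) (med' : medium nu rho sg r' s' tau').
Local Notation C := (pair_cst nu sg).
Local Notation b := (amplitude_cst sg).

Definition propagation_cst (nu rho sg : R) : R :=
  amplitude_cst sg ^+ 2 * (amplitude_cst sg ^+ 2 + 16 * pair_cst nu sg ^+ 2) *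
  expR (expR 1 * (8 * rho ^+ 2)).

Lemma expR_pow_factorial (y : R) n : 0 <= y ->
  y ^+ n.+1 / n.+1`!%:R <= expR (expR 1 * y) * expR (- n.+1%:R).
Proof.
move=> y0; have h := @expR_ge1Dxn R (expR 1 * y) n (mulr_ge0 (expR_ge0 _) y0).
have h1 : (expR 1 * y) ^+ n.+1 / n.+1`!%:R <= expR (expR 1 * y) by lra.
rewrite expRN -ler_pdivrMr ?invr_gt0 ?expR_gt0 // invrK.
apply: le_trans h1; rewrite exprMn -expRM_natl mulr1.
by rewrite le_eqVlt (_ : _ == _) //; apply/eqP; ring.
Qed.

(** The data on [k0 - 2 h, k0] are extrapolated by z - 1 in units of h. The
    degree balances the amplification e^N eta of the data, which asks for
    N <= ln (1 / eta) / e, against the factorial remainder, which is at most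
    e^(p - N) with p of the order of e h z. Interpolating with the trivial
    bound 1, with weight theta, keeps the constant bounded however large p is,
    at the price of the factor theta in the power. *)
Lemma propagation_power (d d' : R -> R[i]) k0 ks eta theta :
  (forall k, 0 < k -> impedance_of r s d k) ->
  (forall k, 0 < k -> impedance_of r' s' d' k) ->
  0 < k0 -> k0 < ks -> 0 < eta < 1 ->
  (forall k, 0 < k <= k0 -> normc (d k - d' k) <= eta) -> normc (d ks - d' ks) <= 1 ->
  let h := Num.min k0 1 / 4 in
  let z := 1 + (ks - k0) / h in
  let e := z + Num.sqrt (z ^+ 2 - 1) in
  0 <= theta <= 1 -> theta * (e * (h * z)) <= 1 ->
  normc (d ks - d' ks) <= propagation_cst nu rho sg * expR (theta / e * ln eta).
Proof.
move=> imp imp' k00 k0s /andP[eta0 eta1] small le1 h z e /andP[th0 th1] thle.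
have m0 : 0 < Num.min k0 1 by rewrite lt_min k00 ltr01.
have h0 : 0 < h by rewrite /h divr_gt0.
have hk : 4 * h <= k0 by rewrite /h mulrC divfK // ge_min lexx.
have z1 : 1 <= z by rewrite /z lerDl divr_ge0 ?(ltW h0) // subr_ge0 ltW.
have q0 : 0 <= z ^+ 2 - 1 by rewrite subr_ge0 exprn_ege1.
pose f := z - Num.sqrt (z ^+ 2 - 1).
have ef : e * f = 1 by rewrite mulrC /e /f -subr_sqr sqr_sqrtr //; ring.
have ez : e + f = 2 * z by rewrite /e /f; ring.
have fe : 0 < f <= e.
  have s0 := sqrtr_ge0 (z ^+ 2 - 1).
  have e0 : 0 < e by rewrite /e; lra.
  by rewrite -(pmulr_rgt0 _ e0) ef ltr01 /= /e /f; lra.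
have e1 : 1 <= e by case/andP: fe => ? ?; lra.
have e0 : 0 < e by exact: lt_le_trans e1.
pose c := k0 - 2 * h.
have csE : c + h * (1 + z) = ks by rewrite /c /z; field; rewrite gt_eqF.
clear q0; clearbody f; clearbody e; clearbody z; clearbody h.
(* The degree of the extrapolation is the integer part of a. *)
pose La := - ln eta.
have La0 : 0 < La by rewrite /La oppr_gt0 ln_lt0 // eta0.
have etaE : eta = expR (- La) by rewrite /La opprK lnK ?posrE.
pose a := La / e.
have a0 : 0 < a by rewrite divr_gt0.
have /andP[N1 N2] := truncn_itv (ltW a0); set N := Num.truncn a in N1 N2; clearbody N.
have b1 := amplitude_cst_ge1 med.
have b2 : 1 <= b ^+ 2 by exact: exprn_ege1.
have ks0 : 0 < ks by exact: lt_trans k0s.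
have [al [be [m dE]]] := imp _ ks0; have [al' [be' [m' dE']]] := imp' _ ks0.
have [_ hd] := defect_impedance med med' m m'; rewrite -dE -dE' in hd.
have beta0 : 0 <= b ^+ 2 * eta by rewrite mulr_ge0 ?(ltW eta0) // (le_trans ler01).
have data k : c <= k <= c + 2 * h -> exists al be al' be',
   [/\ mode r s k al be, mode r' s' k al' be'
     & normc (mode_defect al be al' be' 0) <= b ^+ 2 * eta].
  move=> /andP[k1 k2].
  have kk : 0 < k <= k0 by move: k1 k2; rewrite /c; lra.
  have kp : 0 < k by case/andP: kk.
  have [a1 [a2 [m1 E1]]] := imp _ kp; have [a1' [a2' [m1' E1']]] := imp' _ kp.
  exists a1, a2, a1', a2'; split => //.
  have [hh _] := defect_impedance med med' m1 m1'; rewrite -E1 -E1' in hh.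
  apply: le_trans hh _; apply: ler_wpM2l; first by rewrite (le_trans ler01).
  exact: small.
have m2 := m; have m2' := m'; rewrite -csE in m2 m2'.
have C0 : 0 <= C ^+ 2 by exact: sqr_ge0.
pose y := 2 * h * z * (4 * rho ^+ 2).
have z0 : 0 <= z by exact: le_trans z1.
have y0 : 0 <= y.
  apply: mulr_ge0; last by apply: mulr_ge0 => //; exact: sqr_ge0.
  by apply: mulr_ge0 => //; apply: mulr_ge0 => //; exact: ltW.
have eN0 : 0 <= e ^+ N by rewrite exprn_ge0 // ltW.
have t1 : e ^+ N * eta <= expR (- a).
  have le : ln e <= e - 1.
    have := @le_ln1Dx R (e - 1); rewrite (_ : 1 + (e - 1) = e); last by ring.
    by apply; rewrite ltrBrDr addNr.
  have -> : e ^+ N = expR (N%:R * ln e) by rewrite expRM_natl lnK ?posrE.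
  rewrite etaE -expRD ler_expR.
  have h1 : N%:R * ln e <= a * (e - 1).
    by apply: ler_pM => //; rewrite ln_ge0.
  have h2 : a * e = La by rewrite /a divfK // gt_eqF.
  lra.
pose p := expR 1 * (e * y).
have t2 : e ^+ N * (y ^+ N.+1 / N.+1`!%:R) <= expR p * expR (- a).
  apply: (@le_trans _ _ ((e * y) ^+ N.+1 / N.+1`!%:R)).
    rewrite [(e * y) ^+ _]exprMn -[leRHS]mulrA; apply: ler_wpM2r.
      by rewrite mulr_ge0 ?invr_ge0 ?ler0n // exprn_ge0.
    by rewrite exprS ler_peMl.
  apply: le_trans (expR_pow_factorial _ _) _; first by rewrite mulr_ge0 // ltW.
  apply: ler_wpM2l; first exact: expR_ge0.
  by rewrite ler_expR lerN2 ltW.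
have := @defect_extrapolation R nu rho sg r s tau r' s' tau' med med' N z e f c h
  (b ^+ 2 * eta) al be al' be' z1 ef ez fe h0 beta0 data m2 m2'.
rewrite -/y; move: (_ / N.+1`!%:R) t2 => w t2 hD.
pose K1 := b ^+ 2 * (b ^+ 2 + 16 * C ^+ 2).
have K1_ge1 : 1 <= K1 by rewrite mulr_ege1 //; lra.
have p0 : 0 <= p by apply: mulr_ge0; [exact: expR_ge0 | apply: mulr_ge0 => //; exact: ltW].
have bound : normc (d ks - d' ks) <= K1 * expR (p - a).
  apply: le_trans hd _; rewrite /K1 -mulrA.
  apply: ler_wpM2l; first by rewrite (le_trans ler01).
  apply: le_trans hD _.
  have h1 : e ^+ N * (b ^+ 2 * eta) <= b ^+ 2 * (expR p * expR (- a)).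
    rewrite mulrCA; apply: ler_wpM2l; first by rewrite (le_trans ler01).
    apply: le_trans t1 _; rewrite mulrC; exact: le_mul_expR (expR_ge0 _) p0.
  have h2 := ler_wpM2l (mulr_ge0 (ler0n _ 16) C0) t2.
  rewrite expRD mulrDl; move: h1 h2; lra.
have : normc (d ks - d' ks) <= K1 * expR (theta * (p - a)).
  (* If p >= a the claim is weaker than the bound 1. *)
  have [pa|pa] := leP 0 (p - a).
    apply: (le_trans le1); apply: (le_trans K1_ge1).
    by apply: le_mul_expR; [exact: le_trans ler01 K1_ge1 | exact: mulr_ge0].
  apply: le_trans bound _; apply: ler_wpM2l; first by rewrite (le_trans ler01).
  by rewrite ler_expR; move: pa; nra.
move=> H; apply: le_trans H _; rewrite /propagation_cst -/K1 -mulrA.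
apply: ler_wpM2l; first by rewrite (le_trans ler01).
rewrite -expRD ler_expR mulrBr.
have -> : theta * p = expR 1 * (8 * rho ^+ 2) * (theta * (e * (h * z))).
  by rewrite /p /y; move: (expR 1) => ee; ring.
have -> : theta * a = - (theta / e * ln eta) by rewrite /a /La; ring.
rewrite opprK lerD2r -[leRHS]mulr1; apply: ler_wpM2l => //.
by apply: mulr_ge0; [exact: expR_ge0 | apply: mulr_ge0 => //; exact: sqr_ge0].
Qed.

End PropagationPower.

(** * The exponent of the power law *)
Section Exponent.
Variable R : realType.
Implicit Types (x y z k : R).

Lemma bernoulli_le x (m : nat) : 0 <= x -> 1 + m%:R * x <= (1 + x) ^+ m.
Proof.
move=> x0; elim: m => [|m ih]; first by rewrite expr0 mul0r addr0.
rewrite exprS -natr1.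
have := ler_wpM2l (_ : 0 <= 1 + x) ih; rewrite addr_ge0 // => /(_ isT).
have : 0 <= m%:R * x * x by rewrite !mulr_ge0.
lra.
Qed.

(** The quotients in the bounds on the exponent are increasing functions of the
    ratio a / b alone. *)
Lemma atan_ratio_le (a b c d : R) : 0 < a -> a < b -> 0 < c -> c < d -> a * d <= c * b ->
  a / Num.sqrt (b ^+ 2 - a ^+ 2) <= c / Num.sqrt (d ^+ 2 - c ^+ 2).
Proof.
move=> a0 ab c0 cd h.
have sq (u w : R) : 0 < u -> u < w -> 0 < w ^+ 2 - u ^+ 2.
  by move=> u0 uw; rewrite subr_gt0 ltrXn2r // ltW // (lt_trans u0).
have p1 := sq _ _ a0 ab; have p2 := sq _ _ c0 cd.
rewrite ler_pdivrMr ?sqrtr_gt0 // mulrAC ler_pdivlMr ?sqrtr_gt0 //.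
have e (u w : R) : 0 < u -> 0 <= w -> u * Num.sqrt w = Num.sqrt (u ^+ 2 * w).
  by move=> u0 w0; rewrite sqrtrM ?sqr_ge0 // sqrtr_sqr gtr0_norm.
rewrite !e ?(ltW p1) ?(ltW p2) //; apply: ler_wsqrtr.
have d0 := lt_trans c0 cd; have b0 := lt_trans a0 ab.
have : (a * d) ^+ 2 <= (c * b) ^+ 2.
  by rewrite ler_sqr ?nnegrE // ltW // mulr_gt0.
rewrite !exprMn; lra.
Qed.

(** By convexity, expR x - 1 over x is nondecreasing. *)
Lemma expR_sub1_ratio k ks : 0 < k -> k <= ks ->
  (expR k - 1) * ks <= k * (expR ks - 1).
Proof.
move=> k0 kks.
have := @rder_nondecreasing R (fun x => k * (expR x - 1) - (expR k - 1) * x)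
  (fun x => k * expR x - (expR k - 1)) k ks.
have -> : k * (expR k - 1) - (expR k - 1) * k = 0 by ring.
rewrite subr_ge0; apply => // x /andP[kx xs].
- apply: rderB; last exact: rder_linear.
  apply: rder_eq.
    apply: rderM; first exact: rder_cst.
    by apply: rderB; [exact: is_derive_expR | exact: rder_cst].
  by rewrite mul0r add0r subr0.
- have h1 : k * expR k <= k * expR x by rewrite ler_wpM2l ?(ltW k0) // ler_expR.
  have h2 : expR k * (1 - k) <= 1.
    rewrite -[leRHS](expRxMexpNx_1 k); apply: ler_wpM2l; first exact: expR_ge0.
    exact: expR_ge1Dx.
  lra.
Qed.

Section Fixed.
Variable n : nat.
Hypothesis n_large : (400 <= n)%N.

Let pi_neq0 : @pi R != 0. Proof. by rewrite gt_eqF ?pi_gt0. Qed.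

Let base k : R := (expR k - 1) ^+ n.
Let gap ks k := Num.sqrt (base ks ^+ 2 - base k ^+ 2).

(** The prescribed lower bound itself, with the arctangent of a quotient a / g
    written as the complement of that of g / a, which has no pole on the
    diagonal and is continuous on the whole quadrant. It equals 1 for
    ks <= k because the square root of a negative number is 0. *)
Definition hoelder_exponent (ks k : R) : R :=
  1 - 2 / pi * atan (Num.sqrt (((expR ks - 1) ^+ n) ^+ 2 - ((expR k - 1) ^+ n) ^+ 2)
                     / (expR k - 1) ^+ n).

Let hE ks k : hoelder_exponent ks k = 1 - 2 / pi * atan (gap ks k / base k).
Proof. by []. Qed.

Let sub1_gt0 k : 0 < k -> 0 < expR k - 1.
Proof. by move=> k0; rewrite subr_gt0 expR_gt1. Qed.

Let base_gt0 k : 0 < k -> 0 < base k.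
Proof. by move=> k0; rewrite /base exprn_gt0 // sub1_gt0. Qed.

Let n_gt0 : (0 < n)%N. Proof. by apply: leq_trans n_large. Qed.

Let base_lt k ks : 0 < k -> k < ks -> base k < base ks.
Proof.
move=> k0 h; rewrite /base ltrXn2r -?lt0n ?n_gt0 ?(ltW (sub1_gt0 k0)) //.
by rewrite ltrD2r ltr_expR.
Qed.

Let gap_gt0 k ks : 0 < k -> k < ks -> 0 < gap ks k.
Proof.
move=> k0 h; rewrite /gap sqrtr_gt0 subr_gt0 ltrXn2r //; last exact: base_lt.
by rewrite ltW // base_gt0.
Qed.

Lemma hoelder_exponent_diag k ks : 0 < ks -> ks <= k -> hoelder_exponent ks k = 1.
Proof.
move=> ks0 h; have k0 : 0 < k by exact: lt_le_trans h.
rewrite hE /gap (_ : Num.sqrt _ = 0) ?mul0r ?atan0 ?mulr0 ?subr0 //.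
apply/eqP; rewrite sqrtr_eq0 subr_le0.
have : base ks <= base k.
  by rewrite /base lerXn2r ?nnegrE ?(ltW (sub1_gt0 _)) // lerD2r ler_expR.
by rewrite ler_sqr ?nnegrE ?(ltW (base_gt0 k0)) ?(ltW (base_gt0 ks0)).
Qed.

Lemma hoelder_exponent_atan k ks : 0 < k -> k < ks ->
  hoelder_exponent ks k = 2 / pi * atan (base k / gap ks k).
Proof.
move=> k0 h; rewrite hE -[gap ks k / _]invf_div atanV; last by rewrite divr_gt0 ?gap_gt0 ?base_gt0.
by move: (atan _) (@pi R) pi_neq0 => t p p0; field.
Qed.

Lemma hoelder_exponent_gt0 k ks : 0 < k -> 0 < ks -> 0 < hoelder_exponent ks k.
Proof.
move=> k0 ks0; have [h|h] := leP ks k; first by rewrite hoelder_exponent_diag.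
rewrite hoelder_exponent_atan // mulr_gt0 ?divr_gt0 ?pi_gt0 //.
by rewrite -atan0 lt_atan // divr_gt0 ?base_gt0 ?gap_gt0.
Qed.

Lemma hoelder_exponent_le1 k ks : 0 < k -> hoelder_exponent ks k <= 1.
Proof.
move=> k0; rewrite hE lerBlDr lerDl mulr_ge0 ?divr_ge0 ?pi_ge0 //.
rewrite -atan0 le_atan // divr_ge0 ?sqrtr_ge0 //; exact/ltW/base_gt0.
Qed.

Lemma hoelder_exponent_lower k ks : 0 < k -> k <= ks ->
  w0_lower n ks k = hoelder_exponent ks k.
Proof.
move=> k0; rewrite /w0_lower [(2 * n)%N]mulnC !exprM -/(base ks) -/(base k) -/(gap ks k).
rewrite le_eqVlt => /predU1P[<-|h].
  rewrite hoelder_exponent_diag // /equot /gap subrr sqrtr0 eqxx /=.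
  by move: (@pi R) pi_neq0 => p p0; field.
by rewrite hoelder_exponent_atan // /equot gt_eqF ?gap_gt0.
Qed.

Lemma hoelder_exponent_upper k ks : 0 < k -> k <= ks ->
  hoelder_exponent ks k <= w0_upper n ks k.
Proof.
move=> k0; rewrite /w0_upper.
have e2 x : expR (2 * x * n%:R) = expR (x * n%:R) ^+ 2.
  by rewrite -expRM_natl; congr expR; ring.
rewrite !e2 le_eqVlt => /predU1P[<-|h].
  rewrite hoelder_exponent_diag // /equot !subrr sqrtr0 eqxx.
  rewrite (_ : [set _; _] = [set +oo%E]); last by rewrite setUid.
  rewrite ereal_inf1 /=; rewrite le_eqVlt (_ : _ == _) //; apply/eqP.
  by move: (@pi R) pi_neq0 => p p0; field.
rewrite hoelder_exponent_atan //.
have ks0 := lt_trans k0 h.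
have n0 : (0 : R) < n%:R by rewrite ltr0n.
have eklt : expR (k * n%:R) < expR (ks * n%:R) by rewrite ltr_expR ltr_pM2r.
have s1 : 0 < Num.sqrt (ks ^+ 2 - k ^+ 2).
  by rewrite sqrtr_gt0 subr_gt0 ltrXn2r // ltW.
have s2 : 0 < Num.sqrt (expR (ks * n%:R) ^+ 2 - expR (k * n%:R) ^+ 2).
  by rewrite sqrtr_gt0 subr_gt0 ltrXn2r // expR_ge0.
rewrite /equot !gt_eqF //.
have q1 : base k / gap ks k <= k / Num.sqrt (ks ^+ 2 - k ^+ 2).
  apply: atan_ratio_le => //; rewrite ?base_gt0 ?base_lt //.
  rewrite /base -(prednK n_gt0) !exprS mulrAC mulrA.
  apply: ler_pM; rewrite ?mulr_ge0 ?exprn_ge0 ?(ltW k0) ?(ltW ks0) ?(ltW (sub1_gt0 _)) //.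
    exact/expR_sub1_ratio/ltW.
  by rewrite lerXn2r ?nnegrE ?(ltW (sub1_gt0 _)) // lerD2r ler_expR ltW.
have q2 : base k / gap ks k <=
    expR (k * n%:R) / Num.sqrt (expR (ks * n%:R) ^+ 2 - expR (k * n%:R) ^+ 2).
  apply: atan_ratio_le => //; rewrite ?base_gt0 ?base_lt ?expR_gt0 //.
  rewrite ![_ * n%:R]mulrC !expRM_natl /base -!exprMn.
  rewrite lerXn2r ?nnegrE ?mulr_ge0 ?expR_ge0 ?(ltW (sub1_gt0 _)) //.
  have : expR k <= expR ks by rewrite ler_expR ltW.
  lra.
set I := ereal_inf _.
have lo : ((base k / gap ks k)%:E <= I)%E.
  by apply: le_ereal_inf_tmp => x [->|->]; rewrite lee_fin.
have up : (I <= (k / Num.sqrt (ks ^+ 2 - k ^+ 2))%:E)%E.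
  by apply: ereal_inf_lbound; left.
clearbody I; apply: ler_wpM2l; first by rewrite divr_ge0 ?pi_ge0.
case: I lo up => [x| |] //=; rewrite ?lee_fin // => lo _.
exact: le_atan.
Qed.

(** The ratio of expR ks - 1 to expR k - 1 grows at least linearly on the scale
    min (k, 1), the one on which the extrapolation is measured. *)
Let growth k ks (D := 1 + (ks - k) / Num.min k 1) : 0 < k -> k < ks ->
  D * (expR k - 1) <= expR ks - 1.
Proof.
move=> k0 h; rewrite /D.
set t := ks - k; have t0 : 0 < t by rewrite /t subr_gt0.
have -> : expR ks = expR k * expR t by rewrite -expRD /t; congr expR; ring.
have m0 : 0 < Num.min k 1 by rewrite lt_min k0 ltr01.
suff h1 : expR k - 1 <= expR k * Num.min k 1.
  have h2 : t / Num.min k 1 * (expR k - 1) <= t * expR k.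
    rewrite mulrAC ler_pdivrMr // -mulrA; apply: ler_wpM2l => //; exact: ltW.
  have h3 : expR k * (1 + t) <= expR k * expR t.
    by apply: ler_wpM2l; [exact: expR_ge0 | exact: expR_ge1Dx].
  by move: h2 h3; move: (_ / Num.min k 1) => q; lra.
case: (leP k 1) => _; last by rewrite mulr1 gerBl.
have h2 : expR k * (1 - k) <= 1.
  rewrite -[leRHS](expRxMexpNx_1 k); apply: ler_wpM2l; first exact: expR_ge0.
  exact: expR_ge1Dx.
lra.
Qed.

(** Near the diagonal, 1 - 1 / e and the quotient inside the exponent both behave
    like the square root q of the distance; this compares the constants. *)
Let small_gap (q y : R) : 0 <= q <= 1 / 6 -> 14 * q <= y -> 3 * q <= 2 / pi * atan y.
Proof.
case/andP=> q0 q6 qy; have p0 := pi_gt0 R.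
have p4 : pi <= 4 :> R by have := pihalf_lt2 R; lra.
apply: (@le_trans _ _ (2 / pi * atan (14 * q))); last first.
  by rewrite ler_wpM2l ?divr_ge0 ?pi_ge0 // le_atan.
rewrite mulrAC ler_pdivlMr //.
have [h|h] := leP (14 * q) 1.
  have := @atan_ge_half R (14 * q); rewrite h mulr_ge0 // => /(_ isT).
  have : q * pi <= q * 4 by rewrite ler_wpM2l.
  lra.
have : atan 1 <= atan (14 * q) by rewrite le_atan // ltW.
rewrite atan1; have : q * pi <= 1 / 6 * pi by rewrite ler_wpM2r // ltW.
lra.
Qed.

Let n_excess : (776 <= 2 * n - 24)%N.
Proof. by have := n_large; lia. Qed.

(** With theta of the order of 1 / z^2 the available power theta / e decays
    like z^(-3), whereas the exponent decays like the inverse n-th power of the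
    ratio of the bases. A large n also makes the exponent leave 1 faster than
    1 / e near the diagonal; n >= 400 suffices for both regimes. *)
Lemma hoelder_exponent_rate k ks : 0 < k -> k < ks ->
  let h := Num.min k 1 / 4 in
  let z := 1 + (ks - k) / h in
  let e := z + Num.sqrt (z ^+ 2 - 1) in
  let theta := (Num.max 1 (z ^+ 2 / 2))^-1 in
  [/\ 0 <= theta <= 1, theta * (e * (h * z)) <= 1 & hoelder_exponent ks k <= theta / e].
Proof.
move=> k0 kks h z e theta.
have m0 : 0 < Num.min k 1 by rewrite lt_min k0 ltr01.
have h0 : 0 < h by rewrite /h divr_gt0.
have h4 : h <= 1 / 4.
  by rewrite /h ler_wpM2r ?invr_ge0 // ge_min lexx orbT.
pose dl := (ks - k) / h.
have dl0 : 0 < dl by rewrite divr_gt0 // subr_gt0.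
have zE : z = 1 + dl by [].
have gr := growth k0 kks; set D := 1 + _ / _ in gr.
have DE : D = 1 + dl / 4.
  by rewrite /D /dl /h; field; rewrite gt_eqF.
have D1 : 1 <= D by rewrite DE lerDl divr_ge0 // ltW.
pose Y := gap ks k / base k.
have Y2 : D ^+ (2 * n) - 1 <= Y ^+ 2.
  have b0 := base_gt0 k0.
  have bl : D ^+ n * base k <= base ks.
    rewrite /base -exprMn lerXn2r ?nnegrE ?(ltW (sub1_gt0 _)) ?(lt_trans k0 kks) //.
    by rewrite mulr_ge0 ?(ltW (sub1_gt0 _)) // (le_trans ler01).
  rewrite /Y expr_div_n /gap sqr_sqrtr; last first.
    by rewrite subr_ge0 ler_sqr ?nnegrE ?(ltW (base_lt _ _)) ?(ltW (base_gt0 _)) ?(lt_trans k0 kks).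
  rewrite ler_pdivlMr ?(exprn_gt0 2 b0) // mulrBl mul1r lerD2r mulnC exprM -exprMn.
  rewrite ler_sqr ?nnegrE ?(ltW (base_gt0 _)) ?(lt_trans k0 kks) //.
  by rewrite mulr_ge0 ?(ltW b0) // exprn_ge0 // (le_trans ler01).
have Y0 : 0 < Y by rewrite divr_gt0 ?gap_gt0 ?base_gt0.
have wE : hoelder_exponent ks k = 1 - 2 / pi * atan Y by [].
have n400 : 400 <= n%:R :> R by rewrite (ler_nat R 400).
clearbody Y D dl.
have q0 : 0 <= z ^+ 2 - 1 by rewrite subr_ge0 exprn_ege1 // zE; lra.
have sq : Num.sqrt (z ^+ 2 - 1) <= z.
  rewrite -[leRHS]ger0_norm; last by rewrite zE; lra.
  by rewrite -sqrtr_sqr ler_wsqrtr // gerBl.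
have sq0 := sqrtr_ge0 (z ^+ 2 - 1).
have e2 : e <= 2 * z by rewrite /e; lra.
have e1 : 1 <= e by rewrite /e; move: sq0; rewrite zE; lra.
set mx := Num.max 1 (z ^+ 2 / 2) in theta *.
have mx1 : 1 <= mx by rewrite /mx le_max lexx.
have mxz : z ^+ 2 / 2 <= mx by rewrite /mx le_max lexx orbT.
have th01 : 0 <= theta <= 1.
  by rewrite /theta invr_ge0 (le_trans ler01 mx1) invf_le1 // (lt_le_trans ltr01).
have mx0 : 0 < mx by exact: lt_le_trans mx1.
have e0 : 0 < e by exact: lt_le_trans e1.
split => //.
  rewrite /theta mulrC ler_pdivrMr // mul1r; apply: le_trans mxz.
  have z0 : 0 <= z by rewrite zE; lra.
  apply: (@le_trans _ _ (2 * z * (1 / 4 * z))); last by lra.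
  apply: ler_pM => //; [exact: ltW | by rewrite mulr_ge0 // ltW | exact: ler_wpM2r].
rewrite wE /theta -invfM.
(* Near the diagonal theta = 1; far from it, powers of z and D are compared. *)
have [small|big] := leP dl (1 / 36).
- have -> : mx = 1.
    rewrite /mx; apply/max_idPl; have : z ^+ 2 <= 2; last by lra.
    by rewrite zE; nra.
  rewrite mul1r.
  have [q qE] : exists q, q = Num.sqrt dl by eexists.
  have qq : q ^+ 2 = dl by rewrite qE sqr_sqrtr // ltW.
  have qge : 0 <= q by rewrite qE sqrtr_ge0.
  have q6 : q <= 1 / 6.
    by rewrite -ler_sqr ?nnegrE // qq; lra.
  have sz : Num.sqrt (z ^+ 2 - 1) <= 2 * q.
    rewrite -[leRHS]ger0_norm ?mulr_ge0 // -sqrtr_sqr ler_wsqrtr //.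
    by rewrite zE exprMn qq; nra.
  have q2 : q ^+ 2 <= q by rewrite expr2 ler_piMr //; lra.
  have zq : z = 1 + q ^+ 2 by rewrite qq.
  have e3 : e - 1 <= 3 * q by move: sz q2; rewrite /e {2}zq; move: (Num.sqrt _) (q ^+ 2) => u w; lra.
  have Yq : 14 * q <= Y.
    rewrite -ler_sqr ?nnegrE ?mulr_ge0 // ?(ltW Y0) //.
    apply: le_trans Y2; rewrite exprMn qq.
    have := @bernoulli_le (dl / 4) (2 * n); rewrite divr_ge0 ?(ltW dl0) // => /(_ isT).
    rewrite DE natrM; have : 400 * dl <= n%:R * dl by rewrite ler_wpM2r // ltW.
    lra.
  have qr : 0 <= q <= 1 / 6 by rewrite qge.
  have := small_gap qr Yq.
  have : 2 - e <= e^-1.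
    by rewrite -[leRHS]mul1r ler_pdivlMr //; have := sqr_ge0 (e - 1); lra.
  move: (_ * atan Y) => t; lra.
- have cY : 1 - 2 / pi * atan Y <= Y^-1.
    apply: le_trans (coatan_le_inv Y0).
    have p2 := pi_ge2 R; have p0 := pi_gt0 R; have c0 := coatan_gt0 Y.
    have -> : 1 - 2 / pi * atan Y = 2 / pi * (pi / 2 - atan Y).
      by move: (atan Y) (@pi R) pi_neq0 => t p pn; field.
    by rewrite ler_piMl ?(ltW c0) // ler_pdivrMr // mul1r.
  apply: le_trans cY _; rewrite lef_pV2 ?posrE ?mulr_gt0 //.
  have zD : z <= D ^+ 4.
    have := @bernoulli_le (dl / 4) 4; rewrite divr_ge0 ?(ltW dl0) // => /(_ isT).
    by rewrite -DE zE; apply: le_trans; lra.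
  have z1 : 1 <= z by rewrite zE; lra.
  have mxz2 : mx <= z ^+ 2.
    by rewrite /mx ge_max exprn_ege1 //=; have := sqr_ge0 z; lra.
  have zz : mx * e <= 2 * z ^+ 3.
    rewrite (_ : 2 * z ^+ 3 = z ^+ 2 * (2 * z)); last by ring.
    by apply: ler_pM => //; exact: ltW.
  apply: le_trans zz _; rewrite -ler_sqr ?nnegrE ?mulr_ge0 ?exprn_ge0 ?(ltW Y0) ?(le_trans ler01 z1) //.
  apply: le_trans Y2; rewrite exprMn -exprM.
  have z6 : z ^+ (3 * 2) <= D ^+ 24.
    have -> : D ^+ 24 = (D ^+ 4) ^+ (3 * 2) by rewrite -exprM.
    apply: lerXn2r; rewrite ?nnegrE //.
      by rewrite (le_trans ler01).
    by rewrite exprn_ge0 // (le_trans ler01).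
  have D24 : 1 <= D ^+ 24 by exact: exprn_ege1.
  have n2 : (24 + (2 * n - 24))%N = (2 * n)%N.
    by rewrite subnKC // (leq_trans _ (leq_mul (leqnn 2) n_large)).
  have D5 : 5 <= D ^+ (2 * n - 24).
    have := @bernoulli_le (dl / 4) (2 * n - 24); rewrite divr_ge0 ?(ltW dl0) // => /(_ isT).
    rewrite -DE; apply: le_trans.
    have : (776%:R : R) <= (2 * n - 24)%:R.
      by rewrite ler_nat n_excess.
    move: ((2 * n - 24)%:R : R) => w hw.
    have : 776 * (dl / 4) <= w * (dl / 4) by rewrite ler_wpM2r // divr_ge0 // ltW.
    lra.
  rewrite -n2 exprD.
  have : D ^+ 24 * 5 <= D ^+ 24 * D ^+ (2 * n - 24).
    by apply: ler_wpM2l => //; exact: le_trans ler01 D24.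
  move: z6 D24; move: (z ^+ _) (D ^+ 24) (_ * D ^+ _) => a b c; lra.
Qed.

End Fixed.
End Exponent.

Section ExponentContinuity.
Variable R : realType.

Lemma hoelder_exponent_continuous (n : nat) :
  {within [set z : R * R | 0 < z.1 /\ 0 < z.2],
    continuous (fun z : R * R => hoelder_exponent n z.1 z.2)}.
Proof.
apply: continuous_in_subspaceT => z; rewrite inE /= => -[_ z2].
have c1 : {for z, continuous (fun u : R * R => u.1)} by exact: cvg_fst.
have c2 : {for z, continuous (fun u : R * R => u.2)} by exact: cvg_snd.
have comp (g : R -> R) (p : R * R -> R) : {for z, continuous p} ->
    {for p z, continuous g} -> {for z, continuous (fun u => g (p u))}.
  exact: continuous_comp.
have csub (p q : R * R -> R) : {for z, continuous p} -> {for z, continuous q} ->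
    {for z, continuous (fun u => p u - q u)} by exact: cvgB.
have cmul (p q : R * R -> R) : {for z, continuous p} -> {for z, continuous q} ->
    {for z, continuous (fun u => p u * q u)} by exact: cvgM.
have ccst (a : R) : {for z, continuous (fun=> a)} by exact: cst_continuous.
have cB (p : R * R -> R) : {for z, continuous p} ->
    {for z, continuous (fun u => (expR (p u) - 1) ^+ n)}.
  move=> cp; apply: (comp (fun x => x ^+ n)); last exact: exprn_continuous.
  by apply: (csub) => //; apply: (comp expR) => //; exact: continuous_expR.
rewrite /hoelder_exponent; apply: (csub) => //.
apply: (cmul) => //.
apply: (comp atan); last exact: continuous_atan.
apply: (cmul).
  apply: (comp Num.sqrt); last exact: sqrt_continuous.
  by apply: (csub); apply: (comp (fun x => x ^+ 2)); [exact: cB | exact: exprn_continuous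
    | exact: cB | exact: exprn_continuous].
apply: (comp (fun x => x^-1)); first exact: cB.
by apply: inv_continuous; rewrite gt_eqF // exprn_gt0 // subr_gt0 expR_gt1.
Qed.

End ExponentContinuity.

(** * From waves to amplitudes *)
Section ModesOfSolutions.
Variable R : realType.
Implicit Types (x y k : R).

Lemma conjcM (z w : R[i]) : conjc (z * w) = conjc z * conjc w.
Proof. exact: rmorphM. Qed.

Lemma normc_conj (z : R[i]) : normc (conjc z) = normc z.
Proof. by case: z => a b; rewrite /Normc.normc /= sqrrN. Qed.

(** The modes at negative frequencies, which the kernel needs, carry the same
    information as those at positive ones. *)
Lemma mode_conj (r s : R -> R) k (al be : R -> R[i]) : mode r s k al be ->
  mode r s (- k) (fun x => conjc (al x)) (fun x => conjc (be x)).
Proof.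
case=> ode al1 be1; split.
- move=> x h; have [da db] := ode x h; split.
    apply: cder_eq (cder_conj da) _; rewrite conjcM; congr (_ * _).
    by apply: complexP => //=; rewrite oppr0.
  apply: cder_eq (cder_conj db) _.
  by case: (al x) => a1 a2; case: (be x) => b1 b2; apply: complexP; rewrite !reimE /=; ring.
- by rewrite al1; apply: complexP => //=; rewrite oppr0.
- by rewrite be1; apply: complexP => //=; rewrite oppr0.
Qed.

Section Amplitudes.
Variables (nu rho sg : R) (r s tau : R -> R).
Hypothesis med : medium nu rho sg r s tau.
Variables (k : R) (u v : R -> R[i]).
Hypothesis du : forall x, 0 <= x <= 1 -> cder u x (ii * k%:C * v x).
Hypothesis dv : forall x, 0 <= x <= 1 -> cder v x (ii * (k * r x ^+ 4)%:C * u x).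
Hypothesis uv1 : u 1 = v 1.
Hypothesis uv0 : u 0 != 0 \/ v 0 != 0.

Let X x : R[i] := (r x)%:C.
Let Y x : R[i] := ((r x)^-1)%:C.
Let E x : R[i] := expi (- (k * tau x)).

Let XY x : 0 <= x <= 1 -> X x * Y x = 1.
Proof. by move=> h; rewrite /X /Y -rmorphM divff // gt_eqF // (medium_r_gt0 med h). Qed.

Let dX x : 0 <= x <= 1 -> cder X x ((s x)%:C * X x).
Proof. by move=> h; rewrite -rmorphM; apply/cder_real/(medium_r med). Qed.

Let dY x : 0 <= x <= 1 -> cder Y x (- ((s x)%:C * Y x)).
Proof.
move=> h; have r0 := medium_r_gt0 med h; rewrite -rmorphM -rmorphN; apply: cder_real.
apply: rder_eq; first by apply: rderV; [rewrite gt_eqF | exact: (medium_r med)].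
by field; rewrite gt_eqF.
Qed.

Let dE x : 0 <= x <= 1 -> cder E x (- (ii * k%:C * X x ^+ 2 * E x)).
Proof.
move=> h; apply: cder_eq.
  apply: cder_expi; apply: rderN; apply: (@rder_comp R (fun z => k * z)).
    exact: rder_linear.
  exact: (medium_tau med).
have -> : (- (k * r x ^+ 2))%:C = - (k%:C * X x ^+ 2) :> R[i].
  by rewrite /X -rmorphXn -rmorphM -rmorphN.
by rewrite -/(E x); ring.
Qed.

Let fwd x : R[i] := E x * (X x * u x + Y x * v x) / 2%:R.
Let bwd x : R[i] := E x * (X x * u x - Y x * v x) / 2%:R.

Let ode : mode_eq r s k fwd bwd.
Proof.
move=> x h; have e := XY h.
have half : cder (fun=> (2%:R)^-1 : R[i]) x 0 by exact: cder_cst.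
have dXu := cderM (dX h) (du h); have dYv := cderM (dY h) (dv h).
have k4 : (k * r x ^+ 4)%:C = k%:C * X x ^+ 4 :> R[i] by rewrite /X -rmorphXn -rmorphM.
have k2 : (2 * k * r x ^+ 2)%:C = (1 + 1) * k%:C * X x ^+ 2 :> R[i].
  by rewrite /X -(rmorph1 (real_complex R)) -rmorphD -rmorphXn -!rmorphM.
split; (apply: cder_eq; first apply: cderM half).
- by apply: cderM; [exact: dE | apply: cderD; eassumption].
- rewrite mulr0 addr0 k4 /bwd [RHS]mulrA; congr (_ / _).
  move: (X x) (Y x) (E x) (u x) (v x) e => A B D U V e.
  rewrite -[LHS](subrK (ii * k%:C * D * (A * B - 1) * (A ^+ 3 * U - A * V))).
  by rewrite {2}e subrr mulr0 mul0r addr0; ring.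
- by apply: cderM; [exact: dE | apply: cderB; eassumption].
- rewrite mulr0 addr0 k4 k2 /fwd /bwd.
  rewrite [RHS](_ : _ = ((s x)%:C * (E x * (X x * u x + Y x * v x))
     - (1 + 1) * k%:C * X x ^+ 2 * ii * (E x * (X x * u x - Y x * v x))) / 2%:R); last by ring.
  congr (_ / _).
  move: (X x) (Y x) (E x) (u x) (v x) e => A B D U V e.
  rewrite -[LHS](subrK (- (ii * k%:C * D * (A * B - 1) * (A ^+ 3 * U + A * V)))).
  by rewrite {2}e subrr mulr0 mul0r oppr0 addr0; ring.
Qed.

Let two : (2%:R : R[i]) != 0. Proof. by rewrite pnatr_eq0. Qed.

Let end1 : fwd 1 = E 1 * u 1 /\ bwd 1 = 0.
Proof.
rewrite /fwd /bwd /X /Y (medium_r1 med) invr1 -uv1 (_ : (1 : R)%:C = 1) // !mul1r.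
split; first by field.
by rewrite subrr mulr0 mul0r.
Qed.

Let end0 : fwd 0 + bwd 0 = u 0 /\ fwd 0 - bwd 0 = v 0.
Proof.
rewrite /fwd /bwd /X /Y /E (medium_r0 med) (medium_tau0 med) mulr0 oppr0 expi0 invr1.
by rewrite (_ : (1 : R)%:C = 1) // !mul1r; split; field.
Qed.

(** If the transmitted wave vanished, the energy estimate would make the wave
    vanish at x = 0 as well; hence the amplitudes can be normalised. *)
Let u1_neq0 : u 1 != 0.
Proof.
apply/eqP => u1; have [f1 b1] := end1; rewrite u1 mulr0 in f1.
have o : 0 <= (0 : R) <= 1 by rewrite lexx ler01.
have := mode_energy med ode o; rewrite f1 b1 Normc.normc0 expr0n /= addr0 mulr0 => h.
have h1 := sqr_ge0 (normc (fwd 0)); have h2 := sqr_ge0 (normc (bwd 0)).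
have z (w : R[i]) : normc w ^+ 2 = 0 -> w = 0.
  by move/eqP; rewrite sqrf_eq0 => /eqP/Normc.eq0_normc.
have f0 : fwd 0 = 0 by apply: z; apply/eqP; rewrite eq_le h1 andbT; lra.
have b0 : bwd 0 = 0 by apply: z; apply/eqP; rewrite eq_le h2 andbT; lra.
have [e1 e2] := end0; move: uv0; rewrite -e1 -e2 f0 b0 addr0 subr0 eqxx.
by case.
Qed.

Lemma impedance_of_solution (d : R -> R[i]) : d k = v 0 / u 0 -> impedance_of r s d k.
Proof.
move=> dk; have [f1 b1] := end1; have [e1 e2] := end0.
have A0 : fwd 1 != 0.
  rewrite f1 mulf_neq0 ?u1_neq0 //; apply/eqP => h.
  by have := normc_expi (- (k * tau 1)); rewrite -/(E 1) h Normc.normc0 => /eqP; rewrite eq_sym oner_eq0.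
exists (fun x => (fwd 1)^-1 * fwd x), (fun x => (fwd 1)^-1 * bwd x); split.
  split.
  - move=> x h; have [d1 d2] := ode h; split.
      by apply: cder_eq; [apply: cderM d1; exact: cder_cst | move: (_^-1) (bwd x) => c w; ring].
    by apply: cder_eq; [apply: cderM d2; exact: cder_cst | move: (_^-1) (bwd x) (fwd x) => c w w'; ring].
  - by rewrite mulVf.
  - by rewrite b1 mulr0.
by rewrite -mulrBr -mulrDr e1 e2 dk -mulf_div divff ?mul1r // invr_eq0.
Qed.

End Amplitudes.
End ModesOfSolutions.

(** * Uniform bounds for the admissible potentials *)
Section Potentials.
Variable R : realType.
Implicit Types (x y k : R) (q : R -> R).

Lemma class_C_rder m q x : class_C m.+1 q -> rder q x (derive1 q x).
Proof.
case=> h _; have d : derivable q x 1 by exact: (h 0%N).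
by rewrite derive1E; exact: derivableP.
Qed.

Lemma class_C_continuous_derive1 m q : class_C m.+2 q -> continuous (derive1 q).
Proof.
case=> h _ x; have d : derivable (derive1 q) x 1 by exact: (h 1%N).
by apply/differentiable_continuous; rewrite -derivable1_diffP.
Qed.

Lemma rder_derive1 q x d : rder q x d -> derive1 q x = d.
Proof. by move=> h; rewrite derive1E; case: h. Qed.

Lemma continuous_bounded_01 (f : R -> R) : continuous f ->
  exists B, forall x, 0 <= x <= 1 -> `|f x| <= B.
Proof.
move=> cf; have cn : {within `[(0 : R), 1], continuous (fun x => `|f x|)}.
  by apply: continuous_subspaceT => x; exact: cvg_norm (cf x).
have [c _ H] := EVT_max ler01 cn; exists `|f c| => x hx; apply: H.
by rewrite in_itv.
Qed.

(** The endpoints themselves are covered by continuity, which gives r = 1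
    there. *)
Lemma C0_01_zero m q x : C0_01 m.+1 q -> (x <= 0) || (1 <= x) -> q x = 0.
Proof.
move=> [cq qout] hx.
have cx : {for x, continuous q} by exact: rder_continuous (class_C_rder x cq).
have [// | qx] := eqVneq (q x) 0.
have e0 : 0 < `|q x| by rewrite normr_gt0.
have /cvgrPdist_lt/(_ _ e0) := cx => /nbhs_ballP[d /= d0 hd].
have near y : `|x - y| < d -> q y != 0.
  move=> /hd /=; apply: contraTneq => ->; by rewrite subr0 ltxx.
case/orP: hx => hx.
- have := near (x - d / 2); rewrite opprB addrCA subrr addr0 gtr0_norm ?divr_gt0 //.
  rewrite ltr_pdivrMr // ltr_pMr // ltr1n => /(_ isT) /eqP; case.
  by apply: qout; rewrite in_itv /= negb_and -ltNge; apply/orP; left; lra.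
- have := near (x + d / 2); rewrite opprD addNKr normrN gtr0_norm ?divr_gt0 //.
  rewrite ltr_pdivrMr // ltr_pMr // ltr1n => /(_ isT) /eqP; case.
  by apply: qout; rewrite in_itv /= negb_and -!ltNge; apply/orP; right; lra.
Qed.

Lemma Cnorm_01_ge m (f : R -> R) (j : 'I_m.+1) x : 0 <= x <= 1 ->
  (`|derive1n j f x|%:E <= Cnorm_01 m f)%E.
Proof.
move=> hx; rewrite /Cnorm_01 (bigD1 j) //=.
have up (i : nat) y : 0 <= y <= 1 -> (`|derive1n i f y|%:E <=
    ereal_sup [set `|derive1n i f z|%:E | z in [set` `[0%R, 1%R]]])%E.
  by move=> hy; apply: ereal_sup_ubound; exists y => //=; rewrite in_itv.
have h0 : 0 <= (0 : R) <= 1 by rewrite lexx ler01.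
apply: le_trans (up j x hx) _; apply: leeDl; apply: sume_ge0 => i _.
by apply: le_trans (up i 0 h0); rewrite lee_fin.
Qed.

Lemma admissible_bounds m (M n0 : R) (q0 : R -> R) : C0_01 m.+2 q0 ->
  exists Q0 Q1 : R, forall q, admissible m.+1 M n0 q0 q ->
    forall x, 0 <= x <= 1 -> `|q x| <= Q0 /\ `|derive1 q x| <= Q1.
Proof.
move=> [cq0 _].
have c0 : continuous q0 by move=> x; exact: rder_continuous (class_C_rder x cq0).
have [A hA] := continuous_bounded_01 c0.
have [B hB] := continuous_bounded_01 (class_C_continuous_derive1 cq0).
exists (M + A), (M + B) => q [[cq _] hM _] x hx.
have h0 := le_trans (@Cnorm_01_ge m.+2 (fun x => q x - q0 x) ord0 x hx) hM.
have h1 := le_trans (@Cnorm_01_ge m.+2 (fun x => q x - q0 x) 1 x hx) hM.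
rewrite /= lee_fin in h0; rewrite lee_fin derive1n1 in h1.
rewrite (rder_derive1 (rderB (class_C_rder x cq) (class_C_rder x cq0))) in h1.
have tri (a b : R) : `|a| <= `|a - b| + `|b| by rewrite -{1}(subrK b a) ler_normD.
split; first by apply: le_trans (tri _ (q0 x)) _; rewrite lerD ?hA.
by apply: le_trans (tri _ (derive1 q0 x)) _; rewrite lerD ?hB.
Qed.

(** Reflection exchanges the two endpoints, so that both measurements become
    the impedance at x = 0 of a wave leaving through x = 1. *)
Definition reflect (sd : side) x : R := if sd is side_plus then x else 1 - x.

Lemma reflect_01 sd x : 0 <= x <= 1 -> 0 <= reflect sd x <= 1.
Proof. by case: sd => //= /andP[h1 h2]; apply/andP; split; lra. Qed.

Lemma rder_reflect sd x : rder (reflect sd) x (sgn R sd).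
Proof.
case: sd => /=; first exact: rder_id.
by apply: rder_eq; [apply: rderB; [exact: rder_cst | exact: rder_id] | rewrite sub0r].
Qed.

Definition root_index q sd x : R := Num.sqrt (Num.sqrt (1 + q (reflect sd x))).
Definition log_slope q sd x : R :=
  sgn R sd * derive1 q (reflect sd x) / (4 * (1 + q (reflect sd x))).

Lemma root_index4 q sd x : 0 <= 1 + q (reflect sd x) -> root_index q sd x ^+ 4 = 1 + q (reflect sd x).
Proof. by move=> h; rewrite (exprM _ 2 2) !sqr_sqrtr // sqrtr_ge0. Qed.

Lemma rder_root_index m q sd x : class_C m.+1 q -> 0 < 1 + q (reflect sd x) ->
  rder (root_index q sd) x (log_slope q sd x * root_index q sd x).
Proof.
move=> cq h; have h2 : 0 < Num.sqrt (1 + q (reflect sd x)) by rewrite sqrtr_gt0.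
apply: rder_eq.
  apply: (@rder_comp R Num.sqrt); first exact: is_derive1_sqrt.
  apply: (@rder_comp R Num.sqrt); first exact: is_derive1_sqrt.
  apply: rderD; first exact: rder_cst.
  by apply: rder_comp (rder_reflect sd x); exact: class_C_rder cq.
rewrite /log_slope /root_index.
set a := 1 + _ in h h2 *; set b := Num.sqrt a in h2 *; set c := Num.sqrt b.
have c0 : 0 < c by rewrite sqrtr_gt0.
have ab : a = b ^+ 2 by rewrite sqr_sqrtr // ltW.
have bc : b = c ^+ 2 by rewrite sqr_sqrtr // ltW.
rewrite ab bc add0r; move: (sgn R sd) (derive1 _ _) => S D.
by field; rewrite !gt_eqF.
Qed.

Lemma exists_primitive (f : R -> R) : continuous f ->
  exists F : R -> R, F 0 = 0 /\ forall x, 0 <= x <= 1 -> rder F x (f x).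
Proof.
move=> cf.
pose G x := (\int[@lebesgue_measure R]_(t in `[(-1)%R, x]) (f t))%R.
exists (fun x => G x - G 0); split; first by rewrite subrr.
move=> x /andP[x0 x1]; rewrite -[f x]subr0; apply: rderB; last exact: rder_cst.
have int : (@lebesgue_measure R).-integrable `[(-1)%R, 2%R] (EFin \o f).
  apply: continuous_compact_integrable; first exact: segment_compact.
  exact: continuous_subspaceT.
have [] := @continuous_FTC1_closed R f (-1) x 2 _ int _ (cf x).
- lra.
- lra.
by move=> d e; rewrite -e derive1E; exact: derivableP.
Qed.

End Potentials.

(** * From scattering solutions to impedances *)
Section Measurements.
Variable R : realType.
Implicit Types (x y k : R) (q : R -> R).

Lemma medium_of_admissible m (M n0 Q0 Q1 : R) q0 q sd : 0 < n0 ->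
  admissible m.+1 M n0 q0 q ->
  (forall x, 0 <= x <= 1 -> `|q x| <= Q0 /\ `|derive1 q x| <= Q1) ->
  exists tau, medium (Num.sqrt (Num.sqrt n0)) (Num.sqrt (Num.sqrt (1 + Q0))) (Q1 / (4 * n0))
     (root_index q sd) (log_slope q sd) tau.
Proof.
move=> n00 [cq _ qn] bd.
have pos x : 0 < 1 + q (reflect sd x) by exact: lt_le_trans (qn _).
have dr x := rder_root_index (proj1 cq) (pos x).
have cr : continuous (fun x => root_index q sd x ^+ 2).
  by move=> x; exact: rder_continuous (rderX 1 (dr x)).
have [tau [tau0 dtau]] := exists_primitive cr.
have ends : root_index q sd 0 = 1 /\ root_index q sd 1 = 1.
  by rewrite /root_index; split; (rewrite (C0_01_zero cq) ?addr0 ?sqrtr1 //);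
    case: sd {pos dr cr tau dtau tau0} => /=; rewrite ?subr0 ?subrr ?lexx ?orbT.
exists tau; split => //.
- by rewrite !sqrtr_gt0.
- by move=> x _; do 2 apply: ler_wsqrtr.
- move=> x /(reflect_01 sd) /bd[h _]; do 2 apply: ler_wsqrtr.
  by rewrite lerD2l; apply: le_trans (ler_norm _) h.
- move=> x /(reflect_01 sd) /bd[_ h]; rewrite /log_slope normrM normfV.
  have Q10 : 0 <= Q1 by exact: le_trans (normr_ge0 _) h.
  apply: ler_pM => //.
    by rewrite normrM (_ : `|sgn R sd| = 1) ?mul1r //; case: (sd) => /=; rewrite ?normrN normr1.
  rewrite gtr0_norm ?mulr_gt0 // lef_pV2 ?posrE ?mulr_gt0 //.
  exact: ler_wpM2l.
- by case: ends.
- by case: ends.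
Qed.

Lemma cder_of_derivable (f : R -> R[i]) x :
  complex_derivable f x -> cder f x (complex_derive1 f x).
Proof.
by case=> h1 h2; split => /=; rewrite derive1E; exact: derivableP.
Qed.

Lemma complex_derive1_of_cder (f : R -> R[i]) x d : cder f x d -> complex_derive1 f x = d.
Proof.
by case=> h1 h2; apply: complexP => /=; [exact: rder_derive1 h1 | exact: rder_derive1 h2].
Qed.

Section Solution.
Variables (sd : side) (q : R -> R) (k : R) (phi : R -> R[i]).
Hypothesis k0 : k != 0.
Hypothesis sol : scattering_solution sd q k phi.

Let dphi x : cder phi x (complex_derive1 phi x).
Proof. by case: sol => h _ _ _; apply: cder_of_derivable; case: (h x). Qed.

Let ddphi x : cder (complex_derive1 phi) x (- ((k ^+ 2 * (1 + q x))%:C * phi x)).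
Proof.
case: sol => h e _ _; have := cder_of_derivable (proj2 (h x)).
by move/cder_eq; apply; apply/eqP; rewrite -addr_eq0; apply/eqP; exact: e.
Qed.

Let dpsi x : complex_derive1 (fun y => phi y - expi (sgn R sd * k * y)) x =
  complex_derive1 phi x - ii * (sgn R sd * k)%:C * expi (sgn R sd * k * x).
Proof.
apply: complex_derive1_of_cder; apply: cderB; first exact: dphi.
by apply: cder_expi; exact: rder_linear.
Qed.

Let iikE : Complex 0 k = ii * k%:C :> R[i].
Proof. by apply: complexP; rewrite !reimE /=; ring. Qed.

(** The incident wave is outgoing on the right for the sign plus only, and on
    the left for the sign minus only; the other condition keeps it as a nonzero
    source, which prevents the solution from vanishing. *)
Lemma outgoing_right x : 1 <= x -> complex_derive1 phi x - ii * k%:C * phi x =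
  ii * ((sgn R sd - 1) * k)%:C * expi (sgn R sd * k * x).
Proof.
case: sol => _ _ h _ /h; rewrite dpsi iikE => e.
rewrite mulrBl mul1r rmorphB.
by apply/eqP; rewrite -subr_eq0; apply/eqP; rewrite -[RHS]e; ring.
Qed.

Lemma outgoing_left x : x <= 0 -> complex_derive1 phi x + ii * k%:C * phi x =
  ii * ((sgn R sd + 1) * k)%:C * expi (sgn R sd * k * x).
Proof.
case: sol => _ _ _ h /h; rewrite dpsi iikE => e.
rewrite mulrDl mul1r rmorphD.
by apply/eqP; rewrite -subr_eq0; apply/eqP; rewrite -[RHS]e; ring.
Qed.

Let u x : R[i] := phi (reflect sd x).
Let v x : R[i] := (sgn R sd / k)%:C * (- ii * complex_derive1 phi (reflect sd x)).

Let sgn2 : sgn R sd * sgn R sd = 1.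
Proof. by case: (sd) => /=; ring. Qed.

Let ii2 : ii * ii = -1 :> R[i].
Proof. by apply: complexP; rewrite !reimE /=; ring. Qed.

Let kk : k%:C * (k^-1)%:C = 1 :> R[i].
Proof. by rewrite -rmorphM divff. Qed.

Let sgnC2 : (sgn R sd)%:C * (sgn R sd)%:C = 1 :> R[i].
Proof. by rewrite -rmorphM sgn2. Qed.

Lemma impedance_of_scattering nu rho sg tau (d : R -> R[i]) :
  medium nu rho sg (root_index q sd) (log_slope q sd) tau ->
  (forall x, 0 < 1 + q x) ->
  d k = impedance sd k phi (endpoint R sd) ->
  impedance_of (root_index q sd) (log_slope q sd) d k.
Proof.
move=> med qpos dk.
have du x : 0 <= x <= 1 -> cder u x (ii * k%:C * v x).
  move=> _; apply: cder_eq; first by apply: cder_comp (rder_reflect sd x); exact: dphi.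
  rewrite /v rmorphM /=; move: (complex_derive1 _ _) (sgn R sd)%:C => D S.
  rewrite [RHS](_ : _ = - (ii * ii) * (k%:C * (k^-1)%:C) * (D * S)); last by ring.
  by rewrite ii2 kk opprK !mul1r.
have dv x : 0 <= x <= 1 -> cder v x (ii * (k * root_index q sd x ^+ 4)%:C * u x).
  move=> _; apply: cder_eq.
    apply: cderM; first exact: cder_cst.
    apply: cderM; first exact: cder_cst.
    by apply: cder_comp (rder_reflect sd x); exact: ddphi.
  rewrite root_index4 ?(ltW (qpos _)) // /u !mul0r !add0r.
  rewrite !(rmorphM (real_complex R)) /=.
  have e := sgnC2; have e' := kk.
  move: (phi _) (sgn R sd)%:C (1 + q _)%:C e => P S Q e.
  rewrite [LHS](_ : _ = ii * (k%:C * Q) * P * (S * S) * (k%:C * (k^-1)%:C)); last by ring.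
  by rewrite e e' !mulr1.
have v1 x : v x = complex_derive1 phi (reflect sd x) * ((sgn R sd)%:C * - ii * (k^-1)%:C).
  by rewrite /v rmorphM /=; ring.
have uv1 : u 1 = v 1.
  have inv w : ii * k%:C * w * (- ii * (k^-1)%:C) = w.
    rewrite [LHS](_ : _ = - (ii * ii) * (k%:C * (k^-1)%:C) * w); last by ring.
    by rewrite ii2 kk opprK !mul1r.
  rewrite v1 /u; move: outgoing_right outgoing_left; case: (sd) => /= hr hl.
    have := hr 1 (lexx _); rewrite subrr mul0r mulr0 mul0r => /eqP; rewrite subr_eq0 => /eqP ->.
    by rewrite mul1r inv.
  rewrite subrr; have := hl 0 (lexx _); rewrite addNr mul0r mulr0 mul0r => /eqP.
  rewrite addr_eq0 => /eqP ->.
  have -> : (- (1 : R))%:C = - 1 :> R[i] by apply: complexP => //=; rewrite oppr0.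
  rewrite [RHS](_ : _ = ii * k%:C * phi 0 * (- ii * (k^-1)%:C)); last by ring.
  by rewrite inv.
have nz (c : R) w : ii * (c * k)%:C * expi w = 0 -> c = 0.
  move/eqP; rewrite !mulf_eq0 => /orP[/orP[|]|] /eqP h.
  - by case: h => /eqP; rewrite oner_eq0.
  - by case: h => /eqP; rewrite mulf_eq0 (negPf k0) orbF => /eqP.
  - by have := normc_expi w; rewrite h Normc.normc0 => /eqP; rewrite eq_sym oner_eq0.
have uv0 : u 0 != 0 \/ v 0 != 0.
  have [u0|] := eqVneq (u 0) 0; last by left.
  right; apply/eqP; rewrite v1 => v0.
  have d0 : complex_derive1 phi (reflect sd 0) = 0.
    move/eqP: v0; rewrite !mulf_eq0 => /orP[/eqP //|/orP[/orP[|]|]].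
    - move=> /eqP[] h; have := sgn2; rewrite h mul0r => /esym/eqP.
      by rewrite oner_eq0.
    - by rewrite oppr_eq0 => /eqP[] /eqP; rewrite oner_eq0.
    - by move=> /eqP[] /eqP; rewrite invr_eq0 (negPf k0).
  move: u0 d0 outgoing_right outgoing_left; rewrite /u; case: (sd) => /= u0 d0 hr hl.
    have := hl 0 (lexx _); rewrite u0 d0 mulr0 addr0 => /esym/nz; lra.
  rewrite subr0 in u0 d0.
  have := hr 1 (lexx _); rewrite u0 d0 mulr0 subr0 => /esym/nz; lra.
apply: (impedance_of_solution med du dv uv1 uv0).
rewrite dk /impedance iikE v1 /u.
have -> : endpoint R sd = reflect sd 0 by case: (sd) => //=; rewrite subr0.
have kn : k%:C != 0 :> R[i] by apply/eqP => -[] /eqP; rewrite (negPf k0).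
have ikE : (ii * k%:C)^-1 = - ii * (k^-1)%:C :> R[i].
  apply: (mulfI (_ : ii * k%:C != 0)).
    by rewrite mulf_neq0 //; apply/eqP => -[] /eqP; rewrite oner_eq0.
  rewrite mulfV; last by rewrite mulf_neq0 //; apply/eqP => -[] /eqP; rewrite oner_eq0.
  rewrite [RHS](_ : _ = - (ii * ii) * (k%:C * (k^-1)%:C)); last by ring.
  by rewrite ii2 kk opprK mul1r.
by rewrite invfM ikE; ring.
Qed.

End Solution.
End Measurements.

(** * Essential suprema of Lipschitz functions *)
Section EssentialSupremum.
Variable R : realType.
Local Notation mu := (@lebesgue_measure R).

Lemma lebesgue_measureT_gt0 : (0 < mu [set: R])%E.
Proof.
have -> : [set: R] = [set` `]-oo, +oo[] by apply/seteqP; split => x //= _; rewrite in_itv.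
by rewrite lebesgue_measure_itv /= adde_gt0 ?ltry.
Qed.

Lemma LinftyE (A : set R) (f : R -> R) :
  Linfty A f = ess_sup mu (fun x => `|((EFin \o f) \_ A) x|)%E.
Proof. by rewrite /Linfty unlock lebesgue_measureT_gt0. Qed.

Lemma Linfty_le (A : set R) (f : R -> R) (c : R) : 0 <= c ->
  (forall x, `|f x| <= c) -> (Linfty A f <= c%:E)%E.
Proof.
move=> c0 h; rewrite LinftyE; apply/ess_supP; apply: nearW => x.
by rewrite /patch; case: ifPn => _ /=; rewrite ?normr0 lee_fin.
Qed.

Lemma Linfty_ge0 (A : set R) (f : R -> R) : (0 <= Linfty A f)%E.
Proof.
rewrite LinftyE; apply: ess_sup_gee; first exact: lebesgue_measureT_gt0.
by apply: nearW => x; exact: abse_ge0.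
Qed.

Lemma Linfty_subset (A B : set R) (f : R -> R) : A `<=` B -> (Linfty A f <= Linfty B f)%E.
Proof.
move=> AB; rewrite !LinftyE; apply: le_ess_sup; apply: nearW => x.
rewrite /patch; case: ifPn => hA; last by rewrite abse0; exact: abse_ge0.
by rewrite ifT // inE; apply: AB; rewrite inE in hA.
Qed.

(** An essential bound is attained up to a null set, and intervals are not
    null. *)
Lemma Linfty_witness (A : set R) (f : R -> R) (c a b : R) : (Linfty A f <= c%:E)%E ->
  a < b -> (forall x, a < x < b -> A x) -> exists2 x, a < x < b & `|f x| <= c.
Proof.
rewrite LinftyE => /ess_supP h ab sub.
apply: contrapT => none.
have neg : mu.-negligible [set` `]a, b[].
  apply: negligibleS h => x /=; rewrite in_itv /= => hx; apply/negP; rewrite -ltNge.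
  rewrite /patch ifT /=; last by rewrite inE; exact: sub.
  by rewrite lte_fin ltNge; apply/negP => hc; apply: none; exists x.
have : mu [set` `]a, b[] = 0 by apply/negligibleP => //; exact: measurable_itv.
rewrite lebesgue_measure_itv /= lte_fin ab -EFinD => -[] /eqP.
by rewrite subr_eq0 gt_eqF.
Qed.

Lemma Linfty_pointwise (A : set R) (f : R -> R) (c K k : R) :
  (forall x y, 0 < x -> 0 < y -> `|f x - f y| <= K * `|x - y|) ->
  (Linfty A f <= c%:E)%E -> 0 < k -> (forall x, 0 < x < k -> A x) -> f k <= c.
Proof.
move=> lip hc k0 sub; apply/ler_addgt0Pr => e e0.
pose d := Num.min k (e / (`|K| + 1)).
have K1 : 0 < `|K| + 1 by rewrite ltr_pwDr.
have d0 : 0 < d by rewrite lt_min k0 divr_gt0.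
have dk : d <= k by rewrite ge_min lexx.
have de : d * (`|K| + 1) <= e by rewrite -ler_pdivlMr // ge_min lexx orbT.
have [||x /andP[x1 x2] hx] := @Linfty_witness A f c (k - d) k hc.
- by lra.
- by move=> x /andP[x1 x2]; apply: sub; rewrite x2 andbT; lra.
have x0 : 0 < x by lra.
have := lip k x k0 x0; rewrite (@gtr0_norm _ (k - x)) ?subr_gt0 // => h.
have h1 := ler_norm (f k - f x); have h2 := ler_norm (f x).
have h3 : K * (k - x) <= `|K| * d.
  apply: le_trans (ler_wpM2r _ (ler_norm K)) _; first by rewrite subr_ge0 ltW.
  by apply: ler_wpM2l => //; lra.
move: de; rewrite mulrDr mulr1 [d * _]mulrC; lra.
Qed.

End EssentialSupremum.

(** * Hoelder stability of the potential *)
Section PotentialStability.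
Variable R : realType.
Implicit Types (x k : R).

(** The logarithmic loss of the Fejer kernel is absorbed by giving up the
    fraction 1 / (m + 1) of the exponent. *)
Lemma log_loss_le_power (m : nat) (eps : R) : 0 < eps <= 1 ->
  eps * (3 - ln eps) <= (m%:R + 4) * eps `^ (m%:R / m.+1%:R).
Proof.
case/andP=> e0 e1; set l := - ln eps.
have l0 : 0 <= l by rewrite oppr_ge0 ln_le0.
have m1 : (0 : R) < m.+1%:R by rewrite ltr0n.
have epsE : eps = expR (- l) by rewrite /l opprK lnK ?posrE.
have -> : eps `^ (m%:R / m.+1%:R) = expR (- l) * expR (l / m.+1%:R).
  rewrite /powR gt_eqF // -expRD /l; congr expR.
  rewrite -(natr1 m) ; field; by rewrite natr1 gt_eqF.
rewrite {1}epsE mulrCA; apply: ler_wpM2l; first exact: expR_ge0.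
have h : 1 + l / m.+1%:R <= expR (l / m.+1%:R) by exact: expR_ge1Dx.
have h1 : m.+1%:R * (1 + l / m.+1%:R) <= m.+1%:R * expR (l / m.+1%:R).
  by apply: ler_wpM2l => //; exact: ltW.
have h2 : m.+1%:R * (l / m.+1%:R) = l by field; rewrite gt_eqF.
have h3 : 0 <= l / m.+1%:R by rewrite divr_ge0 // ltW.
move: h1; rewrite mulrDr mulr1 h2 -(natr1 m).
have m0 : (0 : R) <= m%:R by [].
nra.
Qed.

Variables (nu rho sg : R) (r s tau r' s' tau' : R -> R).
Hypotheses (med : medium nu rho sg r s tau) (med' : medium nu rho sg r' s' tau').
Variables d d' : R -> R[i].
Hypothesis imp : forall k, 0 < k -> impedance_of r s d k.
Hypothesis imp' : forall k, 0 < k -> impedance_of r' s' d' k.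
Local Notation b := (amplitude_cst sg).

Definition contrast_cst (nu rho sg : R) (m : nat) : R :=
  `|stability_cst nu rho sg| * ((amplitude_cst sg ^+ 2 + 1) * (m%:R + 4)).

(** The number of probing frequencies is of the order of 1 / eps. *)
Lemma contrast_hoelder (m : nat) (eps : R) : 0 < eps <= 1 ->
  (forall k, 0 < k -> normc (d k - d' k) <= eps) ->
  forall x, 0 <= x <= 1 ->
  `|contrast r r' x| <= contrast_cst nu rho sg m * eps `^ (m%:R / m.+1%:R).
Proof.
move=> he small x hx; have /andP[e0 e1] := he.
have b1 : 1 <= b ^+ 2 by apply: exprn_ege1; exact: amplitude_cst_ge1 med.
have pos k : 0 < k -> exists al be al' be', [/\ mode r s k al be, mode r' s' k al' be'
    & normc (mode_defect al be al' be' 0) <= b ^+ 2 * eps].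
  move=> k0; have [al [be [mo E]]] := imp k0; have [al' [be' [mo' E']]] := imp' k0.
  exists al, be, al', be'; split => //.
  have [h _] := defect_impedance med med' mo mo'; rewrite -E -E' in h.
  apply: le_trans h _; apply: ler_wpM2l; first by rewrite (le_trans ler01).
  exact: small.
have data k : k != 0 -> exists al be al' be', [/\ mode r s k al be, mode r' s' k al' be'
    & normc (mode_defect al be al' be' 0) <= b ^+ 2 * eps].
  rewrite neq_lt => /orP[kn|]; last exact: pos.
  have [al [be [al' [be' [h1 h2 h3]]]]] := pos (- k) ltac:(by rewrite oppr_gt0).
  exists (fun x => conjc (al x)), (fun x => conjc (be x)),
    (fun x => conjc (al' x)), (fun x => conjc (be' x)).
  split; [by rewrite -[k]opprK; exact: mode_conj | by rewrite -[k]opprK; exact: mode_conj |].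
  rewrite (_ : mode_defect _ _ _ _ 0 = conjc (mode_defect al be al' be' 0)) ?normc_conj //.
  rewrite /mode_defect; move: (al 0) (be 0) (al' 0) (be' 0) => [a1 a2] [b1' b2'] [c1 c2] [d1 d2].
  by apply: complexP; rewrite !reimE /=; ring.
have iv0 : 0 < eps^-1 by rewrite invr_gt0.
have /andP[N1 N2] := truncn_itv (ltW iv0); set N := (Num.truncn eps^-1).+1 in N2.
have N0 : (0 : R) < N%:R by rewrite ltr0n.
have iN : N%:R^-1 <= eps by rewrite -[leRHS]invrK lef_pV2 ?posrE // ltW.
have Nle : N%:R <= 2 / eps.
  have : 1 <= eps^-1 by rewrite invf_ge1.
  by rewrite /N -natr1; lra.
have be0 : 0 <= b ^+ 2 * eps by rewrite mulr_ge0 ?(ltW e0) // (le_trans ler01).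
have := contrast_stability med med' (ltn0Sn (Num.truncn eps^-1)) be0 data hx.
rewrite -/N => h; apply: (le_trans h).
have lnN : 1 + ln N%:R <= 3 - ln eps.
  have h1 : ln N%:R <= ln (2 / eps) by rewrite ler_ln ?posrE ?divr_gt0.
  rewrite ln_div ?posrE // in h1; have := @ln_sublinear R 2 ltac:(lra); lra.
have N1' : (1 : R) <= N%:R by rewrite ler1n.
have l0 : 0 <= ln N%:R :> R by rewrite ln_ge0.
rewrite /contrast_cst -[leRHS]mulrA; apply: (@le_trans _ _ (`|stability_cst nu rho sg| *
   ((b ^+ 2 * eps + N%:R^-1) * (1 + ln N%:R)))).
  apply: ler_wpM2r; last exact: ler_norm.
  by rewrite mulr_ge0 ?addr_ge0 // invr_ge0 ltW.
apply: ler_wpM2l => //.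
apply: (@le_trans _ _ ((b ^+ 2 + 1) * (eps * (3 - ln eps)))).
  rewrite mulrA; apply: ler_pM => //; rewrite ?addr_ge0 ?invr_ge0 ?(ltW N0) //.
  by rewrite mulrDl mul1r lerD2l.
rewrite -[leRHS]mulrA; apply: ler_wpM2l; first by rewrite addr_ge0 // (le_trans ler01).
exact: log_loss_le_power.
Qed.

Lemma contrast_potential x : 0 <= x <= 1 ->
  `|r x ^+ 4 - r' x ^+ 4| <= 2 * rho ^+ 4 * `|contrast r r' x|.
Proof.
move=> hx; have p := medium_r_gt0 med hx; have p' := medium_r_gt0 med' hx.
have -> : r x ^+ 4 - r' x ^+ 4 = (r x * r' x) * (r x ^+ 2 + r' x ^+ 2) * contrast r r' x.
  by rewrite /contrast; field; rewrite !gt_eqF.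
have q := medium_le med hx; have q' := medium_le med' hx.
have s2 := medium_r2_le med hx; have s2' := medium_r2_le med' hx.
have rr : r x * r' x <= rho ^+ 2 by rewrite expr2; apply: ler_pM => //; exact: ltW.
rewrite normrM; apply: ler_wpM2r => //.
rewrite ger0_norm; last by rewrite mulr_ge0 ?addr_ge0 ?sqr_ge0 // mulr_ge0 // ltW.
rewrite (_ : 2 * rho ^+ 4 = rho ^+ 2 * (rho ^+ 2 + rho ^+ 2)); last by ring.
by apply: ler_pM; rewrite ?addr_ge0 ?sqr_ge0 ?lerD // mulr_ge0 // ltW.
Qed.

End PotentialStability.

Section HoelderStability.
Variable R : realType.
Implicit Types (x k : R).

(** The value eta = 0, at which the logarithm gives no information, is reached
    from the positive ones: the power 0 of the limit is 0. *)
Lemma le_powR_limit (A C eta p : R) : 0 <= eta < 1 -> 0 < p -> 0 <= C ->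
  (forall y, 0 < y < 1 -> eta <= y -> A <= C * y `^ p) -> A <= C * eta `^ p.
Proof.
case/andP=> eta0 eta1 p0 C0 H; move: eta0; rewrite le_eqVlt => /predU1P[e0|e0]; last first.
  by apply: H => //; rewrite e0.
rewrite -e0 powR0 ?gt_eqF // mulr0 leNgt; apply/negP => A0.
pose y := Num.min (1 / 2) (A / (2 * (C + 1))).
have C1 : 0 < 2 * (C + 1) by lra.
have y0 : 0 < y by rewrite lt_min !divr_gt0.
have y1 : y < 1 by rewrite gt_min; apply/orP; left; lra.
have yA : y * (2 * (C + 1)) <= A by rewrite -ler_pdivlMr // ge_min lexx orbT.
have z0 : 0 < y `^ p^-1 by exact: powR_gt0.
have zp : (y `^ p^-1) `^ p = y by rewrite -powRrM mulVf ?gt_eqF // powRr1 // ltW.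
have z1 : y `^ p^-1 < 1.
  rewrite (_ : 1 = 1 `^ p^-1); last by rewrite powR1.
  apply: gt0_ltr_powR => //; rewrite ?nnegrE ?(ltW y0) //.
  by rewrite invr_gt0.
have := H (y `^ p^-1); rewrite z0 z1 -e0 zp => /(_ isT (ltW z0)); nra.
Qed.

Variables (nu rho sg : R) (r s tau r' s' tau' : R -> R).
Hypotheses (med : medium nu rho sg r s tau) (med' : medium nu rho sg r' s' tau').
Variables d d' : R -> R[i].
Hypothesis imp : forall k, 0 < k -> impedance_of r s d k.
Hypothesis imp' : forall k, 0 < k -> impedance_of r' s' d' k.

(** Continuity turns essential suprema of the difference of the measurements
    into pointwise bounds. *)
Lemma dist_meas_lipschitz : exists K, forall x y, 0 < x -> 0 < y ->
  `|dist_meas d d' x - dist_meas d d' y| <= K * `|x - y|.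
Proof.
eexists => x y x0 y0; rewrite /dist_meas.
have h := impedance_lipschitz med (imp x0) (imp y0).
have h' := impedance_lipschitz med' (imp' x0) (imp' y0).
have t1 : normc (d x - d' x) <= normc (d y - d' y) + normc ((d x - d y) - (d' x - d' y)).
  apply: (le_trans _ (normcD _ _)); rewrite le_eqVlt; apply/orP; left.
  by apply/eqP; congr normc; ring.
have t2 : normc (d y - d' y) <= normc (d x - d' x) + normc ((d x - d y) - (d' x - d' y)).
  rewrite -(normcN ((d x - d y) - _)).
  apply: (le_trans _ (normcD _ _)); rewrite le_eqVlt; apply/orP; left.
  by apply/eqP; congr normc; ring.
have t3 := normcB (d x - d y) (d' x - d' y).
apply: (le_trans _ (_ : normc ((d x - d y) - (d' x - d' y)) <= _)).
  by rewrite ler_norml; lra.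
apply: (le_trans t3); apply: (le_trans (lerD h h')).
by rewrite -mulrDl.
Qed.

Definition hoelder_cst (nu rho sg : R) (m : nat) : R :=
  2 * rho ^+ 4 * (contrast_cst nu rho sg m * Num.max 1 (propagation_cst nu rho sg)).

Lemma contrast_cst_ge0 m : 0 <= contrast_cst nu rho sg m.
Proof.
by apply: mulr_ge0 => //; apply: mulr_ge0; apply: addr_ge0 => //; exact: sqr_ge0.
Qed.

Lemma hoelder_cst_ge0 m : 0 <= hoelder_cst nu rho sg m.
Proof.
rewrite /hoelder_cst; apply: mulr_ge0; first by rewrite mulr_ge0 // exprn_even_ge0.
by apply: mulr_ge0; [exact: contrast_cst_ge0 | rewrite le_max ler01].
Qed.

(** The extrapolation bounds the largest difference of the measurements, taken
    at ks, by a power of the one below k0; the stability estimate for all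
    frequencies applies to the former. *)
Lemma potential_hoelder (m n : nat) ks k0 eta : (400 <= n)%N ->
  0 < k0 -> 0 < ks -> 0 < eta < 1 ->
  (forall k, 0 < k <= k0 -> dist_meas d d' k <= eta) ->
  (forall k, 0 < k -> dist_meas d d' k <= dist_meas d d' ks) ->
  dist_meas d d' ks <= 1 ->
  forall x, 0 <= x <= 1 ->
  `|r x ^+ 4 - r' x ^+ 4| <=
    hoelder_cst nu rho sg m * eta `^ (m%:R / m.+1%:R * hoelder_exponent n ks k0).
Proof.
move=> n400 k00 ks0 heta small top le1 x hx.
have /andP[eta0 eta1] := heta.
set w := hoelder_exponent n ks k0; set mu := m%:R / m.+1%:R.
set K := Num.max 1 (propagation_cst nu rho sg).
have K1 : 1 <= K by rewrite le_max lexx.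
have K0 : 0 < K by exact: lt_le_trans K1.
have w1 : w <= 1 by exact: hoelder_exponent_le1.
have etaw (a : R) : 0 < eta `^ a by exact: powR_gt0.
have bound : dist_meas d d' ks <= K * eta `^ w.
  have [h|h] := leP ks k0.
    apply: (le_trans (small ks _)); first by rewrite ks0.
    rewrite /w hoelder_exponent_diag // powRr1 ?(ltW eta0) //.
    by rewrite ler_peMl // ltW.
  have /= := hoelder_exponent_rate n400 k00 h; set z := 1 + _; set e := z + _ => -[th1 th2 th3].
  apply: (le_trans (propagation_power med med' imp imp' k00 h heta small le1 th1 th2)).
  apply: (@le_trans _ _ (K * expR ((Num.max 1 (z ^+ 2 / 2))^-1 / e * ln eta))).
    by apply: ler_wpM2r; [exact: expR_ge0 | rewrite le_max lexx orbT].
  apply: ler_wpM2l; first exact: ltW.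
  rewrite /powR gt_eqF // ler_expR ler_wnM2r //.
  by rewrite ln_le0 // ltW.
pose eps := Num.min 1 (K * eta `^ w).
have eps0 : 0 < eps <= 1 by rewrite lt_min ltr01 mulr_gt0 //= ge_min lexx.
have epsd k : 0 < k -> normc (d k - d' k) <= eps.
  by move=> k0'; apply: (le_trans (top k k0')); rewrite le_min le1.
have mu01 : 0 <= mu <= 1.
  have m1 : (0 : R) < m.+1%:R by rewrite ltr0n.
  by rewrite divr_ge0 //= ler_pdivrMr // mul1r ler_nat.
have /andP[mu0 mu1] := mu01.
have epsmu : eps `^ mu <= K * eta `^ (mu * w).
  apply: (@le_trans _ _ ((K * eta `^ w) `^ mu)).
    have /andP[e0 _] := eps0; have e1 : 0 <= K * eta `^ w by rewrite ltW // mulr_gt0.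
    by apply: ge0_ler_powR; rewrite ?nnegrE ?(ltW e0) // ge_min lexx orbT.
  rewrite powRM ?(ltW K0) ?(ltW (etaw _)) // -powRrM [w * mu]mulrC.
  apply: ler_wpM2r; first exact: ltW.
  by rewrite -[leRHS]powRr1 ?(ltW K0) //; exact: ler_powR.
apply: (le_trans (contrast_potential med med' hx)).
rewrite /hoelder_cst -[leRHS]mulrA; apply: ler_wpM2l.
  by rewrite mulr_ge0 // exprn_even_ge0.
apply: (le_trans (contrast_hoelder med med' imp imp' m eps0 epsd hx)).
by rewrite -[leRHS]mulrA; apply: ler_wpM2l => //; exact: contrast_cst_ge0.
Qed.

End HoelderStability.

(** * Stability over the admissible potentials *)

Unset Implicit Arguments.
Set Strict Implicit.
Local Close Scope complex_scope.

Theorem theorem1p1 (R : realType) (m : nat) (M n0 : R) (q0 : R -> R)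
    (hm : (4 <= m)%N) (hM : 0 < M) (hn0 : 0 < n0 < 1)
    (hq0 : C0_01 m.+1 q0) (hq0n0 : forall x, n0 <= 1 + q0 x) :
  exists (c : R) (n : nat) (w0 : R -> R -> R),
    [/\ 0 < c, (1 <= n)%N,
        {within [set z : R * R | 0 < z.1 /\ 0 < z.2],
          continuous (fun z : R * R => w0 z.1 z.2)},
        forall kstar k0 : R, 0 < kstar -> 0 < k0 <= kstar ->
          w0_lower n kstar k0 <= w0 kstar k0 <= w0_upper n kstar k0
      & forall (q q' : R -> R) (s : side) (d d' : R -> R[i]) (kstar : R),
          admissible m M n0 q0 q -> admissible m M n0 q0 q' ->
          boundary_measurement s q d -> boundary_measurement s q' d' ->
          (Linfty `]0%R, +oo[ (dist_meas d d') < 1)%E ->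
          0 < kstar ->
          (dist_meas d d' kstar)%:E = Linfty `]0%R, +oo[ (dist_meas d d') ->
          (forall k : R, 0 <= k ->
             (dist_meas d d' k)%:E = Linfty `]0%R, +oo[ (dist_meas d d') ->
             kstar <= k) ->
          forall k0 : R, 0 < k0 ->
            (Linfty setT (fun x => q x - q' x)%R <=
             c%:E * Linfty `]0%R, k0[ (dist_meas d d')
                    `^ (m%:R / m.+1%:R * w0 kstar k0))%E].
Proof.
case: m hm hq0 => // m' hm' hq0'; have [n00 n01] := andP hn0.
have [Q0 [Q1 bounds]] := admissible_bounds M n0 hq0'.
pose nu := Num.sqrt (Num.sqrt n0); pose rho := Num.sqrt (Num.sqrt (1 + Q0)).
pose sg := Q1 / (4 * n0); pose K := hoelder_cst nu rho sg m'.+1.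
(* The constant depends on n0, m, M and q0 only; 1 is added to make it
   positive. *)
exists (`|K| + 1), 400%N, (hoelder_exponent 400); split => //.
- exact: hoelder_exponent_continuous.
- move=> ks k0 ks0 /andP[k00 k0s].
  by rewrite hoelder_exponent_lower // lexx /=; exact: hoelder_exponent_upper.
move=> q q' sd d d' ks aq aq' [bq _ _] [bq' _ _] lt1 ks0 top _ k0 k00.
have [tau med] := medium_of_admissible sd n00 aq (bounds _ aq).
have [tau' med'] := medium_of_admissible sd n00 aq' (bounds _ aq').
have [[cq _ qn] [cq' _ qn']] := (aq, aq').
have pos x : 0 < 1 + q x by exact: lt_le_trans (qn x).
have pos' x : 0 < 1 + q' x by exact: lt_le_trans (qn' x).
have imp k : 0 < k -> impedance_of (root_index q sd) (log_slope q sd) d k.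
  move=> kp; have kn : k != 0 by rewrite gt_eqF.
  by have [phi sol dE] := bq k kn; exact: (impedance_of_scattering kn sol med pos dE).
have imp' k : 0 < k -> impedance_of (root_index q' sd) (log_slope q' sd) d' k.
  move=> kp; have kn : k != 0 by rewrite gt_eqF.
  by have [phi sol dE] := bq' k kn; exact: (impedance_of_scattering kn sol med' pos' dE).
have [lip hlip] := dist_meas_lipschitz med med' imp imp'.
have maxi k : 0 < k -> dist_meas d d' k <= dist_meas d d' ks.
  move=> kp; apply: (Linfty_pointwise hlip _ kp (A := `]0, +oo[%classic)).
    by rewrite top.
  by move=> x /andP[x0 _]; rewrite /= in_itv /= x0.
have sub : (Linfty `]0%R, k0[ (dist_meas d d') <= (dist_meas d d' ks)%:E)%E.
  by rewrite top; apply: Linfty_subset => x /=; rewrite !in_itv /= andbT => /andP[].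
have ge0 := Linfty_ge0 `]0, k0[ (dist_meas d d').
rewrite -top lte_fin in lt1.
case E : (Linfty `]0, k0[ (dist_meas d d')) ge0 sub => [eta| |] //.
rewrite !lee_fin => eta0 eta_le; rewrite poweR_EFin -EFinM.
set w := hoelder_exponent 400 ks k0.
have p0 : 0 < m'.+1%:R / m'.+2%:R * w.
  by rewrite mulr_gt0 ?divr_gt0 ?ltr0n //; exact: hoelder_exponent_gt0.
have small k : 0 < k <= k0 -> dist_meas d d' k <= eta.
  case/andP=> kp kk; apply: (Linfty_pointwise hlip _ kp (A := `]0, k0[%classic)).
    by rewrite E.
  by move=> x /andP[x0 xk]; rewrite /= in_itv /= x0 (lt_le_trans xk).
have K0 : 0 <= K by exact: hoelder_cst_ge0.
have final x : `|q x - q' x| <= (`|K| + 1) * eta `^ (m'.+1%:R / m'.+2%:R * w).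
  have [h|h] := boolP ((x <= 0) || (1 <= x)).
    rewrite (C0_01_zero cq h) (C0_01_zero cq' h) subrr normr0.
    by apply: mulr_ge0; [rewrite addr_ge0 | exact: powR_ge0].
  have hx : 0 <= reflect sd x <= 1.
    by apply: reflect_01; move: h; rewrite negb_or -!ltNge => /andP[h1 h2]; rewrite !ltW.
  have inv : reflect sd (reflect sd x) = x by case: (sd) => //=; ring.
  apply: (@le_trans _ _ (K * eta `^ (m'.+1%:R / m'.+2%:R * w))); last first.
    apply: ler_wpM2r; first exact: powR_ge0.
    by apply: le_trans (ler_norm K) _; rewrite lerDl.
  (* The extrapolation needs a positive bound, hence the passage to y > eta. *)
  apply: le_powR_limit => //; first by rewrite eta0 (le_lt_trans eta_le).
  move=> y hy ey.
  have small' k : 0 < k <= k0 -> dist_meas d d' k <= y.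
    by move=> hk; apply: le_trans ey; exact: small.
  have := potential_hoelder med med' imp imp' m'.+1 (leqnn 400) k00 ks0 hy small' maxi (ltW lt1) hx.
  rewrite !root_index4 inv ?(ltW (pos _)) ?(ltW (pos' _)) //.
  by rewrite (_ : 1 + q x - (1 + q' x) = q x - q' x) //; ring.
apply: Linfty_le; last exact: final.
exact: le_trans (normr_ge0 _) (final 0).
Qed.
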